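(* Let $\mu_1,\mu_2,\lambda>0$, $p_1,p_2\ge0$ with $p_1+p_2=1$, and let $K\in\{1,2,\dots\}\cup\{\infty\}$; if $K=\infty$ assume $2\lambda<\mu_1+\mu_2$. Let $\pi$ be the invariant distribution of the asymmetric join-the-shortest-queue process with capacity $K$. When $K=\infty$, the quantity $\pi(K,K)$ (and hence the term $x^K\pi(K,K)$) must be replaced by $0$ below. Let $g_1,g_2,A_1,A_2$ be as defined in the context. (i) $\pi$ is determined by its values $\pi(k,0)$ and $\pi(0,k)$ for $0\le k<K+1$, through the following expressions. For $0\le j<k<K+1$, $$\pi(k,j)=\frac{\mu_2}{\mu_1}\sum_{l=k}^K\pi(l,0)\left(g_1^{\ast(l-k+1)}(j)-g_1^{\ast(l-k+1)}(j+1)\right),$$ $$\pi(j,k)=\frac{\mu_1}{\mu_2}\sum_{l=k}^K\pi(0,l)\left(g_2^{\ast(l-k+1)}(j)-g_2^{\ast(l-k+1)}(j+1)\right).$$ For $0\le k<K$, $$\pi(k,k)=-\frac1{2\lambda}\sum_{l=k+1}^K\left(\mu_2\,\pi(l,0)\,g_1^{\ast(l-k)}(k+1)+\mu_1\,\pi(0,l)\,g_2^{\ast(l-k)}(k+1)\right),$$ and for $K<\infty$, $$\pi(K,K)=\frac{2\lambda}{\mu_1+\mu_2}\left(\frac{\mu_2}{\mu_1}\pi(K,0)\big(g_1(K-1)-g_1(K)\big)+\frac{\mu_1}{\mu_2}\pi(0,K)\big(g_2(K-1)-g_2(K)\big)\right).$$ (ii) The sequences $(\pi(k,0),\,0\le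 k<K+1)$ and $(\pi(0,k),\,0\le k<K+1)$ are characterized, up to some (common) multiplicative constant, by the following relations holding for $x\in\mathbb C$ with $|x|$ sufficiently small: $$\frac{\mu_2}{y_1-z_1}\Big((y_1-x)A_1(y_1)-(z_1-x)A_1(z_1)\Big)=\mu_2\,x^K\pi(K,K)+\frac{\mu_2+2p_1\lambda x}{2\lambda}\left(\mu_1\frac{A_1(y_1)-A_1(z_1)}{y_1-z_1}+\mu_2\frac{A_2(y_2)-A_2(z_2)}{y_2-z_2}\right)$$ and $$\frac{\mu_1}{y_2-z_2}\Big((y_2-x)A_2(y_2)-(z_2-x)A_2(z_2)\Big)=\mu_1\,x^K\pi(K,K)+\frac{\mu_1+2p_2\lambda x}{2\lambda}\left(\mu_1\frac{A_1(y_1)-A_1(z_1)}{y_1-z_1}+\mu_2\frac{A_2(y_2)-A_2(z_2)}{y_2-z_2}\right),$$ where for $x\in\mathbb C$, $y_1,z_1$ are the roots of the polynomial $p_{x,1}(Y)=\mu_2Y^2-(2\lambda+\mu_1+\mu_2)xY+(\mu_1+2\lambda x)x$ and $y_2,z_2$ are the roots of the polynomial $p_{x,2}(Y)=\mu_1Y^2-(2\lambda+\mu_1+\mu_2)xY+(\mu_2+2\lambda x)x$. (iii) The characterization of $(\pi(k,0),\,0\le k<K+1)$ and $(\pi(0,k),\,0\le k<K+1)$ is complete with the following normalization relation: $$\mu_2A_1(1)+\mu_1A_2(1)=\mu_1+\mu_2-2\lambda\,(1-\pi(K,K)).$$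
   Context: $\mathbb N=\{0,1,2,\dots\}$. For $\varphi,\psi:\mathbb N\to\mathbb C$, $(\varphi\ast\psi)(n)=\sum_{m=0}^n\varphi(m)\psi(n-m)$, and for $k\ge1$, $\varphi^{\ast k}$ is the $k$-fold convolution of $\varphi$ with itself ($\varphi^{\ast1}=\varphi$). Asymmetric JSQ model: two one-server queues of common capacity $K$ (finite or infinite) with exponential service times of rates $\mu_1$ (queue 1) and $\mu_2$ (queue 2); customers arrive according to a Poisson process of parameter $2\lambda$ and join the shortest queue, or queue $i$ with probability $p_i$ ($i=1,2$) if both lengths are equal; if $K<\infty$, customers arriving when both queues have length $K$ are lost. The queue-length process $(L_1,L_2)$ is the continuous-time Markov chain on $\{(j,k)\in\mathbb N^2:\ j,k<K+1\}$ with rates: from $(j,k)$ to $(j-1,k)$ at rate $\mu_1$ if $j>0$; from $(j,k)$ to $(j,k-1)$ at rate $\mu_2$ if $k>0$; from $(j,k)$ with $j<k$ to $(j+1,k)$ at rate $2\lambda$; from $(j,k)$ with $j>k$ to $(j,k+1)$ at rate $2\lambda$; from $(k,k)$ with $k<K$ to $(k+1,k)$ at rate $2\lambda p_1$ and to $(k,k+1)$ at rate $2\lambda p_2$. When $K=\infty$ the condition $2\lambda<\mu_1+\mu_2$ makes the process ergodic. $\pi$ is its unique invariant probability distribution. The functions $g_1,g_2$ on $\mathbb N$ are $$g_1(j)=-\frac{\mu_1}{\mu_2}\,\frac{\xi_{1+}^j-\xi_{1-}^j}{\xi_{1+}-\xi_{1-}},\qquad g_2(j)=-\frac{\mu_2}{\mu_1}\,\frac{\xi_{2+}^j-\xi_{2-}^j}{\xi_{2+}-\xi_{2-}},$$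 where $\xi_{1+},\xi_{1-}$ are the roots of $\mu_2X^2-(2\lambda+\mu_1+\mu_2)X+2\lambda$ and $\xi_{2+},\xi_{2-}$ those of $\mu_1X^2-(2\lambda+\mu_1+\mu_2)X+2\lambda$. Since $g_i(0)=0$, $g_i^{\ast m}(j)=0$ for $j<m$, so when $K=\infty$ the sums in (i) have finitely many nonzero terms. The generating functions are $A_1(y)=\sum_{k=0}^K\pi(k,0)y^k$ and $A_2(y)=\sum_{k=0}^K\pi(0,k)y^k$. Quotients with denominator $y_i-z_i$ are understood by continuity when $y_i=z_i$.
   Formalization: For K=∞, candidates in (ii),(iii) are sequences whose array rebuilt by (i) is absolutely summable (uniqueness fails among all sequences); in (iii), if π(K,K) is read as its expression (i) in the candidate, 2λ≠μ1+μ2 is required, as otherwise every multiple of π qualifies. *)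

(* Defs.v *)
(* Stdlib reals with Coquelicot. *)
From Stdlib Require Import Reals Arith Bool.
From Coquelicot Require Import Coquelicot.
Open Scope R_scope.

(* A capacity is [Some n] (finite, equal to n) or [None] (infinite), and
   [in_cap K k] is "k < K + 1". *)
Definition in_cap (K : option nat) (k : nat) : bool :=
  match K with Some n => (k <=? n)%nat | None => true end.

(** * The Markov chain *)

(* Transition rate from (j, k) to (j', k'), for (j, k) <> (j', k'). *)
Definition rate (K : option nat) (lam mu1 mu2 p1 p2 : R)
    (j k j' k' : nat) : R :=
  if (S j' =? j)%nat && (k' =? k)%nat then mu1
  else if (j' =? j)%nat && (S k' =? k)%nat then mu2
  else if (j' =? S j)%nat && (k' =? k)%nat then
    if (j <? k)%nat then 2 * lam
    else if (j =? k)%nat && in_cap K (S k) then 2 * lam * p1 else 0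
  else if (j' =? j)%nat && (k' =? S k)%nat then
    if (k <? j)%nat then 2 * lam
    else if (j =? k)%nat && in_cap K (S k) then 2 * lam * p2 else 0
  else 0.

Definition sum2 (f : nat -> nat -> R) : R := Series (fun j => Series (f j)).

(* Meant for nonnegative f, for which it is summability over nat * nat. *)
Definition summable2 (f : nat -> nat -> R) : Prop :=
  (forall j, ex_series (f j)) /\ ex_series (fun j => Series (f j)).

(* A distribution on the states is a function on nat * nat vanishing off the
   state space. The rates being bounded, it is invariant iff pi Q = 0, i.e. iff
   at each state the inflow (a sum with finitely many nonzero terms) is equal
   to the outflow. *)
Definition is_invariant_distribution (K : option nat)
    (lam mu1 mu2 p1 p2 : R) (pi : nat -> nat -> R) : Prop :=
  (forall j k, 0 <= pi j k) /\
  (forall j k, in_cap K j && in_cap K k = false -> pi j k = 0) /\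
  summable2 pi /\ sum2 pi = 1 /\
  (forall j k, in_cap K j = true -> in_cap K k = true ->
     sum2 (fun j' k' => pi j' k' * rate K lam mu1 mu2 p1 p2 j' k' j k)
     = pi j k * sum2 (rate K lam mu1 mu2 p1 p2 j k)).

Open Scope C_scope.

(** * Convolution, and the functions g_1, g_2 *)

Definition conv (phi psi : nat -> C) (n : nat) : C :=
  sum_n (fun m => phi m * psi (n - m)%nat) n.

(* The zeroth power is the unit of convolution. *)
Fixpoint conv_pow (phi : nat -> C) (k : nat) : nat -> C :=
  match k with
  | O => fun n => match n with O => 1 | S _ => 0 end
  | S k' => conv phi (conv_pow phi k')
  end.

(* y and z are the roots, with multiplicity, of a Y^2 + b Y + c. *)
Definition roots2 (a b c y z : C) : Prop :=
  forall Y : C, a * Y ^ 2 + b * Y + c = a * ((Y - y) * (Y - z)).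

(* g_1 for r = mu1 / mu2 and the roots xi_{1+}, xi_{1-};
   g_2 for r = mu2 / mu1 and the roots xi_{2+}, xi_{2-}. *)
Definition g_fun (r xip xim : C) (j : nat) : C :=
  - r * ((xip ^ j - xim ^ j) / (xip - xim)).

(** * The expressions of pi by means of its boundary values

    The boundary sequences are a k = pi(k,0) and b k = pi(0,k). *)

(* The sum of f l for k <= l < K + 1, as a convergent series if K = None. *)
Definition sum_from (K : option nat) (k : nat) (f : nat -> C) : C :=
  let u n := if in_cap K (k + n)%nat then f (k + n)%nat else RtoC 0 in
  (Series (fun n => Re (u n)), Series (fun n => Im (u n))).

(* pi(k,j) for j < k; exchanging the two queues gives pi(j,k). *)
Definition off_diag (K : option nat) (mu1 mu2 : R) (g1 a : nat -> C)
    (k j : nat) : C :=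
  mu2 / mu1 * sum_from K k (fun l =>
    a l * (conv_pow g1 (l - k + 1) j - conv_pow g1 (l - k + 1) (j + 1))).

Definition on_diag (K : option nat) (lam mu1 mu2 : R) (g1 g2 a b : nat -> C)
    (k : nat) : C :=
  - (1 / (2 * lam)) * sum_from K (k + 1) (fun l =>
    mu2 * a l * conv_pow g1 (l - k) (k + 1)
    + mu1 * b l * conv_pow g2 (l - k) (k + 1)).

(* pi(n,n) when the capacity n is finite. *)
Definition corner (lam mu1 mu2 : R) (g1 g2 a b : nat -> C) (n : nat) : C :=
  2 * lam / (mu1 + mu2) *
  (mu2 / mu1 * a n * (g1 (n - 1)%nat - g1 n)
   + mu1 / mu2 * b n * (g2 (n - 1)%nat - g2 n)).

Definition corner_or0 (K : option nat) (lam mu1 mu2 : R)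
    (g1 g2 a b : nat -> C) : C :=
  match K with
  | Some n => corner lam mu1 mu2 g1 g2 a b n
  | None => 0
  end.

(* The array that the above expressions associate with arbitrary a and b. *)
Definition reconstruct (K : option nat) (lam mu1 mu2 : R)
    (g1 g2 a b : nat -> C) (j k : nat) : C :=
  if (k <? j)%nat then off_diag K mu1 mu2 g1 a j k
  else if (j <? k)%nat then off_diag K mu2 mu1 g2 b k j
  else if in_cap K (k + 1) then on_diag K lam mu1 mu2 g1 g2 a b k
  else corner lam mu1 mu2 g1 g2 a b k.

(* The array associated with (a, b) defines a finite complex measure on the
   state space. This holds for all (a, b) when the capacity is finite. *)
Definition admissible (K : option nat) (lam mu1 mu2 : R)
    (g1 g2 a b : nat -> C) : Prop :=
  K = None ->
  summable2 (fun j k => Cmod (reconstruct K lam mu1 mu2 g1 g2 a b j k)).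

(** * Functional equations *)

Definition gen (K : option nat) (a : nat -> C) (y : C) : C :=
  sum_from K 0 (fun k => a k * y ^ k).

(* (F y - F z) / (y - z), extended by continuity to y = z. At a point where F
   is not holomorphic C_derive is a junk value. *)
Definition quot (F : C -> C) (y z : C) : C :=
  if Ceq_dec y z then C_derive F y else (F y - F z) / (y - z).

(* c stands for pi(K,K); it is not used if K = None. *)
Definition cap_term (K : option nat) (x c : C) : C :=
  match K with Some n => x ^ n * c | None => 0 end.

Definition functional_equations (K : option nat) (lam mu1 mu2 p1 p2 : R)
    (a b : nat -> C) (c x y1 z1 y2 z2 : C) : Prop :=
  let A1 := gen K a in
  let A2 := gen K b in
  let D := mu1 * quot A1 y1 z1 + mu2 * quot A2 y2 z2 in
  mu2 * quot (fun y => (y - x) * A1 y) y1 z1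
  = mu2 * cap_term K x c + (mu2 + 2 * p1 * lam * x) / (2 * lam) * D /\
  mu1 * quot (fun y => (y - x) * A2 y) y2 z2
  = mu1 * cap_term K x c + (mu1 + 2 * p2 * lam * x) / (2 * lam) * D.

Definition functional_equations_near0 (K : option nat)
    (lam mu1 mu2 p1 p2 : R) (a b : nat -> C) (c : C) : Prop :=
  exists eps : R, (0 < eps)%R /\
  forall x : C, (Cmod x < eps)%R -> forall y1 z1 y2 z2 : C,
    roots2 mu2 (- ((2 * lam + mu1 + mu2) * x)) ((mu1 + 2 * lam * x) * x)
      y1 z1 ->
    roots2 mu1 (- ((2 * lam + mu1 + mu2) * x)) ((mu2 + 2 * lam * x) * x)
      y2 z2 ->
    functional_equations K lam mu1 mu2 p1 p2 a b c x y1 z1 y2 z2.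

Definition normalized (K : option nat) (lam mu1 mu2 : R)
    (a b : nat -> C) (c : C) : Prop :=
  mu2 * gen K a 1 + mu1 * gen K b 1 = mu1 + mu2 - 2 * lam * (1 - c).

(* Main.v *)
(* Let a(l) = pi(l, 0), b(l) = pi(0, l). Below the diagonal the balance equations
   are a recurrence in j which determines pi(k, j) from a; it is solved by the
   convolution powers of g_1. The expressions on the diagonal express that no
   mass flows out of the squares {max(j, k) <= n}. The balance equations left are
   those at (k + 1, k) and (k, k + 1); once pi(k, j) is extended to j >= k by the
   recurrence, they become relations between values on the diagonal. Since
   (y_1^l - z_1^l) / (y_1 - z_1) is a polynomial in x with coefficients
   - (mu2 / mu1) g_1^{*(l-k)}(k + 1), these relations are the equality of the
   coefficients of the functional equations.

   For the uniqueness, let nu be a solution, not necessarily positive, of the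
   balance equations which is summable and vanishes at (0, 0). Then the inflow of
   |nu| is at least its outflow at each state, and the sum of the differences
   over {j + k <= n} is bounded by the flow through the last antidiagonal, which
   tends to 0. Hence |nu| is invariant, and its being zero spreads from (0, 0)
   along the services. *)
Require Import Defs.
From Stdlib Require Import Reals Arith Bool Lia Lra FunctionalExtensionality.
From Coquelicot Require Import Coquelicot.
Open Scope C_scope.

(** * Finite sums and series *)

(** The characterization ranges over arbitrary complex boundary sequences, so positivity is
    available for [pi] only; this is why uniqueness goes through moduli. The sums in (i) cause no
    convergence problem: the m-th power of [g_1] starts at the index m, so once the boundary
    sequences are extended by zero beyond the capacity every such sum is finite. The roots defining
    [g_1] and [g_2] serve only to establish the recurrence [is_gpow], from which all else about the
    powers is derived. In (ii) the obstacle is the expansion in powers of x: a series over l of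
    polynomials in x has to be rearranged. The bound [C * (1 / 2) ^ l * R ^ k] on the coefficients,
    with R = [coef_base], permits it when [R * |x| <= 1 / 2] and the boundary sequences are bounded,
    which summability of the array ensures. For the same x the two roots coincide only at x = 0, the
    only point where the quotients are derivatives. Results are proved for one queue where possible;
    the other follows by exchanging the coordinates, the service rates and the joining
    probabilities. *)

(* [csum n f] and [rsum n f] are the sums of the [n] terms [f 0], ...,
   [f (n - 1)]. *)
Fixpoint csum (n : nat) (f : nat -> C) : C :=
  match n with O => 0 | S n' => csum n' f + f n' end.

Fixpoint rsum (n : nat) (f : nat -> R) : R :=
  match n with O => 0%R | S n' => (rsum n' f + f n')%R end.

Lemma csum_ext n (f g : nat -> C) :
  (forall k, (k < n)%nat -> f k = g k) -> csum n f = csum n g.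
Proof.
  induction n as [|n IH]; intros H; simpl; [easy|].
  rewrite IH by (intros; apply H; lia). now rewrite H by lia.
Qed.

Lemma csum_plus n (f g : nat -> C) : csum n (fun k => f k + g k) = csum n f + csum n g.
Proof. induction n as [|n IH]; simpl; [|rewrite IH]; ring. Qed.

Lemma csum_scal n (c : C) (f : nat -> C) : csum n (fun k => c * f k) = c * csum n f.
Proof. induction n as [|n IH]; simpl; [|rewrite IH]; ring. Qed.

Lemma csum_scal_r n (c : C) (f : nat -> C) : csum n (fun k => f k * c) = csum n f * c.
Proof. induction n as [|n IH]; simpl; [|rewrite IH]; ring. Qed.

Lemma csum_minus n (f g : nat -> C) : csum n (fun k => f k - g k) = csum n f - csum n g.
Proof. induction n as [|n IH]; simpl; [|rewrite IH]; ring. Qed.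

Lemma csum_0 n (f : nat -> C) : (forall k, (k < n)%nat -> f k = 0) -> csum n f = 0.
Proof.
  intros H. rewrite (csum_ext n f (fun _ => 0) H).
  induction n as [|n IH]; simpl; [easy|].
  rewrite IH by (intros; apply H; lia). ring.
Qed.

Lemma csum_S_l n (f : nat -> C) : csum (S n) f = f O + csum n (fun k => f (S k)).
Proof.
  induction n as [|n IH]; [simpl; ring|].
  change (csum (S (S n)) f) with (csum (S n) f + f (S n)).
  rewrite IH. simpl. ring.
Qed.

Lemma csum_add n m (f : nat -> C) :
  csum (n + m) f = csum n f + csum m (fun k => f (n + k)%nat).
Proof.
  induction m as [|m IH]; simpl.
  - rewrite Nat.add_0_r. ring.
  - rewrite Nat.add_succ_r. simpl. rewrite IH. ring.
Qed.

Lemma csum_trunc n m (f : nat -> C) :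
  (n <= m)%nat -> (forall k, (n <= k < m)%nat -> f k = 0) ->
  csum m f = csum n f.
Proof.
  intros Hnm H. replace m with (n + (m - n))%nat by lia.
  rewrite csum_add, (csum_0 (m - n)); [ring|]. intros k Hk. apply H. lia.
Qed.

Lemma csum_swap n m (f : nat -> nat -> C) :
  csum n (fun i => csum m (f i)) = csum m (fun j => csum n (fun i => f i j)).
Proof.
  induction n as [|n IH]; simpl.
  - symmetry. now apply csum_0.
  - now rewrite IH, <- csum_plus.
Qed.

Lemma csum_RtoC n (f : nat -> R) :
  csum n (fun k => RtoC (f k)) = RtoC (rsum n f).
Proof.
  induction n as [|n IH]; simpl; [easy|]. now rewrite IH, RtoC_plus.
Qed.

Lemma Re_csum n (f : nat -> C) : Re (csum n f) = rsum n (fun k => Re (f k)).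
Proof. induction n as [|n IH]; simpl; [easy|]. now rewrite <- IH. Qed.

Lemma Im_csum n (f : nat -> C) : Im (csum n f) = rsum n (fun k => Im (f k)).
Proof. induction n as [|n IH]; simpl; [easy|]. now rewrite <- IH. Qed.

Lemma rsum_ext n (f g : nat -> R) :
  (forall k, (k < n)%nat -> f k = g k) -> rsum n f = rsum n g.
Proof.
  induction n as [|n IH]; intros H; simpl; [easy|].
  rewrite IH by (intros; apply H; lia). now rewrite H by lia.
Qed.

Lemma rsum_scal n (c : R) (f : nat -> R) : (rsum n (fun k => c * f k) = c * rsum n f)%R.
Proof. induction n as [|n IH]; simpl; [|rewrite IH]; ring. Qed.

Lemma rsum_plus n (f g : nat -> R) :
  (rsum n (fun k => f k + g k) = rsum n f + rsum n g)%R.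
Proof. induction n as [|n IH]; simpl; [|rewrite IH]; ring. Qed.

Lemma rsum_le n (f g : nat -> R) :
  (forall k, (k < n)%nat -> (f k <= g k)%R) -> (rsum n f <= rsum n g)%R.
Proof.
  induction n as [|n IH]; intros H; simpl; [lra|].
  apply Rplus_le_compat; [apply IH; intros; apply H|apply H]; lia.
Qed.

Lemma rsum_ge0 n (f : nat -> R) : (forall k, (0 <= f k)%R) -> (0 <= rsum n f)%R.
Proof.
  intros H. induction n as [|n IH]; simpl; [lra|]. specialize (H n). lra.
Qed.

Lemma rsum_incr n m (f : nat -> R) :
  (n <= m)%nat -> (forall k, (0 <= f k)%R) -> (rsum n f <= rsum m f)%R.
Proof.
  intros Hnm H. induction Hnm as [|m Hnm IH]; simpl; [lra|].
  specialize (H m). lra.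
Qed.

Lemma rsum_term_le n (f : nat -> R) k :
  (forall k, (0 <= f k)%R) -> (k < n)%nat -> (f k <= rsum n f)%R.
Proof.
  intros H Hk. apply Rle_trans with (rsum (S k) f).
  - simpl. assert (0 <= rsum k f)%R by now apply rsum_ge0. lra.
  - now apply rsum_incr.
Qed.

Lemma rsum_sum_n n (f : nat -> R) : rsum (S n) f = sum_n f n.
Proof.
  induction n as [|n IH].
  - simpl. rewrite sum_O. apply Rplus_0_l.
  - rewrite sum_Sn, <- IH. easy.
Qed.

Lemma Cmod_csum_le n (f : nat -> C) : (Cmod (csum n f) <= rsum n (fun k => Cmod (f k)))%R.
Proof.
  induction n as [|n IH]; simpl; [rewrite Cmod_0; lra|].
  eapply Rle_trans; [apply Cmod_triangle|]. lra.
Qed.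

Lemma rsum_half n : (rsum n (fun k => (1 / 2) ^ k) <= 2)%R.
Proof.
  enough (rsum n (fun k => (1 / 2) ^ k) = 2 - 2 * (1 / 2) ^ n)%R as ->.
  { assert (0 < (1 / 2) ^ n)%R by (apply pow_lt; lra). lra. }
  induction n as [|n IH]; simpl; [lra|]. rewrite IH. lra.
Qed.

(** Convergence is stated on the modulus of the error, so that errors are handled by real
    inequalities. *)
Definition is_cser (u : nat -> C) (l : C) : Prop :=
  is_lim_seq (fun n => Cmod (csum n u - l)) 0.

(** The shape of [sum_from]: a total function, tied to an actual limit only through [is_cser]. *)
Definition cseries (u : nat -> C) : C :=
  (Series (fun n => Re (u n)), Series (fun n => Im (u n))).

Lemma is_lim_seq_0_le (u v : nat -> R) :
  (forall n, (0 <= u n <= v n)%R) -> is_lim_seq v 0 -> is_lim_seq u 0.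
Proof.
  intros H Hv. apply is_lim_seq_le_le with (fun _ => 0%R) v; auto.
  apply is_lim_seq_const.
Qed.

Lemma is_series_rsum (u : nat -> R) (l : R) :
  is_series u l <-> is_lim_seq (fun n => rsum n u) l.
Proof.
  rewrite is_lim_seq_incr_1. unfold is_series.
  change (is_lim_seq (sum_n u) l <-> is_lim_seq (fun n => rsum (S n) u) l).
  split; apply is_lim_seq_ext; intros n; now rewrite rsum_sum_n.
Qed.

Lemma is_cser_parts u l :
  is_cser u l ->
  is_series (fun n => Re (u n)) (Re l) /\ is_series (fun n => Im (u n)) (Im l).
Proof.
  intros H. rewrite !is_series_rsum. split.
  - apply is_lim_seq_ext with (fun n => (Re (csum n u - l) + Re l)%R).
    { intros n. rewrite <- Re_csum. unfold Re. simpl. ring. }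
    replace (Finite (Re l)) with (Rbar_plus 0 (Re l))
      by (simpl; f_equal; ring).
    apply is_lim_seq_plus'; [|apply is_lim_seq_const].
    apply is_lim_seq_abs_0, is_lim_seq_0_le with (2 := H).
    intros n. split; [apply Rabs_pos|].
    apply Rle_trans with (2 := Rmax_Cmod _), Rmax_l.
  - apply is_lim_seq_ext with (fun n => (Im (csum n u - l) + Im l)%R).
    { intros n. rewrite <- Im_csum. unfold Im. simpl. ring. }
    replace (Finite (Im l)) with (Rbar_plus 0 (Im l))
      by (simpl; f_equal; ring).
    apply is_lim_seq_plus'; [|apply is_lim_seq_const].
    apply is_lim_seq_abs_0, is_lim_seq_0_le with (2 := H).
    intros n. split; [apply Rabs_pos|].
    apply Rle_trans with (2 := Rmax_Cmod _), Rmax_r.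
Qed.

Lemma is_cser_unique u l : is_cser u l -> cseries u = l.
Proof.
  intros H. destruct (is_cser_parts _ _ H) as [H1 H2]. unfold cseries.
  rewrite (is_series_unique _ _ H1), (is_series_unique _ _ H2).
  now destruct l.
Qed.

Lemma is_cser_inj u l l' : is_cser u l -> is_cser u l' -> l = l'.
Proof. intros H H'. now rewrite <- (is_cser_unique u l), (is_cser_unique u l'). Qed.

Lemma is_cser_ext u v l : (forall n, u n = v n) -> is_cser u l -> is_cser v l.
Proof.
  intros H. apply is_lim_seq_ext. intros n. do 2 f_equal.
  now apply csum_ext.
Qed.

Lemma is_cser_plus u v l m :
  is_cser u l -> is_cser v m -> is_cser (fun n => u n + v n) (l + m).
Proof.
  intros Hu Hv. apply is_lim_seq_0_le
    with (fun n => (Cmod (csum n u - l) + Cmod (csum n v - m))%R).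
  - intros n. split; [apply Cmod_ge_0|]. rewrite csum_plus.
    replace (csum n u + csum n v - (l + m))
      with ((csum n u - l) + (csum n v - m)) by ring.
    apply Cmod_triangle.
  - replace (Finite 0) with (Finite (0 + 0)) by (f_equal; ring).
    now apply is_lim_seq_plus'.
Qed.

Lemma is_cser_scal c u l : is_cser u l -> is_cser (fun n => c * u n) (c * l).
Proof.
  intros Hu. apply is_lim_seq_ext
    with (fun n => (Cmod c * Cmod (csum n u - l))%R).
  - intros n. rewrite csum_scal, <- Cmod_mult. f_equal. ring.
  - replace (Finite 0) with (Finite (Cmod c * 0)) by (f_equal; ring).
    apply is_lim_seq_mult'; [apply is_lim_seq_const|easy].
Qed.

Lemma is_cser_minus u v l m :
  is_cser u l -> is_cser v m -> is_cser (fun n => u n - v n) (l - m).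
Proof.
  intros Hu Hv. apply is_cser_ext with (fun n => u n + (- (1)) * v n).
  { intros n. ring. }
  replace (l - m) with (l + - (1) * m) by ring.
  now apply is_cser_plus; [|apply is_cser_scal].
Qed.

Lemma is_cser_finite (u : nat -> C) N :
  (forall n, (N <= n)%nat -> u n = 0) -> is_cser u (csum N u).
Proof.
  intros H. apply is_lim_seq_ext_loc with (fun _ => 0%R).
  - exists N. intros n Hn. rewrite (csum_trunc N n); [|easy|].
    + replace (csum N u - csum N u) with (RtoC 0) by ring.
      now rewrite Cmod_0.
    + intros k Hk. apply H. lia.
  - apply is_lim_seq_const.
Qed.

Lemma is_cser_RtoC (u : nat -> R) (l : R) :
  is_series u l -> is_cser (fun n => RtoC (u n)) l.
Proof.
  rewrite is_series_rsum. intros H.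
  apply is_lim_seq_ext with (fun n => Rabs (rsum n u - l)).
  - intros n. now rewrite csum_RtoC, <- RtoC_minus, Cmod_R.
  - apply (is_lim_seq_abs_0 (fun n => rsum n u - l)%R).
    replace (Finite 0) with (Finite (l - l)) by (f_equal; ring).
    apply is_lim_seq_minus'; [easy|apply is_lim_seq_const].
Qed.

Lemma is_lim_seq_half : is_lim_seq (fun n => ((1 / 2) ^ n)%R) 0.
Proof. apply is_lim_seq_geom. rewrite Rabs_pos_eq; lra. Qed.

Lemma ex_series_half : ex_series (fun n => ((1 / 2) ^ n)%R).
Proof. apply ex_series_geom. rewrite Rabs_pos_eq; lra. Qed.

Lemma is_cser_geom u M :
  (forall n, (Cmod (u n) <= M * (1 / 2) ^ n)%R) -> is_cser u (cseries u).
Proof.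
  intros H.
  assert (Hs : ex_series (fun n => (M * (1 / 2) ^ n)%R))
    by exact (@ex_series_scal_l R_AbsRing R_NormedModule M _ ex_series_half).
  assert (HR : ex_series (fun n => Re (u n))).
  { apply (@ex_series_le R_AbsRing R_CompleteNormedModule) with (2 := Hs).
    intros n. eapply Rle_trans; [|apply H].
    apply Rle_trans with (2 := Rmax_Cmod _), Rmax_l. }
  assert (HI : ex_series (fun n => Im (u n))).
  { apply (@ex_series_le R_AbsRing R_CompleteNormedModule) with (2 := Hs).
    intros n. eapply Rle_trans; [|apply H].
    apply Rle_trans with (2 := Rmax_Cmod _), Rmax_r. }
  apply Series_correct in HR, HI.
  apply is_cser_RtoC in HR, HI.
  apply is_cser_ext with (fun n => RtoC (Re (u n)) + Ci * RtoC (Im (u n))).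
  { intros n. destruct (u n). unfold Ci, Re, Im, Cplus, Cmult. simpl.
    f_equal; ring. }
  replace (cseries u) with
    (RtoC (Series (fun n => Re (u n))) + Ci * RtoC (Series (fun n => Im (u n)))).
  - apply is_cser_plus; [|apply is_cser_scal]; easy.
  - unfold cseries, Ci, Cplus, Cmult. simpl. f_equal; ring.
Qed.

Lemma Cmod_is_cser_le u l (M : R) :
  is_cser u l -> (forall n, (Cmod (csum n u) <= M)%R) -> (Cmod l <= M)%R.
Proof.
  intros Hu H.
  apply (is_lim_seq_le (fun _ => Cmod l) (fun n => (Cmod (csum n u - l) + M)%R)
           (Cmod l) M).
  - intros n. replace l with (- (csum n u - l) + csum n u) at 1 by ring.
    eapply Rle_trans; [apply Cmod_triangle|]. rewrite Cmod_opp.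
    specialize (H n). lra.
  - apply is_lim_seq_const.
  - replace (Finite M) with (Finite (0 + M)) by (f_equal; ring).
    apply is_lim_seq_plus'; [easy|apply is_lim_seq_const].
Qed.

(* The rows and the columns of [t] are finite, so no limit is taken in the
   inner sums. *)
Lemma is_cser_swap (t : nat -> nat -> C) M l :
  (forall i k, (Cmod (t i k) <= M * ((1 / 2) ^ i * (1 / 2) ^ k))%R) ->
  (forall i k, (i < k)%nat -> t i k = 0) ->
  (forall i k, (2 * k + 2 <= i)%nat -> t i k = 0) ->
  is_cser (fun i => csum (S i) (t i)) l ->
  is_cser (fun k => csum (2 * k + 2) (fun i => t i k)) l.
Proof.
  intros Hb Hr Hc Hl.
  assert (HM : (0 <= M)%R).
  { specialize (Hb O O). simpl in Hb. generalize (Cmod_ge_0 (t O O)). lra. }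
  (* The first [n] columns live in the first [2 * n] rows, so both partial sums range over the same
     rows and differ by the entries with [n <= k < 2 * n], which the geometric bound makes small. *)
  assert (Hd : forall n,
    (Cmod (csum n (fun k => csum (2 * k + 2) (fun i => t i k))
      - csum (2 * n) (fun i => csum (S i) (t i))) <= 4 * M * (1 / 2) ^ n)%R).
  { intros n.
    replace (csum n (fun k => csum (2 * k + 2) (fun i => t i k)))
      with (csum (2 * n) (fun i => csum n (t i))).
    2:{ rewrite csum_swap. apply csum_ext. intros k Hk.
        apply csum_trunc; [lia|]. intros i Hi. apply Hc. lia. }
    replace (csum (2 * n) (fun i => csum (S i) (t i)))
      with (csum (2 * n) (fun i => csum (n + n) (t i))).
    2:{ apply csum_ext. intros i Hi. apply csum_trunc; [lia|].
        intros k Hk. apply Hr. lia. }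
    rewrite <- csum_minus.
    rewrite (csum_ext (2 * n) _ (fun i => - csum n (fun k => t i (n + k)%nat))).
    2:{ intros i _. rewrite csum_add. ring. }
    eapply Rle_trans; [apply Cmod_csum_le|].
    apply Rle_trans with
      (rsum (2 * n) (fun i => (2 * M * (1 / 2) ^ n) * (1 / 2) ^ i)%R).
    - apply rsum_le. intros i _. rewrite Cmod_opp.
      eapply Rle_trans; [apply Cmod_csum_le|].
      apply Rle_trans with
        (rsum n (fun k => (M * (1 / 2) ^ n * (1 / 2) ^ i) * (1 / 2) ^ k)%R).
      + apply rsum_le. intros k _. eapply Rle_trans; [apply Hb|].
        rewrite pow_add. right. ring.
      + rewrite rsum_scal.
        apply Rle_trans with (M * (1 / 2) ^ n * (1 / 2) ^ i * 2)%R.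
        * apply Rmult_le_compat_l; [|apply rsum_half].
          repeat apply Rmult_le_pos; try apply pow_le; lra.
        * right. ring.
    - rewrite (rsum_scal (2 * n)).
      apply Rle_trans with (2 * M * (1 / 2) ^ n * 2)%R; [|right; ring].
      apply Rmult_le_compat_l; [|apply rsum_half].
      repeat apply Rmult_le_pos; try apply pow_le; lra. }
  apply is_lim_seq_0_le with (fun n => (4 * M * (1 / 2) ^ n
    + Cmod (csum (2 * n) (fun i => csum (S i) (t i)) - l))%R).
  - intros n. split; [apply Cmod_ge_0|].
    replace (csum n (fun k => csum (2 * k + 2) (fun i => t i k)) - l) with
      ((csum n (fun k => csum (2 * k + 2) (fun i => t i k))
      - csum (2 * n) (fun i => csum (S i) (t i)))
      + (csum (2 * n) (fun i => csum (S i) (t i)) - l)) by ring.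
    eapply Rle_trans; [apply Cmod_triangle|].
    apply Rplus_le_compat_r, Hd.
  - replace (Finite 0) with (Finite (4 * M * 0 + 0)) by (f_equal; ring).
    apply is_lim_seq_plus'.
    + apply is_lim_seq_mult'; [apply is_lim_seq_const|apply is_lim_seq_half].
    + apply (is_lim_seq_subseq
        (fun n => Cmod (csum n (fun i => csum (S i) (t i)) - l))); [|apply Hl].
      apply eventually_subseq. intros n. lia.
Qed.

(** For real x the real and imaginary parts are real power series, to which the identity theorem on
    the line applies. Testing real x only also means that only quadratics with real coefficients
    have to be solved later. *)
Lemma power_series_zero (w : nat -> C) (eps : R) :
  (0 < eps)%R ->
  (forall x : R, (Rabs x < eps)%R -> is_cser (fun k => w k * RtoC x ^ k) 0) ->
  forall k, w k = 0.
Proof.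
  intros Heps H.
  assert (Hz : forall v : nat -> R,
    (forall x : R, (Rabs x < eps)%R -> is_series (fun k => v k * x ^ k)%R 0) ->
    forall k, v k = 0%R).
  { intros v Hv k.
    assert (Hp : forall x : R, (Rabs x < eps)%R -> is_pseries v x 0%R).
    { intros x Hx. unfold is_pseries.
      apply is_series_ext with (2 := Hv x Hx). intros n.
      rewrite Rmult_comm, <- (pow_n_pow x n). reflexivity. }
    apply (PSeries_ext_recip v (fun _ => 0%R) k).
    (* The radius of convergence is at least [eps / 2]: beyond it the terms could not tend to 0, yet
       the series converges at [eps / 2]. *)
    - apply Rbar_lt_le_trans with (Finite (eps / 2)); [simpl; lra|].
      apply Rbar_not_lt_le. intros Hlt.
      apply (CV_disk_outside v (eps / 2)).
      + rewrite Rabs_pos_eq by lra. exact Hlt.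
      + apply ex_series_lim_0. exists 0%R. apply Hv. rewrite Rabs_pos_eq; lra.
    - rewrite CV_radius_const_0. easy.
    - exists (mkposreal eps Heps). intros x Hx.
      rewrite (is_pseries_unique v x 0%R), PSeries_const_0; [easy|].
      apply Hp. unfold ball in Hx. simpl in Hx. unfold AbsRing_ball in Hx.
      unfold minus, plus, opp, abs in Hx. simpl in Hx.
      now rewrite Ropp_0, Rplus_0_r in Hx. }
  intros k. rewrite (surjective_pairing (w k)).
  assert (E : forall (c : C) (x : R) n, Re (c * RtoC x ^ n) = (Re c * x ^ n)%R
            /\ Im (c * RtoC x ^ n) = (Im c * x ^ n)%R).
  { intros c x n. rewrite <- RtoC_pow. unfold Re, Im. simpl.
    split; ring. }
  apply injective_projections; simpl.
  - apply (Hz (fun k => Re (w k))). intros x Hx.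
    destruct (is_cser_parts _ _ (H x Hx)) as [H1 _].
    apply is_series_ext with (2 := H1). intros n. apply E.
  - apply (Hz (fun k => Im (w k))). intros x Hx.
    destruct (is_cser_parts _ _ (H x Hx)) as [_ H1].
    apply is_series_ext with (2 := H1). intros n. apply E.
Qed.

(** * The convolution powers of g *)

Lemma sum_n_csum (f : nat -> C) n : sum_n f n = csum (S n) f.
Proof.
  induction n as [|n IH].
  - rewrite sum_O. simpl. ring.
  - rewrite sum_Sn, IH. easy.
Qed.

Lemma RtoC_neq0 (x : R) : (0 < x)%R -> RtoC x <> 0.
Proof. intros H E. apply RtoC_inj in E. lra. Qed.

Lemma roots2_vieta (a b c y z : C) :
  roots2 a b c y z -> b = - a * (y + z) /\ c = a * (y * z).
Proof.
  intros H. generalize (H 0) (H 1). simpl. intros H0 H1.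
  assert (Hc : c = a * (y * z)).
  { transitivity (a * (0 * (0 * 1)) + b * 0 + c); [ring|]. rewrite H0. ring. }
  split; [|easy].
  transitivity ((a * (1 * (1 * 1)) + b * 1 + c) - a - c); [ring|].
  rewrite H1, Hc. ring.
Qed.

Lemma roots2_sq (a b c y z : C) :
  roots2 a b c y z ->
  a * (y * y) = - b * y - c /\ a * (z * z) = - b * z - c.
Proof.
  intros H. destruct (roots2_vieta _ _ _ _ _ H) as [-> ->]. split; ring.
Qed.

(* The recurrence says that (mu2 - s t + 2 lam t^2) g(t)^(m+1)
   = - mu1 t g(t)^m for the generating function g(t) of g_1, where
   s = 2 lam + mu1 + mu2. *)
Definition is_gpow (lam mu1 mu2 : R) (G : nat -> nat -> C) : Prop :=
  G O O = 1 /\ (forall j, G O (S j) = 0) /\ (forall m, G (S m) O = 0) /\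
  (forall m, mu2 * G (S m) 1%nat = - mu1 * G m O) /\
  (forall m j, mu2 * G (S m) (S (S j)) =
     (2 * lam + mu1 + mu2) * G (S m) (S j) - 2 * lam * G (S m) j
     - mu1 * G m (S j)).

(** The sequence g solves the linear recurrence attached to its quadratic. Convolution with a
    further power preserves this except for the boundary term [mu2 * g 1 = - mu1], which is the
    source term of [is_gpow]. *)
Lemma conv_pow_is_gpow (lam mu1 mu2 : R) (xp xm : C) :
  (0 < lam)%R -> (0 < mu1)%R -> (0 < mu2)%R ->
  roots2 mu2 (- (2 * lam + mu1 + mu2)) (2 * lam) xp xm ->
  is_gpow lam mu1 mu2 (conv_pow (g_fun (mu1 / mu2) xp xm)).
Proof.
  intros Hl H1 H2 Hr.
  assert (Hm2 := RtoC_neq0 mu2 H2).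
  destruct (roots2_vieta _ _ _ _ _ Hr) as [Hb Hc].
  destruct (roots2_sq _ _ _ _ _ Hr) as [Hp Hm].
  (* The discriminant is [(2 lam - mu2)^2 + mu1^2 + 2 mu1 (2 lam + mu2)], hence positive. *)
  assert (Hne : xp - xm <> 0).
  { intros E. assert (Heq : xm = xp) by (replace xm with (xp - (xp - xm)) by ring;
      rewrite E; ring). subst xm.
    assert (E1 : (2 * lam + mu1 + mu2) * (2 * lam + mu1 + mu2)
        = 4 * mu2 * (2 * lam)).
    { replace (2 * lam + mu1 + mu2) with (- - (2 * lam + mu1 + mu2)) by ring.
      rewrite Hb, Hc. ring. }
    assert (E2 : ((2 * lam + mu1 + mu2) * (2 * lam + mu1 + mu2)
      = 4 * mu2 * (2 * lam))%R).
    { apply RtoC_inj. now rewrite !RtoC_mult, !RtoC_plus, !RtoC_mult. }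
    assert (0 < mu1 * mu1)%R by now apply Rmult_lt_0_compat.
    assert (0 < mu1 * (2 * lam + mu2))%R by (apply Rmult_lt_0_compat; lra).
    generalize (Rle_0_sqr (2 * lam - mu2)). unfold Rsqr. nra. }
  set (g := g_fun (mu1 / mu2) xp xm).
  assert (g0 : g O = 0) by (unfold g, g_fun; simpl; field; now split).
  assert (g1 : mu2 * g 1%nat = - mu1)
    by (unfold g, g_fun; simpl; field; now split).
  assert (gS : forall j, mu2 * g (S (S j))
    = (2 * lam + mu1 + mu2) * g (S j) - 2 * lam * g j).
  { intros j. unfold g, g_fun. simpl.
    transitivity (- (mu1 / mu2) * ((mu2 * (xp * xp) * xp ^ j
       - mu2 * (xm * xm) * xm ^ j) / (xp - xm))); [field; now split|].
    rewrite Hp, Hm. field. now split. }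
  assert (Ec : forall phi n, conv g phi n
     = csum (S n) (fun m => g m * phi (n - m)%nat)).
  { intros phi n. apply sum_n_csum. }
  repeat split; try easy.
  - intros m. change (conv g (conv_pow g m) O = 0). rewrite Ec. simpl.
    rewrite g0. ring.
  - intros m.
    change (mu2 * conv g (conv_pow g m) 1%nat = - mu1 * conv_pow g m O).
    rewrite Ec. simpl. rewrite g0, <- g1. ring.
  - intros m j. set (phi := conv_pow g m).
    change (mu2 * conv g phi (S (S j)) = (2 * lam + mu1 + mu2) * conv g phi (S j)
      - 2 * lam * conv g phi j - mu1 * phi (S j)).
    rewrite !Ec.
    rewrite (csum_S_l (S (S j))), (csum_S_l (S j)), (csum_S_l (S j)), g0.
    rewrite !Nat.sub_0_r.
    replace (S (S j) - 1)%nat with (S j) by lia.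
    set (A := csum (S j) (fun k => g (S k) * phi (S j - S k)%nat)).
    set (B := csum (S j) (fun k => g k * phi (j - k)%nat)).
    assert (E : mu2 * csum (S j) (fun k => g (S (S k)) * phi (S (S j) - S (S k))%nat)
      = (2 * lam + mu1 + mu2) * A - 2 * lam * B).
    { unfold A, B. rewrite <- !csum_scal, <- csum_minus. apply csum_ext.
      intros k Hk. simpl. rewrite Cmult_assoc, gS. ring. }
    transitivity (mu2 * g 1%nat * phi (S j)
      + mu2 * csum (S j) (fun k => g (S (S k)) * phi (S (S j) - S (S k))%nat));
      [ring|].
    rewrite E, g1. ring.
Qed.

(** The recurrence of the power m + 1 is driven by the power m one index earlier, so each power
    starts one index later than the preceding one. All truncations of sums below rest on this. *)
Lemma gpow_zero lam mu1 mu2 G :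
  (0 < mu2)%R -> is_gpow lam mu1 mu2 G ->
  forall m j, (j < m)%nat -> G m j = 0.
Proof.
  intros H2 (_ & _ & G0 & G1 & GS).
  assert (Hm2 := RtoC_neq0 mu2 H2).
  assert (K : forall x, mu2 * x = 0 -> x = 0).
  { intros x E. replace x with (/ mu2 * (mu2 * x)) by (field; easy).
    rewrite E. ring. }
  intros m. induction m as [|m IHm]; intros j Hj; [lia|].
  assert (Hboth : ((j < S m)%nat -> G (S m) j = 0) /\
    ((S j < S m)%nat -> G (S m) (S j) = 0)).
  { clear Hj. induction j as [|j [IH1 IH2]].
    - split; [easy|]. intros Hj. apply K. rewrite G1, IHm by lia. ring.
    - split; [easy|]. intros Hj. apply K.
      rewrite GS, IH1, IH2, IHm by lia. ring. }
  now apply Hboth.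
Qed.

(** * The expressions of pi as finite sums *)

(** Moves the capacity into the boundary sequence, so that [off] and [dia] need not mention it. *)
Definition mask (K : option nat) (a : nat -> C) (l : nat) : C :=
  if in_cap K l then a l else 0.

(* pi(k, j) for j < k as a function of a(l) = pi(l, 0), extended to all j. *)
Definition off (mu1 mu2 : R) (G : nat -> nat -> C) (a : nat -> C) (k j : nat) : C :=
  mu2 / mu1 * csum (S j) (fun n => a (k + n)%nat * (G (S n) j - G (S n) (S j))).

(** The form of [on_diag] without series: the terms with [n > k] vanish by [gpow_zero]. *)
Definition dia (lam mu1 mu2 : R) (G1 G2 : nat -> nat -> C) (a b : nat -> C)
    (k : nat) : C :=
  - (1 / (2 * lam)) * csum (S k) (fun n =>
    mu2 * a (S k + n)%nat * G1 (S n) (S k) + mu1 * b (S k + n)%nat * G2 (S n) (S k)).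

Lemma sum_from_finite K k (f : nat -> C) N :
  (forall n, (N <= n)%nat -> f (k + n)%nat = 0) ->
  sum_from K k f = csum N (fun n => mask K f (k + n)%nat).
Proof.
  intros H. unfold sum_from.
  apply (is_cser_unique (fun n => mask K f (k + n)%nat)), is_cser_finite.
  intros n Hn. unfold mask. rewrite H by easy. now destruct in_cap.
Qed.

Section Off.

Variables (lam mu1 mu2 : R) (G : nat -> nat -> C).
Hypotheses (lam0 : (0 < lam)%R) (mu10 : (0 < mu1)%R) (mu20 : (0 < mu2)%R).
Hypothesis HG : is_gpow lam mu1 mu2 G.

Let mu1n := RtoC_neq0 mu1 mu10.
Let mu2n := RtoC_neq0 mu2 mu20.
Let Gz := gpow_zero lam mu1 mu2 G mu20 HG.

Lemma off_0 a k : off mu1 mu2 G a k O = a k.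
Proof.
  pose proof HG as (G00 & _ & G0 & G1 & _). unfold off. simpl.
  rewrite Nat.add_0_r, G0.
  replace (G 1%nat 1%nat) with (/ mu2 * (mu2 * G 1%nat 1%nat)) by (field; easy).
  rewrite G1, G00. field. now split.
Qed.

(** This is balance at [(k, 0)], where queue 2 is empty: the total outflow rate is [mu1 + 2 * lam],
    without [mu2]. *)
Lemma off_1 a k :
  mu2 * off mu1 mu2 G a k 1 =
  (mu1 + 2 * lam) * off mu1 mu2 G a k 0 - mu1 * off mu1 mu2 G a (S k) 0.
Proof.
  pose proof HG as (G00 & G0S & G0 & G1 & GS). rewrite !off_0. unfold off. simpl.
  rewrite Nat.add_0_r, (Nat.add_comm k 1). simpl.
  assert (E1 : G 1%nat 1%nat = - mu1 / mu2).
  { transitivity (/ mu2 * (mu2 * G 1%nat 1%nat)); [field; easy|].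
    rewrite G1, G00. field. easy. }
  assert (E2 : G 1%nat 2%nat = (2 * lam + mu1 + mu2) * (- mu1 / mu2) / mu2).
  { transitivity (/ mu2 * (mu2 * G 1%nat 2%nat)); [field; easy|].
    rewrite GS, G0, E1, G0S. field. easy. }
  assert (E3 : G 2%nat 2%nat = mu1 / mu2 * (mu1 / mu2)).
  { transitivity (/ mu2 * (mu2 * G 2%nat 2%nat)); [field; easy|].
    rewrite GS, G0, E1, (Gz 2%nat 1%nat) by lia. field. easy. }
  rewrite E1, E2, E3, (Gz 2%nat 1%nat) by lia. field. now split.
Qed.

Lemma off_trunc a k j N :
  (S j <= N)%nat ->
  off mu1 mu2 G a k j =
  mu2 / mu1 * csum N (fun n => a (k + n)%nat * (G (S n) j - G (S n) (S j))).
Proof.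
  intros HN. unfold off. f_equal. symmetry. apply csum_trunc; [easy|].
  intros n Hn. rewrite !Gz by lia. ring.
Qed.

(** The source term [- mu1 * G m] of [is_gpow] lowers the power by one; after reindexing the sum,
    this is the passage from column k to column k + 1. *)
Lemma off_SS a k j :
  mu2 * off mu1 mu2 G a k (S (S j)) =
  (2 * lam + mu1 + mu2) * off mu1 mu2 G a k (S j)
  - mu1 * off mu1 mu2 G a (S k) (S j) - 2 * lam * off mu1 mu2 G a k j.
Proof.
  pose proof HG as (G00 & G0S & G0 & G1 & GS).
  rewrite (off_trunc a k (S (S j)) (S (S (S j)))) by lia.
  rewrite (off_trunc a k (S j) (S (S (S j)))) by lia.
  rewrite (off_trunc a k j (S (S (S j)))) by lia.
  rewrite (off_trunc a (S k) (S j) (S (S j))) by lia.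
  (* The index n is shifted by one; the term added at [n = 0] is null because [G O] is the unit of
     convolution. *)
  assert (E : csum (S (S j)) (fun n => a (S k + n)%nat
        * (G (S n) (S j) - G (S n) (S (S j))))
    = csum (S (S (S j))) (fun n => a (k + n)%nat * (G n (S j) - G n (S (S j))))).
  { rewrite (csum_S_l (S (S j))), !G0S.
    transitivity (0 + csum (S (S j)) (fun n => a (S k + n)%nat
        * (G (S n) (S j) - G (S n) (S (S j))))); [now rewrite Cplus_0_l|].
    f_equal; [ring|]. apply csum_ext. intros n _.
    now rewrite Nat.add_succ_r. }
  rewrite E.
  transitivity (mu2 / mu1 * ((2 * lam + mu1 + mu2) * csum (S (S (S j))) (fun n =>
      a (k + n)%nat * (G (S n) (S j) - G (S n) (S (S j))))
    - mu1 * csum (S (S (S j))) (fun n => a (k + n)%nat * (G n (S j) - G n (S (S j))))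
    - 2 * lam * csum (S (S (S j))) (fun n =>
      a (k + n)%nat * (G (S n) j - G (S n) (S j))))); [|ring].
  transitivity (mu2 / mu1 * (mu2 * csum (S (S (S j))) (fun n =>
      a (k + n)%nat * (G (S n) (S (S j)) - G (S n) (S (S (S j))))))); [ring|].
  f_equal. rewrite <- !csum_scal, <- !csum_minus. apply csum_ext. intros n _.
  transitivity (a (k + n)%nat * (mu2 * G (S n) (S (S j)) - mu2 * G (S n) (S (S (S j)))));
    [ring|].
  rewrite !GS. ring.
Qed.

(** The differences in [off] telescope in j. This turns the sum of a column into the sums that make
    up [dia]. *)
Lemma off_sum a k N :
  mu1 * csum (S N) (off mu1 mu2 G a k) =
  - mu2 * csum (S N) (fun n => a (k + n)%nat * G (S n) (S N)).
Proof.
  pose proof HG as (G00 & G0S & G0 & G1 & GS).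
  rewrite (csum_ext (S N) _ (fun j => mu2 / mu1 * csum (S N) (fun n =>
    a (k + n)%nat * (G (S n) j - G (S n) (S j))))).
  2:{ intros j Hj. apply off_trunc. lia. }
  rewrite csum_scal, csum_swap.
  rewrite (csum_ext (S N) _ (fun n => (- (1)) * (a (k + n)%nat * G (S n) (S N)))).
  2:{ intros n _. rewrite csum_scal.
      assert (T : forall M, csum M (fun j => G (S n) j - G (S n) (S j))
        = - G (S n) M).
      { intros M. induction M as [|M IH]; simpl; [rewrite G0|rewrite IH]; ring. }
      rewrite T. ring. }
  rewrite csum_scal. field. easy.
Qed.

(* The recurrence in j involves only states (k, j) with j < k. *)
Lemma off_unique a (Q : nat -> nat -> C) :
  (forall k, Q k O = a k) ->
  (forall k, (1 < k)%nat ->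
     mu2 * Q k 1%nat = (mu1 + 2 * lam) * Q k 0%nat - mu1 * Q (S k) 0%nat) ->
  (forall k j, (S (S j) < k)%nat ->
     mu2 * Q k (S (S j)) = (2 * lam + mu1 + mu2) * Q k (S j)
       - mu1 * Q (S k) (S j) - 2 * lam * Q k j) ->
  forall k j, (j < k)%nat -> Q k j = off mu1 mu2 G a k j.
Proof.
  intros Q0 Q1 QS.
  assert (K : forall x y, mu2 * x = mu2 * y -> x = y).
  { intros x y E. replace x with (/ mu2 * (mu2 * x)) by (field; easy).
    rewrite E. field. easy. }
  enough (H : forall j, (forall k, (j < k)%nat -> Q k j = off mu1 mu2 G a k j) /\
    (forall k, (S j < k)%nat -> Q k (S j) = off mu1 mu2 G a k (S j)))
    by (intros k j; apply H).
  induction j as [|j [IH1 IH2]].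
  - split; intros k Hk; [now rewrite Q0, off_0|].
    apply K. rewrite Q1, off_1, !Q0, !off_0 by easy. easy.
  - split; [easy|]. intros k Hk. apply K.
    rewrite QS, off_SS, !IH2, IH1 by lia. easy.
Qed.

End Off.

Lemma off_scal (mu1 mu2 : R) G (c : C) (a : nat -> C) k j :
  off mu1 mu2 G (fun l => c * a l) k j = c * off mu1 mu2 G a k j.
Proof.
  unfold off.
  transitivity (mu2 / mu1 * (c * csum (S j) (fun n =>
    a (k + n)%nat * (G (S n) j - G (S n) (S j))))); [|ring].
  f_equal. rewrite <- csum_scal. apply csum_ext. intros. ring.
Qed.

Lemma dia_scal (lam mu1 mu2 : R) G1 G2 (c : C) (a b : nat -> C) k :
  dia lam mu1 mu2 G1 G2 (fun l => c * a l) (fun l => c * b l) k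
  = c * dia lam mu1 mu2 G1 G2 a b k.
Proof.
  unfold dia.
  transitivity (- (1 / (2 * lam)) * (c * csum (S k) (fun n =>
    mu2 * a (S k + n)%nat * G1 (S n) (S k)
    + mu1 * b (S k + n)%nat * G2 (S n) (S k)))); [|ring].
  f_equal. rewrite <- csum_scal. apply csum_ext. intros. ring.
Qed.

(** The cut equation of the square [{max <= k}]: arrivals leave it only from its corner [(k, k)],
    services enter it from the column and the row of index k + 1. *)
Lemma dia_off (lam mu1 mu2 : R) G1 G2 (a b : nat -> C) k :
  (0 < lam)%R -> (0 < mu1)%R -> (0 < mu2)%R ->
  is_gpow lam mu1 mu2 G1 -> is_gpow lam mu2 mu1 G2 ->
  2 * lam * dia lam mu1 mu2 G1 G2 a b k =
  mu1 * csum (S k) (off mu1 mu2 G1 a (S k))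
  + mu2 * csum (S k) (off mu2 mu1 G2 b (S k)).
Proof.
  intros Hl H1 H2 HG1 HG2.
  rewrite (off_sum lam mu1 mu2 G1), (off_sum lam mu2 mu1 G2) by easy.
  unfold dia. rewrite csum_plus.
  rewrite (csum_ext (S k) (fun n => mu2 * a (S k + n)%nat * G1 (S n) (S k))
    (fun n => mu2 * (a (S k + n)%nat * G1 (S n) (S k)))) by (intros; ring).
  rewrite (csum_ext (S k) (fun n => mu1 * b (S k + n)%nat * G2 (S n) (S k))
    (fun n => mu1 * (b (S k + n)%nat * G2 (S n) (S k)))) by (intros; ring).
  rewrite !csum_scal. field. now apply RtoC_neq0.
Qed.

Lemma off_diag_off K lam (mu1 mu2 : R) g (a : nat -> C) k j :
  (0 < mu2)%R -> is_gpow lam mu1 mu2 (conv_pow g) ->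
  off_diag K mu1 mu2 g a k j = off mu1 mu2 (conv_pow g) (mask K a) k j.
Proof.
  intros H2 HG. unfold off_diag, off. f_equal.
  rewrite (sum_from_finite K k _ (S j)).
  - apply csum_ext. intros n _. unfold mask.
    destruct in_cap; [|ring]. do 2 f_equal; f_equal; lia.
  - intros n Hn. rewrite !(gpow_zero lam mu1 mu2 (conv_pow g)) by (easy || lia).
    ring.
Qed.

Lemma on_diag_dia K lam (mu1 mu2 : R) g1 g2 (a b : nat -> C) k :
  (0 < mu1)%R -> (0 < mu2)%R ->
  is_gpow lam mu1 mu2 (conv_pow g1) -> is_gpow lam mu2 mu1 (conv_pow g2) ->
  on_diag K lam mu1 mu2 g1 g2 a b k =
  dia lam mu1 mu2 (conv_pow g1) (conv_pow g2) (mask K a) (mask K b) k.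
Proof.
  intros H1 H2 HG1 HG2. unfold on_diag, dia. f_equal.
  rewrite (sum_from_finite K (k + 1) _ (S k)).
  - apply csum_ext. intros n _. unfold mask.
    replace (k + 1 + n)%nat with (S k + n)%nat by lia.
    replace (S k + n - k)%nat with (S n) by lia.
    replace (k + 1)%nat with (S k) by lia.
    destruct in_cap; ring.
  - intros n Hn.
    rewrite (gpow_zero lam mu1 mu2 (conv_pow g1)),
      (gpow_zero lam mu2 mu1 (conv_pow g2)) by (easy || lia).
    ring.
Qed.

(* The capacity cuts the sum off after its first term. *)
Lemma corner_off n lam (mu1 mu2 : R) g1 g2 (a b : nat -> C) :
  (0 < mu1)%R -> (0 < mu2)%R -> (0 < n)%nat ->
  is_gpow lam mu1 mu2 (conv_pow g1) -> is_gpow lam mu2 mu1 (conv_pow g2) ->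
  (mu1 + mu2) * corner lam mu1 mu2 g1 g2 a b n =
  2 * lam * (off mu1 mu2 (conv_pow g1) (mask (Some n) a) n (n - 1)
             + off mu2 mu1 (conv_pow g2) (mask (Some n) b) n (n - 1)).
Proof.
  intros H1 H2 Hn HG1 HG2.
  assert (E : forall (x y : R) g (c : nat -> C),
    off x y (conv_pow g) (mask (Some n) c) n (n - 1) =
    y / x * c n * (g (n - 1)%nat - g n)).
  { intros x y g c. unfold off.
    assert (E1 : forall j, conv_pow g 1%nat j = g j).
    { intros j. change (conv g (conv_pow g O) j = g j). unfold conv.
      rewrite sum_n_csum. change (csum j (fun m => g m * conv_pow g 0 (j - m)%nat)
        + g j * conv_pow g 0 (j - j)%nat = g j).
      rewrite csum_0, Nat.sub_diag; [simpl; ring|].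
      intros k Hk. replace (j - k)%nat with (S (j - k - 1)) by lia. simpl. ring. }
    rewrite csum_S_l, csum_0, !E1.
    - unfold mask, in_cap. rewrite Nat.add_0_r, Nat.leb_refl.
      replace (S (n - 1)) with n by lia. ring.
    - intros k _. unfold mask, in_cap.
      replace (n + S k <=? n)%nat with false; [ring|].
      symmetry. apply Nat.leb_gt. lia. }
  rewrite !E. unfold corner. field. repeat split; try now apply RtoC_neq0.
  rewrite <- RtoC_plus. apply RtoC_neq0. lra.
Qed.

(** * Double series *)

(** Relational counterpart of [sum2]. It carries the convergence of the rows and of their sums,
    without which [Series] is not additive. *)
Definition is_sum2 (f : nat -> nat -> R) (v : R) : Prop :=
  exists r : nat -> R, (forall j, is_series (f j) (r j)) /\ is_series r v.

Lemma is_sum2_unique f v : is_sum2 f v -> sum2 f = v.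
Proof.
  intros [r [Hr Hv]]. unfold sum2. rewrite (Series_ext _ r).
  - now apply is_series_unique.
  - intros j. now apply is_series_unique.
Qed.

Lemma summable2_is_sum2 f : summable2 f -> is_sum2 f (sum2 f).
Proof.
  intros [Hr Hv]. exists (fun j => Series (f j)). split.
  - intros j. now apply Series_correct.
  - now apply Series_correct.
Qed.

Lemma is_sum2_ext f g v :
  (forall j k, f j k = g j k) -> is_sum2 f v -> is_sum2 g v.
Proof.
  intros H [r [Hr Hv]]. exists r. split; [|easy].
  intros j. now apply is_series_ext with (f j).
Qed.

Lemma is_sum2_plus f g v w :
  is_sum2 f v -> is_sum2 g w -> is_sum2 (fun j k => f j k + g j k)%R (v + w)%R.
Proof.
  intros [r [Hr Hv]] [s [Hs Hw]]. exists (fun j => r j + s j)%R. split.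
  - intros j. now apply (is_series_plus (f j) (g j)).
  - now apply (is_series_plus r s).
Qed.

Lemma is_sum2_scal (c : R) f v :
  is_sum2 f v -> is_sum2 (fun j k => c * f j k)%R (c * v)%R.
Proof.
  intros [r [Hr Hv]]. exists (fun j => c * r j)%R. split.
  - intros j. now apply (is_series_scal c (f j)).
  - now apply (is_series_scal c r).
Qed.

Lemma is_series_point (A : nat) (v : R) :
  is_series (fun j => if (j =? A)%nat then v else 0%R) v.
Proof.
  apply is_series_rsum, is_lim_seq_ext_loc with (fun _ => v).
  - exists (S A). intros n Hn.
    assert (E : forall m, rsum m (fun j => if (j =? A)%nat then v else 0%R)
      = if (A <? m)%nat then v else 0%R).
    { induction m as [|m IH]; [easy|]. simpl rsum. rewrite IH.
      destruct (Nat.ltb_spec A m), (Nat.ltb_spec A (S m)), (Nat.eqb_spec m A);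
        try lia; ring. }
    rewrite E. destruct (Nat.ltb_spec A n); [easy|lia].
  - apply is_lim_seq_const.
Qed.

Definition point (A B : nat) (v : R) (j k : nat) : R :=
  if (j =? A)%nat && (k =? B)%nat then v else 0%R.

Lemma is_series_zero : is_series (fun _ : nat => 0%R) 0%R.
Proof.
  apply is_series_ext with (fun j => if (j =? 0)%nat then 0%R else 0%R).
  - intros n. now destruct Nat.eqb.
  - apply is_series_point.
Qed.

Lemma is_sum2_point A B v : is_sum2 (point A B v) v.
Proof.
  exists (fun j => if (j =? A)%nat then v else 0%R). split.
  - intros j. unfold point. destruct (j =? A)%nat; simpl.
    + apply is_series_point.
    + apply is_series_zero.
  - apply is_series_point.
Qed.

Lemma is_sum2_zero : is_sum2 (fun _ _ => 0%R) 0%R.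
Proof.
  exists (fun _ => 0%R). split; intros; apply is_series_zero.
Qed.

Lemma is_series_rsum_le (u : nat -> R) l n :
  (forall k, (0 <= u k)%R) -> is_series u l -> (rsum n u <= l)%R.
Proof.
  intros H Hl. apply is_series_rsum in Hl.
  apply (is_lim_seq_incr_compare (fun n => rsum n u)); [easy|].
  intros m. apply rsum_incr; auto.
Qed.

(** * Sums over antidiagonals and triangles *)

Definition adiag (f : nat -> nat -> R) (n : nat) : R :=
  rsum (S n) (fun j => f j (n - j)%nat).

Lemma rsum_adiag n f :
  rsum n (adiag f) = rsum n (fun j => rsum (n - j) (f j)).
Proof.
  induction n as [|n IH]; [easy|].
  change (rsum n (adiag f) + (rsum n (fun j => f j (n - j)%nat) + f n (n - n)%nat)
    = rsum n (fun j => rsum (S n - j) (f j)) + rsum (S n - n) (f n))%R.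
  rewrite IH, <- Rplus_assoc, <- rsum_plus, Nat.sub_diag.
  replace (S n - n)%nat with 1%nat by lia.
  f_equal; [|simpl; ring]. apply rsum_ext. intros j Hj.
  now replace (S n - j)%nat with (S (n - j)) by lia.
Qed.

Lemma rsum_adiag_le f v n :
  (forall j k, (0 <= f j k)%R) -> is_sum2 f v -> (rsum n (adiag f) <= v)%R.
Proof.
  intros H [r [Hr Hv]]. rewrite rsum_adiag.
  assert (Hr0 : forall m j, (rsum m (f j) <= r j)%R)
    by (intros m j; now apply is_series_rsum_le).
  apply Rle_trans with (rsum n r).
  - now apply rsum_le.
  - apply is_series_rsum_le; [|easy]. intros j. apply (Hr0 O).
Qed.

Lemma adiag_ge0 f n : (forall j k, (0 <= f j k)%R) -> (0 <= adiag f n)%R.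
Proof. intros H. now apply rsum_ge0. Qed.

(** Comparison of shapes: a triangle is contained in finitely many rows, and a box of sides J and M
    in the triangle of size J + M. In the second bound M tends to infinity before J. *)
Lemma is_series_adiag f v :
  (forall j k, (0 <= f j k)%R) -> is_sum2 f v -> is_series (adiag f) v.
Proof.
  intros H Hf. apply is_series_rsum.
  assert (Hi : forall n, (rsum n (adiag f) <= rsum (S n) (adiag f))%R).
  { intros n. apply rsum_incr; [lia|]. intros; now apply adiag_ge0. }
  destruct (ex_finite_lim_seq_incr (fun n => rsum n (adiag f)) v Hi) as [l Hl].
  { intros n. now apply rsum_adiag_le. }
  assert (Hlv : (l <= v)%R).
  { apply (is_lim_seq_le (fun n => rsum n (adiag f)) (fun _ => v) l v); try easy.
    - intros n. now apply rsum_adiag_le.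
    - apply is_lim_seq_const. }
  enough (v <= l)%R by (now replace v with l by lra).
  destruct Hf as [r [Hr Hv]].
  assert (Hbox : forall J M, (rsum J (fun j => rsum M (f j)) <= l)%R).
  { intros J M. apply Rle_trans with (rsum (J + M) (adiag f)).
    - rewrite rsum_adiag. apply Rle_trans with (rsum J (fun j => rsum (J + M - j) (f j))).
      + apply rsum_le. intros j Hj. apply rsum_incr; [lia|auto].
      + apply rsum_incr; [lia|]. intros j. now apply rsum_ge0.
    - apply (is_lim_seq_incr_compare (fun n => rsum n (adiag f))); easy. }
  assert (HJ : forall J, (rsum J r <= l)%R).
  { intros J.
    apply (is_lim_seq_le (fun M => rsum J (fun j => rsum M (f j))) (fun _ => l)
             (rsum J r) l); [easy| |apply is_lim_seq_const].
    induction J as [|J IH]; simpl; [apply is_lim_seq_const|].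
    apply is_lim_seq_plus'; [easy|]. now apply is_series_rsum. }
  apply is_series_rsum in Hv.
  apply (is_lim_seq_le (fun J => rsum J r) (fun _ => l) v l);
    [easy|easy|apply is_lim_seq_const].
Qed.

(** * Balance equations *)

(** One definition serves both queues: the second one uses it with the coordinates exchanged and
    with [p2]. The value 0 at a full corner encodes the loss of arrivals. *)
Definition join_rate (K : option nat) (lam p : R) (j k : nat) : R :=
  if (j <? k)%nat then (2 * lam)%R
  else if (j =? k)%nat && in_cap K (S k) then (2 * lam * p)%R else 0%R.

(* The net flow from (j + 1, k) to (j, k); exchanging the coordinates of [m]
   gives the flow along the other queue. *)
Definition flow (K : option nat) (lam mu p : R) (m : nat -> nat -> C)
    (j k : nat) : C :=
  mu * m (S j) k - join_rate K lam p j k * m j k.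

Definition dflow (K : option nat) (lam mu p : R) (m : nat -> nat -> C)
    (j k : nat) : C :=
  flow K lam mu p m j k -
  match j with O => 0 | S j' => flow K lam mu p m j' k end.

(** Inflow minus outflow as a discrete divergence, so that sums over squares and triangles
    telescope; [net_in_out] gives back the usual form. *)
Definition net (K : option nat) (lam mu1 mu2 p1 p2 : R) (m : nat -> nat -> C)
    (j k : nat) : C :=
  dflow K lam mu1 p1 m j k + dflow K lam mu2 p2 (fun j k => m k j) k j.

Definition null_off (K : option nat) (m : nat -> nat -> C) : Prop :=
  forall j k, in_cap K j && in_cap K k = false -> m j k = 0.

Lemma in_cap_S K k : in_cap K (S k) = true -> in_cap K k = true.
Proof.
  destruct K as [n|]; [|easy]. unfold in_cap. rewrite !Nat.leb_le. lia.
Qed.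

Lemma in_cap_le K j k : (j <= k)%nat -> in_cap K k = true -> in_cap K j = true.
Proof.
  destruct K as [n|]; [|easy]. unfold in_cap. rewrite !Nat.leb_le. lia.
Qed.

Lemma flow_null K lam mu p m j k :
  null_off K m -> in_cap K (S j) && in_cap K k = false ->
  flow K lam mu p m j k = 0.
Proof.
  intros Hm Hjk. unfold flow. rewrite (Hm _ _ Hjk).
  destruct (in_cap K j && in_cap K k) eqn:E.
  - apply andb_prop in E. destruct E as [Ej Ek]. rewrite Ek, andb_true_r in Hjk.
    unfold join_rate. destruct (Nat.ltb_spec j k) as [Hlt|Hge].
    + rewrite (in_cap_le K (S j) k) in Hjk; [easy|lia|easy].
    + destruct (Nat.eqb_spec j k) as [->|Hne]; simpl; [rewrite Hjk|]; ring.
  - rewrite (Hm _ _ E). ring.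
Qed.

(** No transition leads out of the state space, so the balance equations can be imposed on all of
    nat * nat, without side conditions. *)
Lemma net_null K lam mu1 mu2 p1 p2 m j k :
  null_off K m -> in_cap K j && in_cap K k = false ->
  net K lam mu1 mu2 p1 p2 m j k = 0.
Proof.
  assert (D : forall mu p m' j k, null_off K m' ->
    in_cap K j && in_cap K k = false -> dflow K lam mu p m' j k = 0).
  { clear. intros mu p m' j k Hm Hjk. unfold dflow. rewrite flow_null; [|easy|].
    - destruct j; [ring|]. rewrite flow_null by easy. ring.
    - destruct (in_cap K (S j)) eqn:E; [|easy].
      now rewrite (in_cap_S _ _ E) in Hjk. }
  intros Hm Hjk. unfold net. rewrite !D; try easy.
  - ring.
  - intros j' k' H. apply Hm. now rewrite andb_comm.
  - now rewrite andb_comm.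
Qed.

Section Invariance.

Variables (K : option nat) (lam mu1 mu2 p1 p2 : R).

Let up1 j k := join_rate K lam p1 j k.
Let up2 j k := join_rate K lam p2 k j.

(** As a function of the source, the rate is a sum of at most four point masses; this reduces the
    double series in the definition of invariance to a finite expression. *)
Lemma rate_in j k j' k' :
  rate K lam mu1 mu2 p1 p2 j' k' j k =
  (point (S j) k mu1 j' k' + point j (S k) mu2 j' k'
   + match j with O => 0 | S i => point i k (up1 i k) j' k' end
   + match k with O => 0 | S i => point j i (up2 j i) j' k' end)%R.
Proof.
  unfold rate, point, up1, up2, join_rate.
  destruct j as [|j], k as [|k];
  repeat match goal with
  | |- context [(?a =? ?b)%nat] => destruct (Nat.eqb_spec a b); try (exfalso; lia)
  end; simpl andb; cbv iota; subst; try ring;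
  repeat match goal with
  | |- context [(?a <? ?b)%nat] => destruct (Nat.ltb_spec a b); try (exfalso; lia)
  end; try ring; try easy.
Qed.

Lemma rate_out j k j' k' :
  rate K lam mu1 mu2 p1 p2 j k j' k' =
  (match j with O => 0 | S i => point i k mu1 j' k' end
   + match k with O => 0 | S i => point j i mu2 j' k' end
   + point (S j) k (up1 j k) j' k' + point j (S k) (up2 j k) j' k')%R.
Proof.
  unfold rate, point, up1, up2, join_rate.
  destruct j as [|j], k as [|k];
  repeat match goal with
  | |- context [(?a =? ?b)%nat] => destruct (Nat.eqb_spec a b); try (exfalso; lia)
  end; simpl andb; cbv iota; subst; try ring;
  repeat match goal with
  | |- context [(?a <? ?b)%nat] => destruct (Nat.ltb_spec a b); try (exfalso; lia)
  end; try ring; try (replace j with k by lia; ring); try easy.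
Qed.

Lemma sum2_in (pi : nat -> nat -> R) j k :
  sum2 (fun j' k' => pi j' k' * rate K lam mu1 mu2 p1 p2 j' k' j k)%R =
  (mu1 * pi (S j) k + mu2 * pi j (S k)
   + match j with O => 0 | S i => up1 i k * pi i k end
   + match k with O => 0 | S i => up2 j i * pi j i end)%R.
Proof.
  apply is_sum2_unique.
  apply is_sum2_ext with (fun j' k' =>
    point (S j) k (mu1 * pi (S j) k) j' k' + point j (S k) (mu2 * pi j (S k)) j' k'
     + match j with O => 0 | S i => point i k (up1 i k * pi i k) j' k' end
     + match k with O => 0 | S i => point j i (up2 j i * pi j i) j' k' end)%R.
  - intros j' k'. rewrite rate_in, !Rmult_plus_distr_l.
    assert (E : forall A B c,
      point A B (c * pi A B) j' k' = (pi j' k' * point A B c j' k')%R).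
    { intros A B c. unfold point.
      destruct (Nat.eqb_spec j' A) as [->|], (Nat.eqb_spec k' B) as [->|];
        simpl; ring. }
    rewrite !E. destruct j, k; rewrite ?E; ring.
  - repeat apply is_sum2_plus; try apply is_sum2_point.
    + destruct j; [apply is_sum2_zero|apply is_sum2_point].
    + destruct k; [apply is_sum2_zero|apply is_sum2_point].
Qed.

Lemma sum2_out j k :
  sum2 (rate K lam mu1 mu2 p1 p2 j k) =
  (match j with O => 0 | S i => mu1 end + match k with O => 0 | S i => mu2 end
   + up1 j k + up2 j k)%R.
Proof.
  apply is_sum2_unique. eapply is_sum2_ext.
  - intros j' k'. symmetry. apply rate_out.
  - repeat apply is_sum2_plus; try apply is_sum2_point.
    + destruct j; [apply is_sum2_zero|apply is_sum2_point].
    + destruct k; [apply is_sum2_zero|apply is_sum2_point].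
Qed.

Definition outrate (j k : nat) : R :=
  (match j with O => 0 | S _ => mu1 end + match k with O => 0 | S _ => mu2 end
   + up1 j k + up2 j k)%R.

Lemma net_in_out (m : nat -> nat -> C) j k :
  net K lam mu1 mu2 p1 p2 m j k =
  mu1 * m (S j) k + mu2 * m j (S k)
   + match j with O => 0 | S i => up1 i k * m i k end
   + match k with O => 0 | S i => up2 j i * m j i end
  - m j k * outrate j k.
Proof.
  unfold net, dflow, flow, outrate, up1, up2.
  destruct j, k; rewrite !RtoC_plus; ring.
Qed.

(** Real counterpart of [net], for [pi] and for the modulus of a complex solution, where signs
    matter. *)
Definition rnet (m : nat -> nat -> R) (j k : nat) : R :=
  (mu1 * m (S j) k + mu2 * m j (S k)
   + match j with O => 0 | S i => up1 i k * m i k end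
   + match k with O => 0 | S i => up2 j i * m j i end
   - m j k * outrate j k)%R.

Lemma net_RtoC (m : nat -> nat -> R) j k :
  net K lam mu1 mu2 p1 p2 (fun j k => RtoC (m j k)) j k = RtoC (rnet m j k).
Proof.
  rewrite net_in_out. unfold rnet.
  destruct j, k; apply injective_projections; simpl; ring.
Qed.

Lemma invariant_net (pi : nat -> nat -> R) :
  is_invariant_distribution K lam mu1 mu2 p1 p2 pi ->
  forall j k, net K lam mu1 mu2 p1 p2 (fun j k => RtoC (pi j k)) j k = 0.
Proof.
  intros (_ & Hz & _ & _ & Hb) j k.
  destruct (in_cap K j && in_cap K k) eqn:E.
  - apply andb_prop in E. destruct E as [Ej Ek].
    specialize (Hb j k Ej Ek). rewrite sum2_in, sum2_out in Hb.
    rewrite net_RtoC. unfold rnet, outrate. rewrite Hb. f_equal. ring.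
  - apply net_null with (2 := E). intros j' k' H. now rewrite Hz.
Qed.

(** * Flux identities *)

Lemma csum_dflow mu p m n k :
  csum (S n) (fun j => dflow K lam mu p m j k) = flow K lam mu p m n k.
Proof.
  induction n as [|n IH].
  - simpl. unfold dflow. ring.
  - change (csum (S n) (fun j => dflow K lam mu p m j k)
      + dflow K lam mu p m (S n) k = flow K lam mu p m (S n) k).
    rewrite IH. unfold dflow. ring.
Qed.

(** Across an edge of the square, at [(n, k)] with [k < n], an arrival joins the other queue; so
    arrivals contribute at the corner alone. *)
Lemma flow_edge mu p m n :
  csum (S n) (flow K lam mu p m n) =
  mu * csum (S n) (m (S n)) - join_rate K lam p n n * m n n.
Proof.
  simpl. rewrite (csum_ext n _ (fun k => mu * m (S n) k)).
  - rewrite csum_scal. unfold flow. ring.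
  - intros k Hk. unfold flow, join_rate.
    destruct (Nat.ltb_spec n k); [lia|]. destruct (Nat.eqb_spec n k); [lia|].
    simpl. ring.
Qed.

Lemma box_flux m n :
  csum (S n) (fun j => csum (S n) (net K lam mu1 mu2 p1 p2 m j)) =
  mu1 * csum (S n) (m (S n)) + mu2 * csum (S n) (fun j => m j (S n))
  - (join_rate K lam p1 n n + join_rate K lam p2 n n) * m n n.
Proof.
  unfold net.
  rewrite (csum_ext (S n) _ (fun j =>
    csum (S n) (fun k => dflow K lam mu1 p1 m j k)
    + csum (S n) (fun k => dflow K lam mu2 p2 (fun j k => m k j) k j)))
    by (intros; apply csum_plus).
  rewrite csum_plus, csum_swap.
  rewrite (csum_ext (S n) _ (flow K lam mu1 p1 m n))
    by (intros; apply csum_dflow).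
  rewrite (csum_ext (S n) (fun j => csum (S n) _)
    (flow K lam mu2 p2 (fun j k => m k j) n))
    by (intros; apply csum_dflow).
  rewrite !flow_edge. ring.
Qed.

(** Every transition changes [j + k] by one, so the net flow into a triangle passes between two
    consecutive antidiagonals; this is the share of one queue. *)
Definition level (mu p : R) (m : nat -> nat -> C) (n : nat) : C :=
  csum (S n) (fun j => flow K lam mu p m j (n - j)%nat).

Lemma csum_rev n (f : nat -> C) :
  csum (S n) f = csum (S n) (fun j => f (n - j)%nat).
Proof.
  induction n as [|n IH]; [easy|].
  rewrite (csum_S_l (S n) (fun j => f (S n - j)%nat)).
  change (csum (S (S n)) f) with (csum (S n) f + f (S n)).
  rewrite IH. simpl (S n - 0)%nat. rewrite Cplus_comm. f_equal.
Qed.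

Lemma adiag_dflow mu p m n :
  csum (S n) (fun j => dflow K lam mu p m j (n - j)%nat) =
  level mu p m n - match n with O => 0 | S n' => level mu p m n' end.
Proof.
  unfold dflow. rewrite csum_minus. unfold level at 1. f_equal. f_equal.
  rewrite csum_S_l. destruct n as [|n]; [simpl; ring|].
  unfold level. rewrite Cplus_0_l. now apply csum_ext.
Qed.

Lemma level_flux m n :
  csum (S n) (fun j => net K lam mu1 mu2 p1 p2 m j (n - j)%nat) =
  (level mu1 p1 m n + level mu2 p2 (fun j k => m k j) n) -
  match n with O => 0 | S n' =>
    level mu1 p1 m n' + level mu2 p2 (fun j k => m k j) n' end.
Proof.
  unfold net. rewrite csum_plus.
  rewrite (csum_rev n (fun j => dflow K lam mu2 p2 _ (n - j) j)).
  rewrite (csum_ext (S n) (fun j => dflow K lam mu2 p2 _ (n - (n - j)) (n - j))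
    (fun j => dflow K lam mu2 p2 (fun j k => m k j) j (n - j)%nat)).
  - rewrite !adiag_dflow. destruct n; ring.
  - intros j Hj. now replace (n - (n - j))%nat with j by lia.
Qed.

Lemma triangle_flux m n :
  csum (S n) (fun i => csum (S i) (fun j => net K lam mu1 mu2 p1 p2 m j (i - j)%nat))
  = level mu1 p1 m n + level mu2 p2 (fun j k => m k j) n.
Proof.
  induction n as [|n IH].
  - change (0 + csum 1 (fun j => net K lam mu1 mu2 p1 p2 m j (0 - j)%nat)
      = level mu1 p1 m 0 + level mu2 p2 (fun j k => m k j) 0).
    rewrite level_flux. ring.
  - change (csum (S n) (fun i => csum (S i) (fun j =>
      net K lam mu1 mu2 p1 p2 m j (i - j)%nat))
      + csum (S (S n)) (fun j => net K lam mu1 mu2 p1 p2 m j (S n - j)%nat)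
      = level mu1 p1 m (S n) + level mu2 p2 (fun j k => m k j) (S n)).
    rewrite IH, level_flux. ring.
Qed.

End Invariance.

(** With the next lemma, a substitute for linear arithmetic over C: an equation is deduced from a
    known one by a [ring] check that the differences of sides agree. *)
Lemma eq_plus_null (e x y : C) : e = 0 -> x = y + e -> x = y.
Proof. intros -> ->. ring. Qed.

Lemma null_of_eq (x y e : C) : x = y -> e = y - x -> e = 0.
Proof. intros -> ->. ring. Qed.

(** * The balance equations below the diagonal *)

Lemma net_swap K lam mu1 mu2 p1 p2 m j k :
  net K lam mu1 mu2 p1 p2 m j k = net K lam mu2 mu1 p2 p1 (fun j k => m k j) k j.
Proof. unfold net. apply Cplus_comm. Qed.

(** Arrivals at [(j, j)] reach only the neighbours of the diagonal, whence the conditional term;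
    farther below, all arrivals go to queue 2 at rate [2 * lam]. *)
Lemma net_below K lam mu1 mu2 p1 p2 m k j :
  (j < k)%nat ->
  net K lam mu1 mu2 p1 p2 m k j =
  mu1 * m (S k) j + mu2 * m k (S j)
  + match j with O => 0 | S i => 2 * lam * m k i end
  + (if (k =? S j)%nat then join_rate K lam p1 j j * m j j else 0)
  - m k j * (mu1 + 2 * lam + match j with O => 0 | S _ => mu2 end).
Proof.
  intros Hjk. rewrite net_in_out.
  assert (E1 : forall i, (j < i)%nat -> join_rate K lam p1 i j = 0%R).
  { intros i Hi. unfold join_rate. destruct (Nat.ltb_spec i j); [lia|].
    destruct (Nat.eqb_spec i j); [lia|easy]. }
  assert (E2 : forall i, (i < k)%nat -> join_rate K lam p2 i k = (2 * lam)%R).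
  { intros i Hi. unfold join_rate. destruct (Nat.ltb_spec i k); [easy|lia]. }
  unfold outrate. destruct k as [|k]; [lia|].
  rewrite (E1 (S k)), (E2 j) by lia.
  assert (E3 : match j with
      | O => RtoC 0 | S i => join_rate K lam p2 i (S k) * m (S k) i end
    = match j with O => RtoC 0 | S i => 2 * lam * m (S k) i end).
  { destruct j as [|j]; [easy|]. rewrite E2 by lia. now rewrite RtoC_mult. }
  rewrite E3.
  assert (E4 : RtoC (match j with O => 0%R | S _ => mu2 end)
    = match j with O => RtoC 0 | S _ => RtoC mu2 end) by now destruct j.
  rewrite !RtoC_plus, RtoC_mult, E4.
  destruct (Nat.eqb_spec (S k) (S j)) as [E|E].
  - injection E as ->. ring.
  - rewrite (E1 k) by lia. ring.
Qed.

Lemma csum_single n j (f : nat -> C) :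
  (j < n)%nat -> (forall k, (k < n)%nat -> k <> j -> f k = 0) -> csum n f = f j.
Proof.
  intros Hj H. replace n with (j + S (n - j - 1))%nat by lia.
  rewrite csum_add, csum_0, csum_S_l, csum_0, Nat.add_0_r; [ring| |].
  - intros k Hk. apply H; lia.
  - intros k Hk. apply H; lia.
Qed.

Definition null_seq (K : option nat) (a : nat -> C) : Prop :=
  forall l, in_cap K l = false -> a l = 0.

Lemma not_in_cap_le K j k :
  (j <= k)%nat -> in_cap K j = false -> in_cap K k = false.
Proof.
  intros Hjk Hj. destruct (in_cap K k) eqn:E; [|easy].
  now rewrite (in_cap_le K j k) in Hj.
Qed.

Lemma off_null K mu1 mu2 G a k j :
  null_seq K a -> in_cap K k = false -> off mu1 mu2 G a k j = 0.
Proof.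
  intros Ha Hk. unfold off. rewrite csum_0; [ring|].
  intros n _. rewrite Ha; [ring|]. now apply not_in_cap_le with k; [lia|].
Qed.

Lemma dia_null K lam mu1 mu2 G1 G2 a b k :
  null_seq K a -> null_seq K b -> in_cap K (S k) = false ->
  dia lam mu1 mu2 G1 G2 a b k = 0.
Proof.
  intros Ha Hb Hk. unfold dia. rewrite csum_0; [ring|].
  intros n _. rewrite Ha, Hb; [ring| |];
    (apply not_in_cap_le with (S k); [lia|easy]).
Qed.

(** The coefficients of [cap_term] as a polynomial in x. *)
Definition cap_delta (K : option nat) (c : C) (k : nat) : C :=
  match K with Some n => if (k =? n)%nat then c else 0 | None => 0 end.

Lemma cap_delta_0 K c k : in_cap K (S k) = true -> cap_delta K c k = 0.
Proof.
  destruct K as [n|]; [|easy]. unfold in_cap, cap_delta. rewrite Nat.leb_le.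
  intros H. destruct (Nat.eqb_spec k n); [lia|easy].
Qed.

Section Below.

Variables (K : option nat) (lam mu1 mu2 p1 p2 : R) (G : nat -> nat -> C).
Hypotheses (lam0 : (0 < lam)%R) (mu10 : (0 < mu1)%R) (mu20 : (0 < mu2)%R).
Hypothesis HG : is_gpow lam mu1 mu2 G.

Let NET := net K lam mu1 mu2 p1 p2.

Lemma balanced_off m :
  (forall j k, NET m j k = 0) ->
  forall k j, (j < k)%nat -> m k j = off mu1 mu2 G (fun l => m l O) k j.
Proof.
  intros Hm. apply (off_unique lam); try easy.
  - intros k Hk. generalize (Hm k O). unfold NET. rewrite net_below by lia.
    destruct (Nat.eqb_spec k 1) as [|_]; [lia|]. intros E.
    apply (eq_plus_null _ _ _ E); cbv iota; ring.
  - intros k j Hk. generalize (Hm k (S j)). unfold NET.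
    rewrite net_below by lia.
    destruct (Nat.eqb_spec k (S (S j))) as [|_]; [lia|]. intros E.
    apply (eq_plus_null _ _ _ E); cbv iota; ring.
Qed.

Lemma net_far m a :
  (forall k j, (j < k)%nat -> m k j = off mu1 mu2 G a k j) ->
  forall k j, (S j < k)%nat -> NET m k j = 0.
Proof.
  intros Hm k j Hk. unfold NET. rewrite net_below by lia.
  destruct (Nat.eqb_spec k (S j)) as [|_]; [lia|].
  rewrite !Hm by lia. destruct j as [|j].
  - rewrite (off_1 lam) by easy. ring.
  - rewrite (off_SS lam mu1 mu2 G), Hm by (easy || lia). ring.
Qed.

(** The extension [off] satisfies the recurrence at [(k + 1, k)] too, but without arrivals from the
    diagonal. Subtracting leaves these arrivals and the gap between the actual and the extended
    value at [(k + 1, k + 1)]. *)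
Lemma net_near m a :
  (forall k j, (j < k)%nat -> m k j = off mu1 mu2 G a k j) ->
  forall k, NET m (S k) k =
    mu2 * (m (S k) (S k) - off mu1 mu2 G a (S k) (S k))
    + join_rate K lam p1 k k * m k k.
Proof.
  intros Hm k. unfold NET. rewrite net_below by lia. rewrite Nat.eqb_refl.
  assert (E : mu2 * (m (S k) (S k) - off mu1 mu2 G a (S k) (S k))
    = mu2 * m (S k) (S k) - mu2 * off mu1 mu2 G a (S k) (S k)) by ring.
  rewrite E, (Hm (S (S k)) k), (Hm (S k) k) by lia. destruct k as [|k].
  - rewrite (off_1 lam) by easy. ring.
  - rewrite (off_SS lam mu1 mu2 G), (Hm (S (S k)) k) by (easy || lia). ring.
Qed.

End Below.

(** * Reconstruction of balanced arrays from their boundary values *)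

Section Reconstruction.

Variables (K : option nat) (lam mu1 mu2 p1 p2 : R) (G1 G2 : nat -> nat -> C).
Hypotheses (lam0 : (0 < lam)%R) (mu10 : (0 < mu1)%R) (mu20 : (0 < mu2)%R).
Hypotheses (psum : (p1 + p2 = 1)%R) (K1 : K <> Some O).
Hypotheses (HG1 : is_gpow lam mu1 mu2 G1) (HG2 : is_gpow lam mu2 mu1 G2).

Let NET := net K lam mu1 mu2 p1 p2.

(** For [k > 0] and [P = off], this is balance at [(k, k - 1)] or its mirror image; for [k = 0] it
    says that the boundary and the diagonal formula agree at the origin. The last term has [d]
    without [cap_delta] because arrivals at the full corner are lost. *)
Definition diag_relation (mu p : R) (P : nat -> nat -> C) (d : nat -> C) (c : C)
    (k : nat) : Prop :=
  mu * P k k = mu * (d k + cap_delta K c k)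
    + 2 * lam * p * match k with O => 0 | S i => d i end.

Definition diag_relations (a b : nat -> C) (c : C) : Prop :=
  forall k,
    diag_relation mu2 p1 (off mu1 mu2 G1 a) (dia lam mu1 mu2 G1 G2 a b) c k /\
    diag_relation mu1 p2 (off mu2 mu1 G2 b) (dia lam mu1 mu2 G1 G2 a b) c k.

Definition corner_relation (a b : nat -> C) (c : C) : Prop :=
  forall n, K = Some n ->
    (mu1 + mu2) * c = 2 * lam * (off mu1 mu2 G1 a n (n - 1)
                                 + off mu2 mu1 G2 b n (n - 1)).

Lemma join_rate_diag n :
  RtoC (join_rate K lam p1 n n + join_rate K lam p2 n n) =
  if in_cap K (S n) then 2 * lam else 0.
Proof.
  unfold join_rate. rewrite Nat.ltb_irrefl, Nat.eqb_refl. simpl andb.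
  destruct (in_cap K (S n)).
  - rewrite <- RtoC_mult. f_equal.
    transitivity (2 * lam * (p1 + p2))%R; [ring|]. rewrite psum. ring.
  - f_equal. ring.
Qed.

Lemma net_corner m n :
  K = Some n -> null_off K m ->
  NET m n n = 2 * lam * (m n (n - 1)%nat + m (n - 1)%nat n) - (mu1 + mu2) * m n n.
Proof.
  intros EK Hm. unfold NET. rewrite net_in_out. destruct n as [|n]; [easy|].
  replace (S n - 1)%nat with n by lia.
  assert (E : forall p, join_rate K lam p (S n) (S n) = 0%R).
  { intros p. unfold join_rate. rewrite Nat.ltb_irrefl, Nat.eqb_refl, EK. unfold in_cap.
    destruct (Nat.leb_spec (S (S n)) (S n)); [lia|easy]. }
  assert (E' : forall p, join_rate K lam p n (S n) = (2 * lam)%R).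
  { intros p. unfold join_rate. destruct (Nat.ltb_spec n (S n)); [easy|lia]. }
  unfold outrate. rewrite !E, !E', !RtoC_plus, !RtoC_mult.
  assert (Ho : in_cap K (S (S n)) = false)
    by (rewrite EK; apply Nat.leb_gt; lia).
  rewrite (Hm (S (S n)) (S n)), (Hm (S n) (S (S n)));
    rewrite ?Ho, ?andb_false_r; try easy. ring.
Qed.

Lemma balanced_expressions m :
  null_off K m -> (forall j k, NET m j k = 0) ->
  (forall k j, (j < k)%nat -> m k j = off mu1 mu2 G1 (fun l => m l O) k j) /\
  (forall k j, (j < k)%nat -> m j k = off mu2 mu1 G2 (fun l => m O l) k j) /\
  (forall k, in_cap K (S k) = true ->
     m k k = dia lam mu1 mu2 G1 G2 (fun l => m l O) (fun l => m O l) k) /\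
  (forall n, K = Some n ->
     (mu1 + mu2) * m n n = 2 * lam * (m n (n - 1)%nat + m (n - 1)%nat n)).
Proof.
  intros Hz Hm.
  assert (H1 := balanced_off K lam mu1 mu2 p1 p2 G1 mu10 mu20 HG1 m Hm).
  assert (Hm' : forall j k, net K lam mu2 mu1 p2 p1 (fun j k => m k j) j k = 0).
  { intros j k. rewrite net_swap. apply Hm. }
  assert (H2 := balanced_off K lam mu2 mu1 p2 p1 G2 mu20 mu10 HG2 _ Hm').
  cbv beta in H2. repeat split; try easy.
  - intros k Hk. assert (B := box_flux K lam mu1 mu2 p1 p2 m k).
    rewrite csum_0 in B by (intros; apply csum_0; intros; apply Hm).
    rewrite <- RtoC_plus, join_rate_diag, Hk in B.
    rewrite (csum_ext _ (m (S k)) (off mu1 mu2 G1 (fun l => m l O) (S k))) in B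
      by (intros; apply H1; lia).
    rewrite (csum_ext _ (fun j => m j (S k)) (off mu2 mu1 G2 (fun l => m O l) (S k)))
      in B by (intros; apply H2; lia).
    rewrite <- (dia_off lam mu1 mu2 G1 G2) in B by easy.
    assert (L2 : 2 * lam <> 0).
    { rewrite <- RtoC_mult. apply RtoC_neq0. lra. }
    set (d := dia _ _ _ _ _ _ _ _) in *.
    replace (m k k) with (d - (2 * lam * d - 2 * lam * m k k) / (2 * lam)).
    + rewrite <- B. field. now apply RtoC_neq0.
    + field. now apply RtoC_neq0.
  - intros n EK. assert (E := net_corner m n EK Hz). rewrite Hm in E.
    symmetry. apply eq_plus_null with (1 := eq_sym E). ring.
Qed.

(** The corner value is a parameter here, unlike in [reconstruct], and otherwise the capacity acts
    only through sequences that vanish beyond it. *)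
Definition recon (a b : nat -> C) (c : C) (j k : nat) : C :=
  if (k <? j)%nat then off mu1 mu2 G1 a j k
  else if (j <? k)%nat then off mu2 mu1 G2 b k j
  else dia lam mu1 mu2 G1 G2 a b k + cap_delta K c k.

Lemma recon_below a b c k j :
  (j < k)%nat -> recon a b c k j = off mu1 mu2 G1 a k j.
Proof. intros H. unfold recon. now rewrite (proj2 (Nat.ltb_lt _ _) H). Qed.

Lemma recon_above a b c k j :
  (j < k)%nat -> recon a b c j k = off mu2 mu1 G2 b k j.
Proof.
  intros H. unfold recon. rewrite (proj2 (Nat.ltb_lt _ _) H).
  destruct (Nat.ltb_spec k j); [lia|easy].
Qed.

Lemma recon_diag a b c k :
  recon a b c k k = dia lam mu1 mu2 G1 G2 a b k + cap_delta K c k.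
Proof. unfold recon. now rewrite !Nat.ltb_irrefl. Qed.

Lemma recon_null a b c :
  null_seq K a -> null_seq K b -> null_off K (recon a b c).
Proof.
  clear NET K1. intros Ha Hb j k Hjk.
  assert (Hmax : in_cap K (Nat.max j k) = false).
  { destruct (in_cap K (Nat.max j k)) eqn:E; [|easy].
    rewrite (in_cap_le K j _ (Nat.le_max_l j k) E),
      (in_cap_le K k _ (Nat.le_max_r j k) E) in Hjk. easy. }
  destruct (Nat.lt_trichotomy j k) as [H|[<-|H]].
  - rewrite recon_above by easy. apply off_null with K; [easy|].
    now rewrite Nat.max_r in Hmax by lia.
  - rewrite Nat.max_id in Hmax. rewrite recon_diag, (dia_null K); try easy.
    + destruct K as [n|]; simpl; [|ring]. simpl in Hmax.
      apply Nat.leb_gt in Hmax. destruct (Nat.eqb_spec j n); [lia|ring].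
    + apply not_in_cap_le with j; [lia|easy].
  - rewrite recon_below by easy. apply off_null with K; [easy|].
    now rewrite Nat.max_l in Hmax by lia.
Qed.

Lemma join_rate_dia p a b c k :
  null_seq K a -> null_seq K b ->
  join_rate K lam p k k * (dia lam mu1 mu2 G1 G2 a b k + cap_delta K c k) =
  2 * lam * p * dia lam mu1 mu2 G1 G2 a b k.
Proof.
  intros Ha Hb. unfold join_rate. rewrite Nat.ltb_irrefl, Nat.eqb_refl. simpl andb.
  destruct (in_cap K (S k)) eqn:E.
  - rewrite cap_delta_0, !RtoC_mult by easy. ring.
  - rewrite (dia_null K) by easy. ring.
Qed.

Lemma balanced_diag_relations m (c : C) :
  null_off K m -> (forall j k, NET m j k = 0) ->
  (forall n, K = Some n -> c = m n n) ->
  diag_relations (fun l => m l O) (fun l => m O l) c.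
Proof.
  intros Hz Hm Hc.
  destruct (balanced_expressions m Hz Hm) as (H1 & H2 & H3 & _).
  set (a := fun l => m l O) in *. set (b := fun l => m O l) in *.
  assert (Ha : null_seq K a).
  { intros l Hl. apply Hz. now rewrite Hl. }
  assert (Hb : null_seq K b).
  { intros l Hl. apply Hz. now rewrite Hl, andb_false_r. }
  assert (Hd : forall k, m k k = dia lam mu1 mu2 G1 G2 a b k + cap_delta K c k).
  { intros k. destruct (in_cap K (S k)) eqn:E.
    - rewrite cap_delta_0, H3 by easy. ring.
    - rewrite (dia_null K) by easy.
      destruct (Nat.lt_trichotomy k (match K with Some n => n | None => k end))
        as [H|[H|H]]; destruct K as [n|] eqn:EK; simpl; try easy; try lia.
      + unfold in_cap in E. apply Nat.leb_gt in E. lia.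
      + subst k. rewrite Nat.eqb_refl, (Hc n) by easy. ring.
      + destruct (Nat.eqb_spec k n); [lia|]. rewrite Hz; [ring|].
        simpl. replace (k <=? n)%nat with false; [easy|].
        symmetry. now apply Nat.leb_gt. }
  assert (Hm' : forall j k, net K lam mu2 mu1 p2 p1 (fun j k => m k j) j k = 0).
  { intros j k. rewrite net_swap. apply Hm. }
  intros [|k]; unfold diag_relation.
  - rewrite <- Hd, (off_0 lam mu1 mu2 G1), (off_0 lam mu2 mu1 G2) by easy.
    unfold a, b. split; ring.
  - rewrite <- Hd. split.
    + assert (E := net_near K lam mu1 mu2 p1 p2 G1 mu10 mu20 HG1 m a H1 k).
      rewrite (Hm (S k) k : net _ _ _ _ _ _ _ _ _ = 0) in E.
      rewrite (Hd k), join_rate_dia in E by easy.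
      set (d := dia _ _ _ _ _ _ _ _) in *.
      symmetry. apply eq_plus_null with (1 := eq_sym E). ring.
    + assert (E := net_near K lam mu2 mu1 p2 p1 G2 mu20 mu10 HG2 _ b H2 k).
      cbv beta in E. rewrite (Hm' (S k) k) in E.
      rewrite (Hd k), join_rate_dia in E by easy.
      set (d := dia _ _ _ _ _ _ _ _) in *.
      symmetry. apply eq_plus_null with (1 := eq_sym E). ring.
Qed.

Lemma recon_balanced a b c :
  null_seq K a -> null_seq K b ->
  diag_relations a b c -> corner_relation a b c ->
  forall j k, NET (recon a b c) j k = 0.
Proof.
  intros Ha Hb HR HC.
  assert (N := recon_null a b c Ha Hb).
  assert (Hnear : forall k, NET (recon a b c) (S k) k = 0 /\
      NET (recon a b c) k (S k) = 0).
  { intros k. destruct (HR (S k)) as [R1 R2]. unfold diag_relation in R1, R2.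
    split.
    - unfold NET. rewrite (net_near K lam mu1 mu2 p1 p2 G1 mu10 mu20 HG1 _ a)
        by (intros; now apply recon_below).
      rewrite !recon_diag, join_rate_dia by easy.
      apply null_of_eq with (1 := R1). ring.
    - unfold NET. rewrite net_swap.
      rewrite (net_near K lam mu2 mu1 p2 p1 G2 mu20 mu10 HG2 _ b)
        by (intros; now apply recon_above).
      rewrite !recon_diag, join_rate_dia by easy.
      apply null_of_eq with (1 := R2). ring. }
  assert (Hoff : forall j k, j <> k -> NET (recon a b c) j k = 0).
  { intros j k Hjk. destruct (Nat.lt_trichotomy j k) as [H|[H|H]]; [|lia|].
    - destruct (Nat.eq_dec k (S j)) as [->|Hk]; [apply Hnear|].
      unfold NET. rewrite net_swap.
      apply (net_far K lam mu2 mu1 p2 p1 G2 mu20 mu10 HG2 _ b); [|lia].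
      intros; now apply recon_above.
    - destruct (Nat.eq_dec j (S k)) as [->|Hk]; [apply Hnear|].
      apply (net_far K lam mu1 mu2 p1 p2 G1 mu10 mu20 HG1 _ a); [|lia].
      intros; now apply recon_below. }
  (* No relation imposes balance on the diagonal. Since it holds elsewhere, the flux identity of a
     square reduces to the sum of its diagonal equations, and [dia] makes the flux zero; consecutive
     squares then isolate each diagonal equation. *)
  assert (Hbox : forall n, in_cap K (S n) = true ->
    csum (S n) (fun j => NET (recon a b c) j j) = 0).
  { intros n Hn.
    transitivity (csum (S n) (fun j => csum (S n) (NET (recon a b c) j))).
    { apply csum_ext. intros j Hj. symmetry. apply csum_single; [easy|].
      intros k _ Hk. now apply Hoff. }
    unfold NET. rewrite box_flux, <- RtoC_plus, join_rate_diag, Hn, recon_diag, cap_delta_0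
      by easy.
    rewrite (csum_ext _ (recon a b c (S n)) (off mu1 mu2 G1 a (S n)))
      by (intros; now apply recon_below).
    rewrite (csum_ext _ (fun j => recon a b c j (S n)) (off mu2 mu1 G2 b (S n)))
      by (intros; now apply recon_above).
    rewrite <- (dia_off lam mu1 mu2 G1 G2) by easy. ring. }
  intros j k. destruct (Nat.eq_dec j k) as [<-|Hjk]; [|now apply Hoff].
  destruct (in_cap K (S j)) eqn:E.
  - assert (B := Hbox j E). simpl in B. destruct j as [|j].
    + simpl in B. rewrite <- B. ring.
    + rewrite (Hbox j (in_cap_S _ _ E)) in B. rewrite <- B. ring.
  (* At the full corner there is no further column to carry a flux; balance there is
     [corner_relation]. *)
  - destruct (in_cap K j) eqn:E'.
    + assert (EK : K = Some j).
      { destruct K as [n|]; [|easy]. unfold in_cap in E, E'.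
        apply Nat.leb_gt in E. apply Nat.leb_le in E'. f_equal. lia. }
      rewrite net_corner, recon_diag by easy.
      assert (0 < j)%nat by (destruct j; [congruence|lia]).
      rewrite recon_below, recon_above by lia.
      rewrite <- (HC j EK), (dia_null K) by easy.
      rewrite EK. simpl. rewrite Nat.eqb_refl. ring.
    + apply net_null; [easy|]. now rewrite E'.
Qed.

End Reconstruction.

(** * Uniqueness and normalization *)

Section Uniqueness.

Variables (K : option nat) (lam mu1 mu2 p1 p2 : R).
Hypotheses (lam0 : (0 < lam)%R) (mu10 : (0 < mu1)%R) (mu20 : (0 < mu2)%R).
Hypotheses (p10 : (0 <= p1)%R) (p20 : (0 <= p2)%R).

Let NET := net K lam mu1 mu2 p1 p2.
Let RNET := rnet K lam mu1 mu2 p1 p2.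

Lemma join_rate_ge0 p j k : (0 <= p)%R -> (0 <= join_rate K lam p j k)%R.
Proof.
  intros Hp. unfold join_rate. destruct (j <? k)%nat; [lra|].
  destruct (_ && _); [|lra]. apply Rmult_le_pos; lra.
Qed.

Lemma rsum_minus n (f g : nat -> R) :
  (rsum n (fun k => f k - g k) = rsum n f - rsum n g)%R.
Proof. induction n as [|n IH]; simpl; [|rewrite IH]; ring. Qed.

Lemma rsum_rev n (f : nat -> R) :
  rsum (S n) f = rsum (S n) (fun j => f (n - j)%nat).
Proof.
  apply RtoC_inj. rewrite <- !csum_RtoC. apply (csum_rev n (fun k => RtoC (f k))).
Qed.

Lemma level_RtoC mu p (f : nat -> nat -> R) n :
  level K lam mu p (fun j k => RtoC (f j k)) n =
  RtoC (mu * adiag (fun j k => f (S j) k) n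
    - adiag (fun j k => join_rate K lam p j k * f j k)%R n).
Proof.
  unfold level, adiag. rewrite <- (rsum_scal (S n)), <- rsum_minus, <- csum_RtoC.
  apply csum_ext. intros j _. unfold flow.
  now rewrite RtoC_minus, !RtoC_mult.
Qed.

Lemma adiag_flip (f : nat -> nat -> R) n :
  adiag (fun j k => f k j) n = adiag f n.
Proof.
  unfold adiag. rewrite rsum_rev. apply rsum_ext. intros j Hj.
  now replace (n - (n - j))%nat with j by lia.
Qed.

Lemma adiag_rnet (f : nat -> nat -> R) n :
  rsum (S n) (adiag (RNET f)) =
  (mu1 * adiag (fun j k => f (S j) k) n + mu2 * adiag (fun j k => f j (S k)) n
   - adiag (fun j k => (join_rate K lam p1 j k + join_rate K lam p2 k j) * f j k) n)%R.
Proof.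
  apply RtoC_inj.
  transitivity (level K lam mu1 p1 (fun j k => RtoC (f j k)) n
    + level K lam mu2 p2 (fun j k => RtoC (f k j)) n).
  - rewrite <- (triangle_flux K lam mu1 mu2 p1 p2 (fun j k => RtoC (f j k)) n).
    rewrite <- csum_RtoC. apply csum_ext. intros i _. unfold adiag.
    rewrite <- csum_RtoC. apply csum_ext. intros j _. now rewrite net_RtoC.
  - rewrite level_RtoC, (level_RtoC mu2 p2 (fun j k => f k j)), <- RtoC_plus.
    f_equal.
    rewrite (adiag_flip (fun j k => f j (S k))).
    rewrite (adiag_flip (fun j k => join_rate K lam p2 k j * f j k)%R).
    unfold adiag. rewrite (rsum_ext (S n) (fun j => (_ + _) * f j (n - j)%nat)%R
      (fun j => join_rate K lam p1 j (n - j) * f j (n - j)%nat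
        + join_rate K lam p2 (n - j) j * f j (n - j)%nat)%R)
      by (intros; ring).
    rewrite rsum_plus. ring.
Qed.

(** Triangle inequality in the balance equation solved for its outflow term, all rates being
    nonnegative. *)
Lemma rnet_Cmod_ge0 (m : nat -> nat -> C) :
  (forall j k, NET m j k = 0) ->
  forall j k, (0 <= RNET (fun j k => Cmod (m j k)) j k)%R.
Proof.
  intros Hm j k. generalize (Hm j k). unfold NET. rewrite net_in_out. intros E.
  unfold RNET, rnet.
  assert (Ho : (0 <= outrate K lam mu1 mu2 p1 p2 j k)%R).
  { unfold outrate. assert (H1 := join_rate_ge0 p1 j k p10).
    assert (H2 := join_rate_ge0 p2 k j p20). destruct j, k; lra. }
  assert (Cs : forall (c : R) (z : C), (0 <= c)%R -> Cmod (c * z) = (c * Cmod z)%R).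
  { intros c z Hc. rewrite Cmod_mult, Cmod_R, Rabs_pos_eq by easy. easy. }
  assert (E1 : m j k * outrate K lam mu1 mu2 p1 p2 j k =
    mu1 * m (S j) k + mu2 * m j (S k)
    + match j with O => 0 | S i => join_rate K lam p1 i k * m i k end
    + match k with O => 0 | S i => join_rate K lam p2 i j * m j i end).
  { symmetry. apply eq_plus_null with (1 := E). ring. }
  assert (E2 : (Cmod (m j k) * outrate K lam mu1 mu2 p1 p2 j k <=
    mu1 * Cmod (m (S j) k) + mu2 * Cmod (m j (S k))
    + match j with O => 0 | S i => join_rate K lam p1 i k * Cmod (m i k) end
    + match k with O => 0 | S i => join_rate K lam p2 i j * Cmod (m j i) end)%R).
  { assert (T : forall x y z t,
      (Cmod (x + y + z + t) <= Cmod x + Cmod y + Cmod z + Cmod t)%R).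
    { intros x y z t. assert (T1 := Cmod_triangle (x + y + z) t).
      assert (T2 := Cmod_triangle (x + y) z). assert (T3 := Cmod_triangle x y). lra. }
    rewrite Rmult_comm, <- Cs, Cmult_comm, E1 by easy.
    eapply Rle_trans; [apply T|].
    apply Rplus_le_compat; [apply Rplus_le_compat; [apply Rplus_le_compat|]|].
    - rewrite Cs; lra.
    - rewrite Cs; lra.
    - destruct j; [rewrite Cmod_0; lra|].
      rewrite Cs; [lra|now apply join_rate_ge0].
    - destruct k; [rewrite Cmod_0; lra|].
      rewrite Cs; [lra|now apply join_rate_ge0]. }
  lra.
Qed.

Lemma adiag_shift_le (f : nat -> nat -> R) n :
  (forall j k, (0 <= f j k)%R) ->
  (adiag (fun j k => f (S j) k) n <= adiag f (S n))%R.
Proof.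
  intros Hf. unfold adiag.
  assert (E : forall m (g : nat -> R), rsum (S m) g = (g O + rsum m (fun k => g (S k)))%R).
  { clear. intros m g. induction m as [|m IH]; [simpl; ring|].
    change (rsum (S m) g + g (S m) = g O + rsum (S m) (fun k => g (S k)))%R.
    rewrite IH. simpl. ring. }
  rewrite (E (S n)). assert (H := Hf O (S n)). simpl (S n - 0)%nat.
  change (fun k => f (S k) (S n - S k)%nat) with (fun j => f (S j) (n - j)%nat). lra.
Qed.

(* |m| satisfies the balance equations up to a nonnegative defect, whose sum
   over a triangle is at most the flow through its hypotenuse. *)
Lemma rnet_Cmod_null (m : nat -> nat -> C) (M : R) :
  (forall j k, NET m j k = 0) ->
  (forall n, (rsum n (adiag (fun j k => Cmod (m j k))) <= M)%R) ->
  forall j k, RNET (fun j k => Cmod (m j k)) j k = 0%R.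
Proof.
  intros Hm HM. set (f := fun j k => Cmod (m j k)) in *.
  assert (Hf : forall j k, (0 <= f j k)%R) by (intros; apply Cmod_ge_0).
  assert (Hr := rnet_Cmod_ge0 m Hm). fold f in Hr.
  assert (L : is_lim_seq (adiag f) 0).
  { apply ex_series_lim_0.
    destruct (ex_finite_lim_seq_incr (fun n => rsum n (adiag f)) M) as [l Hl].
    - intros n. apply rsum_incr; [lia|]. intros; now apply adiag_ge0.
    - easy.
    - exists l. now apply is_series_rsum. }
  assert (B : forall i n, (i <= n)%nat ->
    (adiag (RNET f) i <= (mu1 + mu2) * adiag f (S n))%R).
  { intros i n Hi. apply Rle_trans with (rsum (S n) (adiag (RNET f))).
    - apply rsum_term_le; [|lia]. intros; now apply adiag_ge0.
    - rewrite adiag_rnet.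
      assert (H1 := adiag_shift_le f n Hf).
      assert (H2 := adiag_shift_le (fun j k => f k j) n (fun j k => Hf k j)).
      rewrite (adiag_flip f), (adiag_flip (fun j k => f j (S k))) in H2.
      assert (H3 : (0 <= adiag (fun j k =>
        (join_rate K lam p1 j k + join_rate K lam p2 k j) * f j k) n)%R).
      { apply adiag_ge0. intros j k.
        apply Rmult_le_pos; [|easy].
        apply Rplus_le_le_0_compat; now apply join_rate_ge0. }
      nra. }
  assert (Z : forall i, adiag (RNET f) i = 0%R).
  { intros i. apply Rle_antisym; [|now apply adiag_ge0].
    apply (is_lim_seq_le_loc (fun _ => adiag (RNET f) i)
      (fun n => (mu1 + mu2) * adiag f (S n))%R (adiag (RNET f) i) 0).
    - exists i. intros n Hn. now apply B.
    - apply is_lim_seq_const.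
    - replace (Finite 0) with (Finite ((mu1 + mu2) * 0)) by (f_equal; ring).
      apply is_lim_seq_mult'; [apply is_lim_seq_const|].
      now apply is_lim_seq_incr_1 in L. }
  intros j k. apply Rle_antisym; [|easy].
  rewrite <- (Z (j + k)%nat). unfold adiag.
  replace (RNET f j k) with (RNET f j (j + k - j)%nat) by (f_equal; lia).
  apply (rsum_term_le (S (j + k)) (fun i => RNET f i (j + k - i)%nat)); [|lia].
  intros i. apply Hr.
Qed.

(** At a null state the inflow is a null sum of nonnegative terms, two of which are services with
    positive rates. Besides the uniqueness, this yields [pi O O > 0]. *)
Lemma rnet_null_spread (f : nat -> nat -> R) :
  (forall j k, (0 <= f j k)%R) -> (forall j k, RNET f j k = 0%R) ->
  f O O = 0%R -> forall j k, f j k = 0%R.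
Proof.
  intros Hf Hr H0.
  assert (St : forall j k, f j k = 0%R -> f (S j) k = 0%R /\ f j (S k) = 0%R).
  { intros j k Hjk. generalize (Hr j k). unfold RNET, rnet. rewrite Hjk.
    assert (H1 : (0 <= match j with O => 0 | S i => join_rate K lam p1 i k * f i k end)%R).
    { destruct j; [lra|]. apply Rmult_le_pos; [now apply join_rate_ge0|easy]. }
    assert (H2 : (0 <= match k with O => 0 | S i => join_rate K lam p2 i j * f j i end)%R).
    { destruct k; [lra|]. apply Rmult_le_pos; [now apply join_rate_ge0|easy]. }
    assert (H3 := Hf (S j) k). assert (H4 := Hf j (S k)).
    assert (H5 := Rmult_le_pos _ _ (Rlt_le _ _ mu10) H3).
    assert (H6 := Rmult_le_pos _ _ (Rlt_le _ _ mu20) H4).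
    intros E. split.
    - apply Rmult_eq_reg_l with mu1; lra.
    - apply Rmult_eq_reg_l with mu2; lra. }
  assert (Hj : forall j, f j O = 0%R)
    by (induction j; [easy|now apply St]).
  intros j k. induction k as [|k IH]; [easy|now apply St].
Qed.

Lemma balanced_unique (m : nat -> nat -> C) (M : R) :
  (forall j k, NET m j k = 0) ->
  (forall n, (rsum n (adiag (fun j k => Cmod (m j k))) <= M)%R) ->
  m O O = 0 -> forall j k, m j k = 0.
Proof.
  intros Hm HM H0 j k. apply Cmod_eq_0. revert j k. apply rnet_null_spread.
  - intros; apply Cmod_ge_0.
  - now apply rnet_Cmod_null with M.
  - now rewrite H0, Cmod_0.
Qed.

Lemma net_lin (m m' : nat -> nat -> C) (c : C) j k :
  NET (fun j k => m j k - c * m' j k) j k = NET m j k - c * NET m' j k.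
Proof.
  unfold NET, net, dflow, flow. destruct j, k; ring.
Qed.

Lemma balanced_proportional (m : nat -> nat -> C) (pi : nat -> nat -> R) (M M' : R) :
  (forall j k, NET m j k = 0) ->
  (forall j k, NET (fun j k => RtoC (pi j k)) j k = 0) ->
  (forall j k, (0 <= pi j k)%R) -> pi O O <> 0%R ->
  (forall n, (rsum n (adiag (fun j k => Cmod (m j k))) <= M)%R) ->
  (forall n, (rsum n (adiag pi) <= M')%R) ->
  exists c, forall j k, m j k = c * pi j k.
Proof.
  intros Hm Hpi Hp Hp0 HM HM'. assert (N : RtoC (pi O O) <> 0).
  { intros E. apply RtoC_inj in E. easy. }
  exists (m O O / pi O O). set (c := m O O / pi O O).
  assert (U : forall j k, m j k - c * pi j k = 0).
  { apply (balanced_unique _ (M + Cmod c * M')%R).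
    - intros j k. rewrite net_lin, Hm, Hpi. ring.
    - intros n. apply Rle_trans with
        (rsum n (adiag (fun j k => Cmod (m j k))) + Cmod c * rsum n (adiag pi))%R.
      + rewrite <- rsum_scal, <- rsum_plus. apply rsum_le. intros i _.
        unfold adiag. rewrite <- (rsum_scal (S i)), <- rsum_plus. apply rsum_le.
        intros j _. eapply Rle_trans; [apply Cmod_triangle|].
        rewrite Cmod_opp, Cmod_mult, Cmod_R, (Rabs_pos_eq (pi _ _)) by easy. lra.
      + apply Rplus_le_compat; [easy|].
        apply Rmult_le_compat_l; [apply Cmod_ge_0|easy].
    - unfold c. field. easy. }
  intros j k. apply eq_plus_null with (1 := U j k). ring.
Qed.

End Uniqueness.

Lemma sum_from_RtoC K (f : nat -> R) (l : R) :
  is_series (fun k => if in_cap K k then f k else 0%R) l ->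
  sum_from K 0 (fun k => RtoC (f k)) = l.
Proof.
  intros H. apply is_cser_unique. apply is_cser_RtoC in H.
  apply is_cser_ext with (2 := H). intros n. simpl. now destruct in_cap.
Qed.

Section Invariant.

Variables (K : option nat) (lam mu1 mu2 p1 p2 : R) (pi : nat -> nat -> R).
Hypotheses (lam0 : (0 < lam)%R) (mu10 : (0 < mu1)%R) (mu20 : (0 < mu2)%R).
Hypotheses (p10 : (0 <= p1)%R) (p20 : (0 <= p2)%R) (psum : (p1 + p2 = 1)%R).
Hypothesis Hpi : is_invariant_distribution K lam mu1 mu2 p1 p2 pi.

Lemma invariant_is_sum2 : is_sum2 pi 1.
Proof.
  destruct Hpi as (_ & _ & Hs & H1 & _). rewrite <- H1.
  now apply summable2_is_sum2.
Qed.

Lemma invariant_origin_pos : (0 < pi O O)%R.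
Proof.
  destruct Hpi as (Hp & _ & _ & H1 & _).
  destruct (Hp O O) as [H|H]; [easy|exfalso].
  assert (Z : forall j k, pi j k = 0%R).
  { apply (rnet_null_spread K lam mu1 mu2 p1 p2); try easy.
    intros j k. apply RtoC_inj. rewrite <- net_RtoC.
    now apply invariant_net. }
  apply R1_neq_R0. rewrite <- H1. apply is_sum2_unique.
  apply is_sum2_ext with (fun _ _ => 0%R); [easy|apply is_sum2_zero].
Qed.

(* The total rates of the services and of the accepted arrivals agree. *)
Lemma invariant_normalized :
  normalized K lam mu1 mu2 (fun k => RtoC (pi k 0%nat)) (fun k => RtoC (pi 0%nat k))
    (match K with Some n => RtoC (pi n n) | None => RtoC 0 end) /\
  mu2 * gen K (fun k => RtoC (pi k 0%nat)) 1 + mu1 * gen K (fun k => RtoC (pi 0%nat k)) 1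
    <> 0.
Proof.
  assert (Hp0 := invariant_origin_pos).
  destruct invariant_is_sum2 as [r [Hr H1]].
  pose proof Hpi as (Hp & Hz & _ & _ & _).
  assert (Hr0 : forall j, (0 <= r j)%R).
  { intros j. apply (is_series_rsum_le (pi j) (r j) 0); [easy|apply Hr]. }
  assert (HA : ex_series (fun j => pi j O)).
  { apply (@ex_series_le R_AbsRing R_CompleteNormedModule) with r; [|now exists 1%R].
    intros j. unfold norm. simpl. unfold abs. simpl. rewrite Rabs_pos_eq by easy.
    generalize (is_series_rsum_le (pi j) (r j) 1 (Hp j) (Hr j)). simpl. lra. }
  destruct HA as [A HA]. set (B := r O).
  set (c := match K with Some n => pi n n | None => 0%R end).
  assert (S1 : is_sum2 (fun j k => pi (S j) k) (1 - B)%R).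
  { exists (fun j => r (S j)). split; [intros; apply Hr|].
    apply (is_series_incr_1 r). change (is_series r (1 - B + B)%R).
    now replace (1 - B + B)%R with 1%R by ring. }
  assert (S2 : is_sum2 (fun j k => pi j (S k)) (1 - A)%R).
  { exists (fun j => r j - pi j O)%R. split.
    - intros j. apply (is_series_incr_1 (pi j)).
      change (is_series (pi j) (r j - pi j O + pi j O)%R).
      replace (r j - pi j O + pi j O)%R with (r j) by ring. apply Hr.
    - now apply (is_series_minus r (fun j => pi j O)). }
  (* The total arrival rate is [2 * lam] at every state but the full corner; a point mass there
     corrects the constant. *)
  assert (S3 : is_sum2 (fun j k => (join_rate K lam p1 j k + join_rate K lam p2 k j)
      * pi j k)%R (2 * lam * 1 + - (2 * lam * c))%R).
  { apply is_sum2_ext with (fun j k => 2 * lam * pi j k +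
      match K with Some n => point n n (- (2 * lam * pi n n)) j k | None => 0 end)%R.
    - intros j k. unfold join_rate.
      destruct (Nat.ltb_spec j k), (Nat.ltb_spec k j), (Nat.eqb_spec j k),
        (Nat.eqb_spec k j); try lia; simpl andb.
      + destruct K as [N|]; [|ring]. unfold point.
        destruct (Nat.eqb_spec j N), (Nat.eqb_spec k N); try lia; simpl; ring.
      + destruct K as [N|]; [|ring]. unfold point.
        destruct (Nat.eqb_spec j N), (Nat.eqb_spec k N); try lia; simpl; ring.
      + subst k. assert (E : (2 * lam * p1 + 2 * lam * p2 = 2 * lam)%R).
        { transitivity (2 * lam * (p1 + p2))%R; [ring|]. rewrite psum. ring. }
        unfold in_cap. destruct K as [N|]; [|rewrite E; ring].
        unfold point.
        destruct (Nat.leb_spec (S j) N), (Nat.eqb_spec j N) as [->|];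
          simpl andb; cbv iota; try lia.
        * rewrite E. ring.
        * ring.
        * rewrite Hz; [ring|]. unfold in_cap.
          destruct (Nat.leb_spec j N); [lia|easy].
    - apply is_sum2_plus; [apply is_sum2_scal; now exists r|].
      unfold c. destruct K; [apply is_sum2_point|].
      rewrite Rmult_0_r, Ropp_0. apply is_sum2_zero. }
  (* By invariance, services and accepted arrivals balance across each antidiagonal; summing over
     all antidiagonals gives the total rates. *)
  assert (F : (mu1 * (1 - B) + mu2 * (1 - A) = 2 * lam * 1 + - (2 * lam * c))%R).
  { apply is_series_adiag in S1, S2, S3; try easy.
    2:{ intros j k. apply Rmult_le_pos; [|easy].
        apply Rplus_le_le_0_compat; now apply join_rate_ge0. }
    rewrite <- (is_series_unique _ _ S3). symmetry. apply is_series_unique.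
    apply is_series_ext with (fun n => mu1 * adiag (fun j k => pi (S j) k) n
      + mu2 * adiag (fun j k => pi j (S k)) n)%R.
    - intros n.
      assert (E := adiag_rnet K lam mu1 mu2 p1 p2 pi n).
      (* Zero is written [0 * 0] so that [rsum_scal] extracts a null factor from the sum. *)
      rewrite (rsum_ext (S n) _ (fun _ => 0 * 0)%R), rsum_scal in E.
      + lra.
      + intros i _. unfold adiag.
        rewrite (rsum_ext _ _ (fun _ => 0 * 0)%R), rsum_scal; [ring|].
        intros j _. rewrite Rmult_0_r. apply RtoC_inj. rewrite <- net_RtoC.
        now apply invariant_net.
    - apply (is_series_plus (fun n => mu1 * adiag (fun j k => pi (S j) k) n)%R
        (fun n => mu2 * adiag (fun j k => pi j (S k)) n)%R).
      + now apply (is_series_scal mu1 (adiag (fun j k => pi (S j) k))).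
      + now apply (is_series_scal mu2 (adiag (fun j k => pi j (S k)))). }
  assert (GA : gen K (fun k => RtoC (pi k O)) 1 = A).
  { transitivity (sum_from K 0 (fun k => RtoC (pi k O))).
    - unfold gen. f_equal. apply functional_extensionality. intros k.
      rewrite Cpow_1_l. ring.
    - apply sum_from_RtoC. apply is_series_ext with (2 := HA). intros k.
      destruct (in_cap K k) eqn:E; [easy|]. apply Hz. now rewrite E. }
  assert (GB : gen K (fun k => RtoC (pi O k)) 1 = B).
  { transitivity (sum_from K 0 (fun k => RtoC (pi O k))).
    - unfold gen. f_equal. apply functional_extensionality. intros k.
      rewrite Cpow_1_l. ring.
    - apply sum_from_RtoC. apply is_series_ext with (2 := Hr O). intros k.
      destruct (in_cap K k) eqn:E; [easy|]. apply Hz. now rewrite E, andb_false_r. }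
  assert (Ec : match K with Some n => RtoC (pi n n) | None => RtoC 0 end = c)
    by (unfold c; now destruct K).
  unfold normalized. rewrite GA, GB, Ec.
  rewrite <- !RtoC_mult, <- !RtoC_plus. split.
  - rewrite <- RtoC_minus, <- RtoC_mult, <- RtoC_minus. f_equal. lra.
  (* The quantity is at least [mu2 * pi O O]. Its being nonzero lets the normalization fix the
     multiplicative constant. *)
  - apply RtoC_neq0.
    assert (HAp : (pi O O <= A)%R).
    { generalize (is_series_rsum_le (fun j => pi j O) A 1 (fun j => Hp j O) HA).
      simpl. lra. }
    assert (HBp := Hr0 O). fold B in HBp.
    apply Rplus_lt_le_0_compat; [apply Rmult_lt_0_compat|apply Rmult_le_pos]; lra.
Qed.

End Invariant.

(** * The functional equations as identities between power series *)

Lemma is_cser_shift (u : nat -> C) l :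
  is_cser u l -> is_cser (fun k => u (S k)) (l - u O).
Proof.
  intros H. apply is_lim_seq_incr_1 in H.
  apply is_lim_seq_ext with (2 := H). intros n. rewrite csum_S_l. f_equal. ring.
Qed.

Lemma is_cser_unshift (u : nat -> C) l :
  is_cser u l -> is_cser (fun k => match k with O => 0 | S i => u i end) l.
Proof.
  intros H. apply is_lim_seq_incr_1.
  apply is_lim_seq_ext with (2 := H). intros n. rewrite csum_S_l.
  change (Cmod (csum n u - l) = Cmod (0 + csum n u - l)). f_equal. ring.
Qed.

Definition cgen (a : nat -> C) (y : C) : C := cseries (fun l => a l * y ^ l).

Lemma gen_mask K a : gen K a = cgen (mask K a).
Proof.
  apply functional_extensionality. intros y. unfold gen, cgen, sum_from.
  change (cseries (fun n => if in_cap K (0 + n)%nat then a (0 + n)%nat * y ^ (0 + n) else RtoC 0)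
    = cseries (fun l => mask K a l * y ^ l)).
  f_equal. apply functional_extensionality. intros n. unfold mask. simpl.
  destruct in_cap; ring.
Qed.

Section CGen.

Variables (a : nat -> C) (M : R).
Hypothesis HM : forall l, (Cmod (a l) <= M)%R.

Lemma cgen_term_le y l :
  (Cmod y <= 1 / 2)%R -> (Cmod (a l * y ^ l) <= M * (1 / 2) ^ l)%R.
Proof.
  intros Hy. rewrite Cmod_mult, Cmod_pow.
  apply Rmult_le_compat; try apply Cmod_ge_0; try easy.
  - apply pow_le, Cmod_ge_0.
  - apply pow_incr. split; [apply Cmod_ge_0|easy].
Qed.

Lemma is_cser_cgen y :
  (Cmod y <= 1 / 2)%R -> is_cser (fun l => a l * y ^ l) (cgen a y).
Proof.
  intros Hy. apply is_cser_geom with M. intros n. now apply cgen_term_le.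
Qed.

Lemma cgen_le y : (Cmod y <= 1 / 2)%R -> (Cmod (cgen a y) <= 2 * M)%R.
Proof.
  intros Hy. apply Cmod_is_cser_le with (1 := is_cser_cgen y Hy). intros n.
  eapply Rle_trans; [apply Cmod_csum_le|].
  apply Rle_trans with (rsum n (fun l => M * (1 / 2) ^ l)%R).
  - apply rsum_le. intros. now apply cgen_term_le.
  - rewrite rsum_scal. rewrite Rmult_comm. apply Rmult_le_compat_r.
    + eapply Rle_trans; [|apply (HM O)]. apply Cmod_ge_0.
    + apply rsum_half.
Qed.

Lemma cgen_0 : cgen a 0 = a O.
Proof.
  apply is_cser_unique.
  replace (a O) with (csum 1 (fun l => a l * 0 ^ l)) by (simpl; ring).
  apply is_cser_finite. intros [|n] Hn; [lia|]. simpl. ring.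
Qed.

End CGen.

Lemma cgen_S (a : nat -> C) M y :
  (forall l, (Cmod (a l) <= M)%R) -> (Cmod y <= 1 / 2)%R ->
  cgen a y = a O + y * cgen (fun l => a (S l)) y.
Proof.
  intros HM Hy.
  assert (H := is_cser_shift _ _ (is_cser_cgen a M HM y Hy)).
  assert (H' := is_cser_scal y _ _
    (is_cser_cgen (fun l => a (S l)) M (fun l => HM (S l)) y Hy)).
  assert (E : cgen a y - a O * y ^ 0 = y * cgen (fun l => a (S l)) y).
  { apply is_cser_inj with (1 := H). apply is_cser_ext with (2 := H').
    intros n. simpl. ring. }
  rewrite <- E. simpl. ring.
Qed.

(** [C_derive] is a limit along the horizontal line through the point, so real increments decide its
    value at 0. *)
Lemma C_derive_0 (F : C -> C) (l : C) (B : R) :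
  (forall t : R, t <> 0%R -> (Rabs t <= 1 / 2)%R ->
     (Cmod ((F t - F 0) / t - l) <= B * Rabs t)%R) ->
  C_derive F 0 = l.
Proof.
  intros H.
  assert (L : forall h : R -> R, forall v : R,
    (forall t : R, t <> 0%R -> (Rabs t <= 1 / 2)%R -> (Rabs (h t - v) <= B * Rabs t)%R) ->
    real (Lim h 0) = v).
  { intros h v Hh. enough (E : Lim h 0 = v) by now rewrite E.
    apply is_lim_unique, is_lim_spec. intros eps.
    assert (Hd : (0 < Rmin (1 / 2) (eps / (Rabs B + 1)))%R).
    { apply Rmin_glb_lt; [lra|]. apply Rdiv_lt_0_compat; [apply cond_pos|].
      generalize (Rabs_pos B). lra. }
    exists (mkposreal _ Hd). intros t Ht Hne.
    change (Rabs (t - 0) < Rmin (1 / 2) (eps / (Rabs B + 1)))%R in Ht.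
    rewrite Rminus_0_r in Ht.
    assert (H1 : (Rabs t < 1 / 2)%R) by (eapply Rlt_le_trans; [exact Ht|apply Rmin_l]).
    assert (H2 : (Rabs t < eps / (Rabs B + 1))%R)
      by (eapply Rlt_le_trans; [exact Ht|apply Rmin_r]).
    assert (HB := Rabs_pos B).
    apply Rle_lt_trans with ((Rabs B + 1) * Rabs t)%R.
    - eapply Rle_trans; [apply Hh; [easy|lra]|].
      apply Rmult_le_compat_r; [apply Rabs_pos|]. generalize (Rle_abs B). lra.
    - apply Rmult_lt_compat_l with (r := (Rabs B + 1)%R) in H2; [|lra].
      replace ((Rabs B + 1) * (eps / (Rabs B + 1)))%R with (pos eps) in H2
        by (field; lra). easy. }
  assert (E : forall t : R, (F (t, 0%R) - F 0) / ((t, 0%R) - 0) = (F t - F 0) / t).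
  { intros t. change (t, 0%R) with (RtoC t). f_equal. ring. }
  apply injective_projections.
  - apply (L (fun t => fst ((F (t, 0%R) - F 0) / ((t, 0%R) - 0)))).
    intros t Ht Ht'. rewrite E. eapply Rle_trans; [|apply H; eassumption].
    eapply Rle_trans; [|apply Rmax_Cmod]. apply Rmax_l.
  - apply (L (fun t => snd ((F (t, 0%R) - F 0) / ((t, 0%R) - 0)))).
    intros t Ht Ht'. rewrite E. eapply Rle_trans; [|apply H; eassumption].
    eapply Rle_trans; [|apply Rmax_Cmod]. apply Rmax_r.
Qed.

(** * Expansion of the divided differences in powers of x *)

Section Coefficients.

Variables (lam mu1 mu2 : R) (G : nat -> nat -> C).
Hypotheses (lam0 : (0 < lam)%R) (mu10 : (0 < mu1)%R) (mu20 : (0 < mu2)%R).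
Hypothesis HG : is_gpow lam mu1 mu2 G.

Let mu1n := RtoC_neq0 mu1 mu10.
Let mu2n := RtoC_neq0 mu2 mu20.
Let Gz := gpow_zero lam mu1 mu2 G mu20 HG.

(* The coefficients of x^k in the polynomials (y^l - z^l) / (y - z) and
   (y^(l+1) - z^(l+1)) / (y - z) - x (y^l - z^l) / (y - z), where y and z are
   the roots of p_{x,1}. *)
Definition ucoef (l k : nat) : C := - (mu2 / mu1) * G (l - k) (S k).
Definition vcoef (l k : nat) : C :=
  mu2 / mu1 * (G (S l - k)%nat k - G (S l - k)%nat (S k)).

Definition upoly (l : nat) (x : C) : C := csum (S l) (fun k => ucoef l k * x ^ k).

Lemma ucoef_high l k : (l <= k)%nat -> ucoef l k = 0.
Proof.
  intros H. unfold ucoef. replace (l - k)%nat with O by lia.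
  pose proof HG as (_ & G0S & _). rewrite G0S. ring.
Qed.

Lemma ucoef_low l k : (2 * k + 2 <= l)%nat -> ucoef l k = 0.
Proof. intros H. unfold ucoef. rewrite Gz by lia. ring. Qed.

Lemma ucoef_1 : ucoef 1 0 = 1.
Proof.
  unfold ucoef. simpl. pose proof HG as (G00 & _ & _ & G1 & _).
  transitivity (- (1 / mu1) * (mu2 * G 1%nat 1%nat)); [field; easy|].
  rewrite G1, G00. field. easy.
Qed.

(** The coefficient of x^(k+1) in the recurrence that the root equation imposes on
    [(y^l - z^l) / (y - z)]. The power of g drops exactly in the term with [mu1], as in
    [is_gpow]. *)
Lemma ucoef_rec l k :
  mu2 * ucoef (S (S l)) (S k) =
  (2 * lam + mu1 + mu2) * ucoef (S l) k - mu1 * ucoef l k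
  - 2 * lam * match k with O => 0 | S i => ucoef l i end.
Proof.
  pose proof HG as (G00 & G0S & G0 & G1 & GS). unfold ucoef.
  destruct k as [|k].
  - replace (S (S l) - 1)%nat with (S l) by lia.
    replace (S l - 0)%nat with (S l) by lia. rewrite Nat.sub_0_r.
    transitivity (- (mu2 / mu1) * (mu2 * G (S l) 2%nat)); [ring|].
    rewrite GS, G0. ring.
  - replace (S (S l) - S (S k))%nat with (l - k)%nat by lia.
    replace (S l - S k)%nat with (l - k)%nat by lia.
    transitivity (- (mu2 / mu1) * (mu2 * G (l - k)%nat (S (S (S k))))); [ring|].
    (* When the subtraction truncates, all terms are values of [G O] at positive indices, hence
       null. *)
    destruct (l - k)%nat as [|m] eqn:E.
    + replace (l - S k)%nat with O by lia. rewrite !G0S. ring.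
    + replace (l - S k)%nat with m by lia. rewrite GS. ring.
Qed.

Lemma vcoef_ucoef l k :
  vcoef l k = ucoef (S l) k - match k with O => 0 | S i => ucoef l i end.
Proof.
  pose proof HG as (_ & _ & G0 & _). unfold vcoef, ucoef. destruct k as [|k].
  - rewrite Nat.sub_0_r, G0. ring.
  - replace (S l - S k)%nat with (l - k)%nat by lia. ring.
Qed.

Lemma vcoef_high l k : (l < k)%nat -> vcoef l k = 0.
Proof.
  intros H. rewrite vcoef_ucoef, ucoef_high by lia. destruct k; [ring|].
  rewrite ucoef_high by lia. ring.
Qed.

Lemma vcoef_low l k : (2 * k + 2 <= l)%nat -> vcoef l k = 0.
Proof.
  intros H. rewrite vcoef_ucoef, ucoef_low by lia. destruct k; [ring|].
  rewrite ucoef_low by lia. ring.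
Qed.

Lemma upoly_trunc l n x :
  (S l <= n)%nat -> csum n (fun k => ucoef l k * x ^ k) = upoly l x.
Proof.
  intros H. apply csum_trunc; [easy|]. intros k Hk.
  rewrite ucoef_high by lia. ring.
Qed.

Lemma csum_ucoef_pred l n x :
  (S l <= n)%nat ->
  csum (S n) (fun k => match k with O => 0 | S i => ucoef l i end * x ^ k)
  = x * upoly l x.
Proof.
  intros H. rewrite csum_S_l, <- (upoly_trunc l n) by easy. rewrite <- csum_scal.
  rewrite (csum_ext n _ (fun k => x * (ucoef l k * x ^ k)));
    [ring|]. intros k _. simpl. ring.
Qed.

Lemma upoly_rec l x :
  mu2 * upoly (S (S l)) x =
  (2 * lam + mu1 + mu2) * x * upoly (S l) x - (mu1 + 2 * lam * x) * x * upoly l x.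
Proof.
  unfold upoly at 1. rewrite csum_S_l, ucoef_low by lia.
  transitivity (x * (mu2 * csum (S (S l)) (fun k => ucoef (S (S l)) (S k) * x ^ k))).
  { rewrite (csum_ext _ (fun k => ucoef (S (S l)) (S k) * x ^ S k)
      (fun k => x * (ucoef (S (S l)) (S k) * x ^ k))) by (intros; simpl; ring).
    rewrite csum_scal. ring. }
  rewrite <- csum_scal.
  rewrite (csum_ext _ _ (fun k =>
    (2 * lam + mu1 + mu2) * (ucoef (S l) k * x ^ k) - mu1 * (ucoef l k * x ^ k)
    - 2 * lam * (match k with O => 0 | S i => ucoef l i end * x ^ k))).
  2:{ intros k _. rewrite Cmult_assoc, ucoef_rec. ring. }
  rewrite !csum_minus, !csum_scal, csum_ucoef_pred, !upoly_trunc by lia. ring.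
Qed.

Lemma upoly_0 x : upoly 0 x = 0.
Proof. unfold upoly. simpl. rewrite ucoef_high by lia. ring. Qed.

Lemma upoly_1 x : upoly 1 x = 1.
Proof.
  unfold upoly. simpl. rewrite ucoef_1, (ucoef_high 1 1) by lia. ring.
Qed.

Lemma vpoly l x :
  csum (S l) (fun k => vcoef l k * x ^ k) = upoly (S l) x - x * upoly l x.
Proof.
  rewrite <- (csum_trunc (S l) (S (S l))); [|lia|].
  - rewrite (csum_ext _ _ (fun k => ucoef (S l) k * x ^ k
      - match k with O => 0 | S i => ucoef l i end * x ^ k)).
    + rewrite csum_minus, csum_ucoef_pred, upoly_trunc by lia. easy.
    + intros k _. rewrite vcoef_ucoef. ring.
  - intros k Hk. rewrite vcoef_high by lia. ring.
Qed.

(* The second term bounds the coefficients through their recurrence and keeps the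
   roots in the disk of radius 1 / 2; the third one excludes a double root for
   0 < |x| <= 1 / (2 coef_base). *)
Definition coef_base : R :=
  (1 + (2 * (2 * lam + mu1 + mu2) + 4 * mu1 + 8 * lam) / mu2
   + (2 * lam + mu1 + mu2) * (2 * lam + mu1 + mu2) / (mu1 * mu2))%R.

Lemma coef_base_spec :
  (1 <= coef_base)%R /\
  (2 * (2 * lam + mu1 + mu2) + 4 * mu1 + 8 * lam <= mu2 * coef_base)%R /\
  ((2 * lam + mu1 + mu2) * (2 * lam + mu1 + mu2) <= mu1 * mu2 * coef_base)%R.
Proof.
  assert (H12 : (0 < mu1 * mu2)%R) by now apply Rmult_lt_0_compat.
  set (A := ((2 * (2 * lam + mu1 + mu2) + 4 * mu1 + 8 * lam) / mu2)%R).
  set (B := ((2 * lam + mu1 + mu2) * (2 * lam + mu1 + mu2) / (mu1 * mu2))%R).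
  assert (HA : (0 < A)%R) by (apply Rdiv_lt_0_compat; lra).
  assert (HB : (0 < B)%R)
    by (apply Rdiv_lt_0_compat; [apply Rmult_lt_0_compat; lra|easy]).
  assert (EA : (2 * (2 * lam + mu1 + mu2) + 4 * mu1 + 8 * lam = mu2 * A)%R)
    by (unfold A; field; lra).
  assert (EB : ((2 * lam + mu1 + mu2) * (2 * lam + mu1 + mu2) = mu1 * mu2 * B)%R)
    by (unfold B; field; lra).
  rewrite EA, EB. change coef_base with (1 + A + B)%R. split; [lra|].
  split; apply Rmult_le_compat_l; lra.
Qed.

(** The decay in l allows bounded sequences [a] and the exchange of sums; the growth in k is
    absorbed by small x. In the induction along [ucoef_rec], the gained factor [coef_base] pays for
    the coefficients and for the two lost factors [1 / 2]. *)
Lemma ucoef_le l k : (Cmod (ucoef l k) <= 2 * ((1 / 2) ^ l * coef_base ^ k))%R.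
Proof.
  destruct coef_base_spec as (R1 & R2 & _).
  assert (Hpos : forall l k, (0 <= 2 * ((1 / 2) ^ l * coef_base ^ k))%R).
  { intros i j. repeat apply Rmult_le_pos; try apply pow_le; lra. }
  enough (H : forall l, (forall k, Cmod (ucoef l k) <= 2 * ((1 / 2) ^ l * coef_base ^ k))%R /\
    (forall k, Cmod (ucoef (S l) k) <= 2 * ((1 / 2) ^ S l * coef_base ^ k))%R) by apply H.
  clear l k. induction l as [|l [IH1 IH2]].
  - split; intros k.
    + rewrite ucoef_high, Cmod_0 by lia. apply Hpos.
    + destruct k as [|k]; [rewrite ucoef_1, Cmod_1; simpl; lra|].
      rewrite ucoef_high, Cmod_0 by lia. apply Hpos.
  - split; [easy|]. intros [|k].
    { rewrite ucoef_low, Cmod_0 by lia. apply Hpos. }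
    set (X := ((1 / 2) ^ l * coef_base ^ k)%R).
    assert (HX : (0 <= X)%R) by (apply Rmult_le_pos; apply pow_le; lra).
    assert (B1 : (Cmod (ucoef (S l) k) <= X)%R).
    { eapply Rle_trans; [apply IH2|]. right. unfold X. simpl. field. }
    assert (B2 : (Cmod (ucoef l k) <= 2 * X)%R) by apply IH1.
    assert (B3 : (Cmod (match k with O => 0 | S i => ucoef l i end) <= 2 * X)%R).
    { destruct k as [|k]; [rewrite Cmod_0; lra|].
      eapply Rle_trans; [apply IH1|]. unfold X. simpl.
      apply Rmult_le_compat_l; [lra|]. apply Rmult_le_compat_l; [apply pow_le; lra|].
      rewrite <- (Rmult_1_l (coef_base ^ k)) at 1.
      apply Rmult_le_compat_r; [apply pow_le; lra|easy]. }
    assert (E : (mu2 * Cmod (ucoef (S (S l)) (S k)) <=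
      (2 * lam + mu1 + mu2) * X + mu1 * (2 * X) + 2 * lam * (2 * X))%R).
    { assert (C1 : forall (c : R) (z : C), (0 <= c)%R -> Cmod (c * z) = (c * Cmod z)%R).
      { intros c z Hc. rewrite Cmod_mult, Cmod_R, Rabs_pos_eq by easy. easy. }
      rewrite <- C1, ucoef_rec by lra.
      eapply Rle_trans; [apply Cmod_triangle|]. rewrite Cmod_opp.
      apply Rplus_le_compat; [eapply Rle_trans; [apply Cmod_triangle|];
        rewrite Cmod_opp; apply Rplus_le_compat|].
      - rewrite <- RtoC_mult, <- !RtoC_plus, C1 by lra.
        apply Rmult_le_compat_l; lra.
      - rewrite C1 by lra. apply Rmult_le_compat_l; lra.
      - rewrite <- RtoC_mult, C1 by lra. apply Rmult_le_compat_l; lra. }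
    apply Rmult_le_reg_l with mu2; [easy|]. eapply Rle_trans; [apply E|].
    replace (mu2 * (2 * ((1 / 2) ^ S (S l) * coef_base ^ S k)))%R
      with ((mu2 * coef_base) * (X / 2))%R by (unfold X; simpl; field).
    apply Rle_trans with
      ((2 * (2 * lam + mu1 + mu2) + 4 * mu1 + 8 * lam) * (X / 2))%R.
    + right. field.
    + apply Rmult_le_compat_r; [lra|easy].
Qed.

Lemma vcoef_le l k : (Cmod (vcoef l k) <= 3 * ((1 / 2) ^ l * coef_base ^ k))%R.
Proof.
  destruct coef_base_spec as (R1 & _).
  rewrite vcoef_ucoef. eapply Rle_trans; [apply Cmod_triangle|].
  rewrite Cmod_opp.
  set (X := ((1 / 2) ^ l * coef_base ^ k)%R).
  assert (HX : (0 <= X)%R) by (apply Rmult_le_pos; apply pow_le; lra).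
  assert (B1 : (Cmod (ucoef (S l) k) <= X)%R).
  { eapply Rle_trans; [apply ucoef_le|]. right. unfold X. simpl. field. }
  assert (B2 : (Cmod (match k with O => 0 | S i => ucoef l i end) <= 2 * X)%R).
  { destruct k as [|k]; [rewrite Cmod_0; lra|].
    eapply Rle_trans; [apply ucoef_le|]. unfold X. simpl.
    apply Rmult_le_compat_l; [lra|]. apply Rmult_le_compat_l; [apply pow_le; lra|].
    rewrite <- (Rmult_1_l (coef_base ^ k)) at 1.
    apply Rmult_le_compat_r; [apply pow_le; lra|easy]. }
  lra.
Qed.

Section SmallX.

Variables (x y z : C).
Hypothesis Hx : (coef_base * Cmod x <= 1 / 2)%R.
Hypothesis Hr : roots2 mu2 (- ((2 * lam + mu1 + mu2) * x))
  ((mu1 + 2 * lam * x) * x) y z.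

(** If [|w| > 1 / 2], dividing the equation by [|w|] at most doubles its constant term, and the
    choice of [coef_base] then forces [|w| <= 1 / 4]. Inside this disk the generating series of a
    bounded sequence converges geometrically. *)
Lemma root_small w :
  mu2 * (w * w) = (2 * lam + mu1 + mu2) * x * w - (mu1 + 2 * lam * x) * x ->
  (Cmod w <= 1 / 2)%R.
Proof.
  intros E. destruct (Rle_lt_dec (Cmod w) (1 / 2)) as [H|H]; [easy|exfalso].
  destruct coef_base_spec as (R1 & R2 & _). assert (Hx0 := Cmod_ge_0 x).
  set (X := Cmod x) in *. set (W := Cmod w) in *.
  assert (B : (mu2 * (W * W) <= (2 * lam + mu1 + mu2) * X * W
    + (mu1 + 2 * lam * X) * X)%R).
  { replace (mu2 * (W * W))%R with (Cmod (mu2 * (w * w))).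
    2:{ rewrite !Cmod_mult, Cmod_R, Rabs_pos_eq; [easy|lra]. }
    rewrite E. eapply Rle_trans; [apply Cmod_triangle|]. rewrite Cmod_opp.
    apply Rplus_le_compat.
    - rewrite !Cmod_mult, <- RtoC_mult, <- !RtoC_plus, Cmod_R, Rabs_pos_eq by lra.
      right. easy.
    - rewrite Cmod_mult. apply Rmult_le_compat_r; [easy|].
      eapply Rle_trans; [apply Cmod_triangle|].
      rewrite <- RtoC_mult, Cmod_mult, !Cmod_R, !Rabs_pos_eq by lra. right. easy. }
  assert (X1 : (X <= 1)%R) by nra.
  assert (B2 : (mu2 * W <= (2 * lam + mu1 + mu2) * X + 2 * (mu1 + 2 * lam) * X)%R).
  { apply Rmult_le_reg_r with W; [lra|].
    assert (T1 : ((mu1 + 2 * lam * X) * X <= (mu1 + 2 * lam) * X)%R).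
    { apply Rmult_le_compat_r; [easy|]. nra. }
    assert (T2 : ((mu1 + 2 * lam) * X <= (mu1 + 2 * lam) * X * (2 * W))%R).
    { assert (0 <= (mu1 + 2 * lam) * X)%R by (apply Rmult_le_pos; lra).
      rewrite <- (Rmult_1_r ((mu1 + 2 * lam) * X)) at 1.
      apply Rmult_le_compat_l; lra. }
    lra. }
  assert (B3 : ((2 * (2 * lam + mu1 + mu2) + 4 * mu1 + 8 * lam) * X
     <= mu2 * (1 / 2))%R).
  { apply Rle_trans with (mu2 * coef_base * X)%R; [apply Rmult_le_compat_r; easy|].
    rewrite Rmult_assoc. apply Rmult_le_compat_l; lra. }
  nra.
Qed.

Lemma roots_eqs :
  (mu2 * (y * y) = (2 * lam + mu1 + mu2) * x * y - (mu1 + 2 * lam * x) * x) /\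
  (mu2 * (z * z) = (2 * lam + mu1 + mu2) * x * z - (mu1 + 2 * lam * x) * x).
Proof. destruct (roots2_sq _ _ _ _ _ Hr) as [E1 E2]. rewrite E1, E2. split; ring. Qed.

Lemma root_diff l : y ^ l - z ^ l = upoly l x * (y - z).
Proof.
  destruct roots_eqs as [Ey Ez].
  enough (H : y ^ l - z ^ l = upoly l x * (y - z) /\
    y ^ S l - z ^ S l = upoly (S l) x * (y - z)) by apply H.
  induction l as [|l [IH1 IH2]].
  - rewrite upoly_0, upoly_1. simpl. split; ring.
  - split; [easy|].
    assert (E : mu2 * (y ^ S (S l) - z ^ S (S l)) = mu2 * (upoly (S (S l)) x * (y - z))).
    { transitivity (mu2 * (y * y) * y ^ l - mu2 * (z * z) * z ^ l); [simpl; ring|].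
      rewrite Ey, Ez.
      transitivity ((2 * lam + mu1 + mu2) * x * (y ^ S l - z ^ S l)
        - (mu1 + 2 * lam * x) * x * (y ^ l - z ^ l)); [simpl; ring|].
      rewrite IH1, IH2.
      transitivity (mu2 * upoly (S (S l)) x * (y - z)); [|ring].
      rewrite upoly_rec. ring. }
    transitivity (/ mu2 * (mu2 * (y ^ S (S l) - z ^ S (S l)))); [field; easy|].
    rewrite E. field. easy.
Qed.

(** With [s = 2 lam + mu1 + mu2], a double root at [x <> 0] requires
    [(s^2 - 8 mu2 lam) x = 4 mu1 mu2], and such an x is too large for [Hx]. So derivatives occur
    only at the origin. *)
Lemma double_root : y = z -> x = 0 /\ y = 0.
Proof.
  intros <-. destruct (roots2_vieta _ _ _ _ _ Hr) as [E1 E2].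
  destruct (Ceq_dec x 0) as [Hx0|Hx0].
  - split; [easy|]. rewrite Hx0 in E1.
    transitivity (- (1 / (2 * mu2)) * (- mu2 * (y + y))).
    + field. easy.
    + rewrite <- E1. ring.
  - exfalso. destruct coef_base_spec as (R1 & _ & R3).
    assert (E : (2 * lam + mu1 + mu2) * (2 * lam + mu1 + mu2) * x
      = 4 * mu2 * (mu1 + 2 * lam * x)).
    { transitivity (/ x * (- ((2 * lam + mu1 + mu2) * x) * - ((2 * lam + mu1 + mu2) * x)));
        [field; easy|].
      rewrite E1.
      transitivity (/ x * (4 * mu2 * (mu2 * (y * y)))); [ring|].
      rewrite <- E2. field. easy. }
    set (s := (2 * lam + mu1 + mu2)%R) in *.
    assert (E3 : RtoC (4 * mu1 * mu2) = RtoC (s * s - 8 * mu2 * lam) * x).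
    { rewrite RtoC_minus, !RtoC_mult. unfold s. rewrite !RtoC_plus, RtoC_mult.
      symmetry. apply eq_plus_null with (1 := null_of_eq _ _ _ (eq_sym E) eq_refl).
      ring. }
    assert (Hs : (0 < s * s - 8 * mu2 * lam)%R).
    { unfold s. assert (0 < mu1 * mu1)%R by now apply Rmult_lt_0_compat.
      assert (0 < mu1 * (2 * lam + mu2))%R by (apply Rmult_lt_0_compat; lra).
      generalize (Rle_0_sqr (2 * lam - mu2)). unfold Rsqr. nra. }
    apply (f_equal Cmod) in E3. rewrite Cmod_mult, !Cmod_R, !Rabs_pos_eq in E3.
    + assert (Hl : (0 < mu2 * lam)%R) by now apply Rmult_lt_0_compat.
      assert (H12 : (0 < mu1 * mu2)%R) by now apply Rmult_lt_0_compat.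
      assert (Hx1 := Cmod_ge_0 x).
      assert (B1 : ((s * s - 8 * mu2 * lam) * Cmod x <= mu1 * mu2 * coef_base * Cmod x)%R)
        by (apply Rmult_le_compat_r; lra).
      assert (B2 : (mu1 * mu2 * (coef_base * Cmod x) <= mu1 * mu2 * (1 / 2))%R)
        by (apply Rmult_le_compat_l; lra).
      lra.
    + lra.
    + repeat apply Rmult_le_pos; lra.
Qed.

Variables (a : nat -> C) (M : R).
Hypothesis HM : forall l, (Cmod (a l) <= M)%R.

Lemma upoly_at_0 l : upoly l 0 = if (l =? 1)%nat then 1 else 0.
Proof.
  destruct l as [|[|l]]; [apply upoly_0|apply upoly_1|].
  unfold upoly. rewrite csum_S_l, ucoef_low, csum_0 by (intros; simpl; ring || lia).
  simpl. ring.
Qed.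

(** For distinct roots this is termwise division. Otherwise x and both roots are 0, [upoly l 0] is
    nonzero only at [l = 1], and the series reduce to the derivatives at 0 of A and of [y * A y]. *)
Lemma quot_upoly :
  is_cser (fun l => a l * upoly l x) (quot (cgen a) y z) /\
  is_cser (fun l => a l * (upoly (S l) x - x * upoly l x))
    (quot (fun y => (y - x) * cgen a y) y z).
Proof.
  destruct roots_eqs as [Ey Ez].
  assert (Hy := root_small y Ey). assert (Hz := root_small z Ez).
  unfold quot. destruct (Ceq_dec y z) as [E|E].
  - destruct (double_root E) as [-> ->].
    assert (HS : forall t : R, (Rabs t <= 1 / 2)%R -> (Cmod t <= 1 / 2)%R)
      by (intros t Ht; now rewrite Cmod_R).
    split.
    (* Removing two terms of the series leaves the error t times the series of the coefficients
       [a (l + 2)], which is at most [2 * M] on the disk of radius 1/2. *)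
    + rewrite (C_derive_0 _ (a 1%nat) (2 * M)).
      * replace (a 1%nat) with (csum 2 (fun l => a l * upoly l 0)).
        -- apply is_cser_finite. intros [|[|n]] Hn; try lia.
           rewrite upoly_at_0. simpl. ring.
        -- simpl. rewrite !upoly_at_0. simpl. ring.
      * intros t Ht Ht'. assert (Htc : RtoC t <> 0) by (intros E'; now apply RtoC_inj in E').
        rewrite cgen_0, (cgen_S a M t HM (HS t Ht')).
        rewrite (cgen_S _ M t (fun l => HM (S l)) (HS t Ht')).
        match goal with |- (Cmod ?e <= _)%R =>
          replace e with (RtoC t * cgen (fun l => a (S (S l))) t) by (field; easy) end.
        rewrite Cmod_mult, Cmod_R, Rmult_comm.
        apply Rmult_le_compat_r; [apply Rabs_pos|].
        apply cgen_le; [intros; apply HM|now apply HS].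
    + rewrite (C_derive_0 _ (a 0%nat) (2 * M)).
      * replace (a O) with (csum 1 (fun l => a l * (upoly (S l) 0 - 0 * upoly l 0))).
        -- apply is_cser_finite. intros [|n] Hn; try lia.
           rewrite !upoly_at_0. simpl. ring.
        -- simpl. rewrite !upoly_at_0. simpl. ring.
      * intros t Ht Ht'. assert (Htc : RtoC t <> 0) by (intros E'; now apply RtoC_inj in E').
        rewrite (cgen_S a M t HM (HS t Ht')).
        match goal with |- (Cmod ?e <= _)%R =>
          replace e with (RtoC t * cgen (fun l => a (S l)) t) by (field; easy) end.
        rewrite Cmod_mult, Cmod_R, Rmult_comm.
        apply Rmult_le_compat_r; [apply Rabs_pos|].
        apply cgen_le; [intros; apply HM|now apply HS].
  - assert (E' : y - z <> 0).
    { intros E0. apply E. apply eq_plus_null with (1 := E0). ring. }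
    assert (Sy := is_cser_cgen a M HM y Hy). assert (Sz := is_cser_cgen a M HM z Hz).
    split.
    + replace ((cgen a y - cgen a z) / (y - z))
        with (/ (y - z) * (cgen a y - cgen a z)) by (field; easy).
      apply is_cser_ext with (fun l => / (y - z) * (a l * y ^ l - a l * z ^ l)).
      * intros l.
        transitivity (/ (y - z) * (a l * (y ^ l - z ^ l))); [ring|].
        rewrite root_diff. field. easy.
      * now apply is_cser_scal, is_cser_minus.
    + match goal with |- is_cser _ ?e => replace e with
        (/ (y - z) * ((y - x) * cgen a y - (z - x) * cgen a z)) by (field; easy) end.
      apply is_cser_ext with
        (fun l => / (y - z) * ((y - x) * (a l * y ^ l) - (z - x) * (a l * z ^ l))).
      * intros l.
        transitivity (/ (y - z) * (a l * ((y ^ S l - z ^ S l) - x * (y ^ l - z ^ l))));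
          [simpl; ring|].
        rewrite !root_diff. field. easy.
      * now apply is_cser_scal, is_cser_minus; apply is_cser_scal.
Qed.

Lemma coef_bound (w : nat -> nat -> C) (B : R) i k :
  (0 <= B)%R ->
  (Cmod (w i k) <= B * ((1 / 2) ^ i * coef_base ^ k))%R ->
  (Cmod (a i * (w i k * x ^ k)) <= M * B * ((1 / 2) ^ i * (1 / 2) ^ k))%R.
Proof.
  intros HB Hw. rewrite !Cmod_mult, Cmod_pow, Rmult_assoc.
  apply Rmult_le_compat; [apply Cmod_ge_0| |apply HM|].
  - apply Rmult_le_pos; [apply Cmod_ge_0|apply pow_le, Cmod_ge_0].
  - destruct coef_base_spec as (R1 & _).
    apply Rle_trans with (B * ((1 / 2) ^ i * coef_base ^ k) * Cmod x ^ k)%R.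
    + apply Rmult_le_compat_r; [apply pow_le, Cmod_ge_0|easy].
    + replace (B * ((1 / 2) ^ i * coef_base ^ k) * Cmod x ^ k)%R
        with (B * ((1 / 2) ^ i * (coef_base * Cmod x) ^ k))%R
        by (rewrite Rpow_mult_distr; ring).
      apply Rmult_le_compat_l; [easy|]. apply Rmult_le_compat_l; [apply pow_le; lra|].
      apply pow_incr. split; [|easy]. apply Rmult_le_pos; [lra|apply Cmod_ge_0].
Qed.

Lemma quot_coefficients :
  is_cser (fun k => csum (2 * k + 2) (fun l => a l * ucoef l k) * x ^ k)
    (quot (cgen a) y z) /\
  is_cser (fun k => csum (2 * k + 2) (fun l => a l * vcoef l k) * x ^ k)
    (quot (fun y => (y - x) * cgen a y) y z).
Proof.
  destruct quot_upoly as [Q1 Q2]. split.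
  - apply is_cser_ext with (fun k => csum (2 * k + 2) (fun l => a l * (ucoef l k * x ^ k))).
    { intros k. rewrite <- csum_scal_r. apply csum_ext. intros; ring. }
    apply (is_cser_swap (fun l k => a l * (ucoef l k * x ^ k)) (M * 2)).
    + intros i k. apply coef_bound; [lra|apply ucoef_le].
    + intros i k Hik. rewrite ucoef_high by lia. ring.
    + intros i k Hik. rewrite ucoef_low by lia. ring.
    + apply is_cser_ext with (2 := Q1). intros l. now rewrite csum_scal.
  - apply is_cser_ext with (fun k => csum (2 * k + 2) (fun l => a l * (vcoef l k * x ^ k))).
    { intros k. rewrite <- csum_scal_r. apply csum_ext. intros; ring. }
    apply (is_cser_swap (fun l k => a l * (vcoef l k * x ^ k)) (M * 3)).
    + intros i k. apply coef_bound; [lra|apply vcoef_le].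
    + intros i k Hik. rewrite vcoef_high by lia. ring.
    + intros i k Hik. rewrite vcoef_low by lia. ring.
    + apply is_cser_ext with (2 := Q2). intros l. now rewrite csum_scal, vpoly.
Qed.

End SmallX.

Lemma csum_ucoef (a : nat -> C) k :
  mu1 * csum (2 * k + 2) (fun l => a l * ucoef l k) =
  - mu2 * csum (S k) (fun n => a (S k + n)%nat * G (S n) (S k)).
Proof.
  replace (2 * k + 2)%nat with (S k + S k)%nat by lia.
  rewrite csum_add, csum_0.
  2:{ intros l Hl. rewrite ucoef_high by lia. ring. }
  rewrite (csum_ext (S k) _ (fun n =>
    - (mu2 / mu1) * (a (S k + n)%nat * G (S n) (S k)))).
  - rewrite csum_scal. field. easy.
  - intros n _. unfold ucoef. replace (S k + n - k)%nat with (S n) by lia. ring.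
Qed.

(** So the left-hand side of a functional equation generates the values on the diagonal of the
    extension of [pi] across it. *)
Lemma csum_vcoef (a : nat -> C) k :
  csum (2 * k + 2) (fun l => a l * vcoef l k) = off mu1 mu2 G a k k.
Proof.
  replace (2 * k + 2)%nat with (k + (k + 2))%nat by lia.
  rewrite csum_add, csum_0.
  2:{ intros l Hl. rewrite vcoef_high by lia. ring. }
  rewrite (off_trunc lam mu1 mu2 G mu20 HG a k k (k + 2)) by lia.
  rewrite <- csum_scal, Cplus_0_l. apply csum_ext. intros n _.
  unfold vcoef. replace (S (k + n) - k)%nat with (S n) by lia. ring.
Qed.

End Coefficients.

(** Supplies the roots at real x, where the functional equations are tested to obtain the
    coefficients. *)
Lemma real_quadratic_roots (a b c : R) :
  (0 < a)%R -> exists y z : C, roots2 a b c y z.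
Proof.
  intros Ha. assert (Han := RtoC_neq0 a Ha).
  assert (Hw : exists w : C, w * w = b * b - 4 * a * c).
  { assert (E : RtoC (b * b - 4 * a * c) = b * b - 4 * a * c)
      by now rewrite RtoC_minus, !RtoC_mult.
    rewrite <- E. set (d := (b * b - 4 * a * c)%R).
    destruct (Rle_lt_dec 0 d) as [Hd|Hd].
    - exists (RtoC (sqrt d)). rewrite <- RtoC_mult. now rewrite sqrt_sqrt.
    - exists (Ci * RtoC (sqrt (- d))).
      transitivity (Ci * Ci * (RtoC (sqrt (- d)) * RtoC (sqrt (- d)))); [ring|].
      rewrite <- RtoC_mult, sqrt_sqrt by lra.
      apply injective_projections; simpl; ring. }
  destruct Hw as [w Hw].
  exists ((- b + w) / (2 * a)), ((- b - w) / (2 * a)). intros Y.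
  transitivity (a * Y ^ 2 + b * Y + (b * b - w * w) / (4 * a)).
  - rewrite Hw. field. easy.
  - simpl. field. easy.
Qed.

Section FunctionalEquations.

Variables (K : option nat) (lam mu1 mu2 p1 p2 : R) (G1 G2 : nat -> nat -> C).
Hypotheses (lam0 : (0 < lam)%R) (mu10 : (0 < mu1)%R) (mu20 : (0 < mu2)%R).
Hypotheses (HG1 : is_gpow lam mu1 mu2 G1) (HG2 : is_gpow lam mu2 mu1 G2).

(** So the factor [D] common to both functional equations is the generating series of
    [2 * lam * dia]. *)
Lemma dia_ucoef (a b : nat -> C) k :
  2 * lam * dia lam mu1 mu2 G1 G2 a b k =
  mu1 * csum (2 * k + 2) (fun l => a l * ucoef mu1 mu2 G1 l k)
  + mu2 * csum (2 * k + 2) (fun l => b l * ucoef mu2 mu1 G2 l k).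
Proof.
  rewrite (csum_ucoef lam mu1 mu2 G1), (csum_ucoef lam mu2 mu1 G2) by easy.
  rewrite dia_off by easy.
  now rewrite (off_sum lam mu1 mu2 G1), (off_sum lam mu2 mu1 G2).
Qed.

Definition diag_defect (mu p : R) (P : nat -> nat -> C) (d : nat -> C) (c : C)
    (k : nat) : C :=
  mu * P k k - (mu * (d k + cap_delta K c k)
    + 2 * lam * p * match k with O => 0 | S i => d i end).

Lemma defect_series (mu p : R) (P : nat -> nat -> C) (d : nat -> C) (c x Q D : C) :
  is_cser (fun k => P k k * x ^ k) Q ->
  is_cser (fun k => 2 * lam * d k * x ^ k) D ->
  is_cser (fun k => diag_defect mu p P d c k * x ^ k)
    (mu * Q - (mu * cap_term K x c + (mu + 2 * p * lam * x) / (2 * lam) * D)).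
Proof.
  intros HQ HD. assert (Hl := RtoC_neq0 lam lam0).
  assert (HC : is_cser (fun k => cap_delta K c k * x ^ k) (cap_term K x c)).
  { destruct K as [n|]; simpl.
    - replace (x ^ n * c) with
        (csum (S n) (fun k => (if (k =? n)%nat then c else 0) * x ^ k)).
      + apply is_cser_finite. intros k Hk.
        destruct (Nat.eqb_spec k n); [lia|ring].
      + rewrite (csum_single _ n) by (lia || (intros k Hk Hkn;
          destruct (Nat.eqb_spec k n); [lia|ring])).
        rewrite Nat.eqb_refl. ring.
    - apply (is_cser_finite _ 0). intros k _. ring. }
  (* The part [p * x * D] of the right-hand side shifts the coefficients by one, producing the term
     [d i] with [k = S i]. *)
  assert (HX := is_cser_unshift _ _ (is_cser_scal (RtoC p * x) _ _ HD)).
  replace (mu * Q - (mu * cap_term K x c + (mu + 2 * p * lam * x) / (2 * lam) * D))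
    with (mu * Q - (mu * cap_term K x c + (mu / (2 * lam) * D + p * x * D)))
    by (field; easy).
  eapply is_cser_ext; [|apply is_cser_minus; [apply is_cser_scal, HQ|
    apply is_cser_plus; [apply is_cser_scal, HC|
    apply is_cser_plus; [apply is_cser_scal, HD|apply HX]]]].
  intros k. unfold diag_defect. destruct k as [|k].
  - simpl. field. easy.
  - simpl. field. easy.
Qed.

Variables (a b : nat -> C) (c : C) (M : R).
Hypotheses (Ha : forall l, (Cmod (mask K a l) <= M)%R).
Hypotheses (Hb : forall l, (Cmod (mask K b l) <= M)%R).

Let d := dia lam mu1 mu2 G1 G2 (mask K a) (mask K b).

Lemma fe_series (x y1 z1 y2 z2 : C) :
  (coef_base lam mu1 mu2 * Cmod x <= 1 / 2)%R -> (coef_base lam mu2 mu1 * Cmod x <= 1 / 2)%R ->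
  roots2 mu2 (- ((2 * lam + mu1 + mu2) * x)) ((mu1 + 2 * lam * x) * x) y1 z1 ->
  roots2 mu1 (- ((2 * lam + mu1 + mu2) * x)) ((mu2 + 2 * lam * x) * x) y2 z2 ->
  exists S1 S2 : C,
    is_cser (fun k => diag_defect mu2 p1 (off mu1 mu2 G1 (mask K a)) d c k * x ^ k) S1 /\
    is_cser (fun k => diag_defect mu1 p2 (off mu2 mu1 G2 (mask K b)) d c k * x ^ k) S2 /\
    (functional_equations K lam mu1 mu2 p1 p2 a b c x y1 z1 y2 z2 <->
     S1 = 0 /\ S2 = 0).
Proof.
  intros Hx1 Hx2 Hr1 Hr2.
  replace (2 * lam + mu1 + mu2) with (2 * lam + mu2 + mu1) in Hr2 by ring.
  destruct (quot_coefficients lam mu1 mu2 G1 lam0 mu10 mu20 HG1 x y1 z1 Hx1 Hr1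
    (mask K a) M Ha) as [D1 Q1].
  destruct (quot_coefficients lam mu2 mu1 G2 lam0 mu20 mu10 HG2 x y2 z2 Hx2 Hr2
    (mask K b) M Hb) as [D2 Q2].
  unfold functional_equations. rewrite !gen_mask.
  set (A1 := cgen (mask K a)) in *. set (A2 := cgen (mask K b)) in *.
  assert (HD : is_cser (fun k => 2 * lam * d k * x ^ k)
    (mu1 * quot A1 y1 z1 + mu2 * quot A2 y2 z2)).
  { eapply is_cser_ext; [|apply is_cser_plus; apply is_cser_scal; [exact D1|exact D2]].
    intros k. unfold d. rewrite dia_ucoef. ring. }
  assert (Q1' : is_cser (fun k => off mu1 mu2 G1 (mask K a) k k * x ^ k)
    (quot (fun y => (y - x) * A1 y) y1 z1)).
  { apply is_cser_ext with (2 := Q1). intros k.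
    now rewrite (csum_vcoef lam mu1 mu2 G1). }
  assert (Q2' : is_cser (fun k => off mu2 mu1 G2 (mask K b) k k * x ^ k)
    (quot (fun y => (y - x) * A2 y) y2 z2)).
  { apply is_cser_ext with (2 := Q2). intros k.
    now rewrite (csum_vcoef lam mu2 mu1 G2). }
  do 2 eexists. split; [|split].
  - apply (defect_series mu2 p1 _ d c x _ _ Q1' HD).
  - apply (defect_series mu1 p2 _ d c x _ _ Q2' HD).
  - split; intros [E1 E2]; split.
    + now apply null_of_eq with (1 := eq_sym E1).
    + now apply null_of_eq with (1 := eq_sym E2).
    + apply eq_plus_null with (1 := E1). ring.
    + apply eq_plus_null with (1 := E2). ring.
Qed.

Lemma functional_equations_iff :
  functional_equations_near0 K lam mu1 mu2 p1 p2 a b c <->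
  diag_relations K lam mu1 mu2 p1 p2 G1 G2 (mask K a) (mask K b) c.
Proof.
  destruct (coef_base_spec lam mu1 mu2 lam0 mu10 mu20) as [B1 _].
  destruct (coef_base_spec lam mu2 mu1 lam0 mu20 mu10) as [B2 _].
  set (R1 := coef_base lam mu1 mu2) in *. set (R2 := coef_base lam mu2 mu1) in *.
  (* As both constants are at least 1, their product dominates each of them, and [|x| < r] meets
     both smallness conditions. *)
  set (r := (1 / (2 * (R1 * R2)))%R).
  assert (H12 : (1 <= R1 * R2)%R) by nra.
  assert (Hr : (0 < r)%R) by (apply Rdiv_lt_0_compat; lra).
  assert (Er : (R1 * R2 * r = 1 / 2)%R) by (unfold r; field; lra).
  assert (Hsmall : forall x, (Cmod x < r)%R ->
    (R1 * Cmod x <= 1 / 2)%R /\ (R2 * Cmod x <= 1 / 2)%R).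
  { intros x Hx. assert (Hx0 := Cmod_ge_0 x). rewrite <- Er. split.
    - rewrite Rmult_assoc. apply Rmult_le_compat_l; [lra|]. nra.
    - rewrite (Rmult_comm R1), Rmult_assoc. apply Rmult_le_compat_l; [lra|]. nra. }
  split.
  - intros [eps [Heps H]].
    assert (Hmin : (0 < Rmin eps r)%R) by now apply Rmin_glb_lt.
    assert (HS : forall x : R, (Rabs x < Rmin eps r)%R ->
      is_cser (fun k => diag_defect mu2 p1 (off mu1 mu2 G1 (mask K a)) d c k * RtoC x ^ k) 0 /\
      is_cser (fun k => diag_defect mu1 p2 (off mu2 mu1 G2 (mask K b)) d c k * RtoC x ^ k) 0).
    { intros x Hx. rewrite <- Cmod_R in Hx.
      destruct (Hsmall x) as [Hx1 Hx2].
      { eapply Rlt_le_trans; [exact Hx|apply Rmin_r]. }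
      destruct (real_quadratic_roots mu2 (- ((2 * lam + mu1 + mu2) * x))
        ((mu1 + 2 * lam * x) * x) mu20) as (y1 & z1 & Hr1).
      destruct (real_quadratic_roots mu1 (- ((2 * lam + mu1 + mu2) * x))
        ((mu2 + 2 * lam * x) * x) mu10) as (y2 & z2 & Hr2).
      rewrite RtoC_opp, !RtoC_mult, !RtoC_plus, !RtoC_mult in Hr1, Hr2.
      destruct (fe_series x y1 z1 y2 z2 Hx1 Hx2 Hr1 Hr2) as (S1 & S2 & H1 & H2 & E).
      destruct (proj1 E) as [E1 E2].
      - apply H; [|easy|easy]. eapply Rlt_le_trans; [exact Hx|apply Rmin_l].
      - now subst. }
    intros k. split.
    + assert (E := power_series_zero _ _ Hmin (fun x Hx => proj1 (HS x Hx)) k).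
      apply eq_plus_null with (1 := E). unfold diag_defect. fold d. ring.
    + assert (E := power_series_zero _ _ Hmin (fun x Hx => proj2 (HS x Hx)) k).
      apply eq_plus_null with (1 := E). unfold diag_defect. fold d. ring.
  - intros H. exists r. split; [easy|].
    intros x Hx y1 z1 y2 z2 Hr1 Hr2. destruct (Hsmall x Hx) as [Hx1 Hx2].
    destruct (fe_series x y1 z1 y2 z2 Hx1 Hx2 Hr1 Hr2) as (S1 & S2 & H1 & H2 & E).
    apply E.
    assert (Z : forall (w : nat -> C) s, (forall k, w k = 0) ->
      is_cser (fun k => w k * x ^ k) s -> s = 0).
    { intros w s Hw Hs. apply is_cser_inj with (1 := Hs).
      apply (is_cser_finite _ 0). intros k _. rewrite Hw. ring. }
    split.
    + apply Z with (2 := H1). intros k. destruct (H k) as [E1 _].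
      now apply null_of_eq with (1 := eq_sym E1).
    + apply Z with (2 := H2). intros k. destruct (H k) as [_ E2].
      now apply null_of_eq with (1 := eq_sym E2).
Qed.

End FunctionalEquations.

(** * Scaling and bounds for the boundary sequences *)

Lemma diag_relations_scal K lam mu1 mu2 p1 p2 G1 G2 (a b : nat -> C) (c t : C) :
  diag_relations K lam mu1 mu2 p1 p2 G1 G2 a b c ->
  diag_relations K lam mu1 mu2 p1 p2 G1 G2
    (fun l => t * a l) (fun l => t * b l) (t * c).
Proof.
  intros H k. destruct (H k) as [E1 E2]. unfold diag_relation in *.
  assert (Ed : cap_delta K (t * c) k = t * cap_delta K c k).
  { destruct K as [n|]; simpl; [destruct Nat.eqb|]; ring. }
  assert (Ep : match k with O => RtoC 0
      | S i => dia lam mu1 mu2 G1 G2 (fun l => t * a l) (fun l => t * b l) i end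
    = t * match k with O => RtoC 0 | S i => dia lam mu1 mu2 G1 G2 a b i end).
  { destruct k; [ring|]. apply dia_scal. }
  rewrite Ep, Ed, dia_scal, !off_scal. split.
  - transitivity (t * (mu2 * off mu1 mu2 G1 a k k)); [ring|]. rewrite E1. ring.
  - transitivity (t * (mu1 * off mu2 mu1 G2 b k k)); [ring|]. rewrite E2. ring.
Qed.

Lemma null_seq_mask K a : null_seq K (mask K a).
Proof. intros l Hl. unfold mask. now rewrite Hl. Qed.

Lemma mask_null K a : null_seq K a -> mask K a = a.
Proof.
  intros H. apply functional_extensionality. intros l. unfold mask.
  destruct (in_cap K l) eqn:E; [easy|]. now rewrite H.
Qed.

Lemma summable2_le (f : nat -> nat -> R) j k :
  (forall j k, (0 <= f j k)%R) -> summable2 f -> (f j k <= sum2 f)%R.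
Proof.
  intros Hf Hs. destruct (summable2_is_sum2 f Hs) as [r [Hr Hv]].
  assert (H1 := is_series_rsum_le (f j) (r j) (S k) (Hf j) (Hr j)).
  assert (H2 := rsum_term_le (S k) (f j) k (Hf j) (Nat.lt_succ_diag_r k)).
  assert (Hr0 : forall i, (0 <= r i)%R)
    by (intros i; apply (is_series_rsum_le (f i) (r i) 0 (Hf i) (Hr i))).
  assert (H3 := is_series_rsum_le r (sum2 f) (S j) Hr0 Hv).
  assert (H4 := rsum_term_le (S j) r j Hr0 (Nat.lt_succ_diag_r j)).
  lra.
Qed.

Section Admissible.

Variables (K : option nat) (lam mu1 mu2 : R) (g1 g2 : nat -> C).
Hypotheses (lam0 : (0 < lam)%R) (mu10 : (0 < mu1)%R) (mu20 : (0 < mu2)%R).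
Hypotheses (HG1 : is_gpow lam mu1 mu2 (conv_pow g1)).
Hypotheses (HG2 : is_gpow lam mu2 mu1 (conv_pow g2)).

Lemma reconstruct_recon (a b : nat -> C) c j k :
  reconstruct None lam mu1 mu2 g1 g2 a b j k =
  recon None lam mu1 mu2 (conv_pow g1) (conv_pow g2) a b c j k.
Proof.
  unfold reconstruct, recon.
  rewrite (off_diag_off None lam mu1 mu2 g1), (off_diag_off None lam mu2 mu1 g2),
    on_diag_dia by easy.
  simpl in_cap. cbv iota. rewrite !mask_null by easy.
  destruct (k <? j)%nat, (j <? k)%nat; try easy. simpl. ring.
Qed.

Lemma admissible_bounded (a b : nat -> C) :
  admissible K lam mu1 mu2 g1 g2 a b ->
  exists M, forall l, (Cmod (mask K a l) <= M)%R /\ (Cmod (mask K b l) <= M)%R.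
Proof.
  intros H. destruct K as [n|].
  - exists (rsum (S n) (fun l => Cmod (a l)) + rsum (S n) (fun l => Cmod (b l)))%R.
    assert (P : forall f : nat -> C, (0 <= rsum (S n) (fun l => Cmod (f l)))%R)
      by (intros f; apply rsum_ge0; intros; apply Cmod_ge_0).
    assert (T : forall (f : nat -> C) l,
      (Cmod (mask (Some n) f l) <= rsum (S n) (fun l => Cmod (f l)))%R).
    { intros f l. unfold mask, in_cap. destruct (Nat.leb_spec l n).
      - apply (rsum_term_le (S n) (fun l => Cmod (f l))); [|lia].
        intros; apply Cmod_ge_0.
      - rewrite Cmod_0. apply P. }
    intros l. assert (P1 := P a). assert (P2 := P b).
    assert (T1 := T a l). assert (T2 := T b l). lra.
  - specialize (H eq_refl). set (f := fun j k => Cmod _) in H.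
    assert (F : forall j k, (f j k <= sum2 f)%R)
      by (intros j k; apply summable2_le; [intros; apply Cmod_ge_0|easy]).
    (* For positive indices the boundary values are entries of the summable array. At the origin the
       array holds the diagonal formula, not yet known to agree with [a O] and [b O], which are
       therefore added. *)
    set (v := sum2 f) in F. exists (v + Cmod (a O) + Cmod (b O))%R.
    assert (Ca := Cmod_ge_0 (a O)). assert (Cb := Cmod_ge_0 (b O)).
    assert (F0 := Rle_trans _ _ _ (Cmod_ge_0 _ : (0 <= f O O)%R) (F O O)).
    intros l. unfold mask. simpl. destruct l as [|l]; [lra|].
    assert (F1 := F (S l) O). assert (F2 := F O (S l)). unfold f in F1, F2.
    rewrite (reconstruct_recon _ _ 0), recon_below, (off_0 lam) in F1
      by (easy || lia).
    rewrite (reconstruct_recon _ _ 0), recon_above, (off_0 lam) in F2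
      by (easy || lia).
    unfold mask in F1, F2. simpl in F1, F2. lra.
Qed.

Lemma recon_adiag_bounded (a b : nat -> C) c :
  admissible K lam mu1 mu2 g1 g2 a b ->
  exists M, forall n, (rsum n (adiag (fun j k => Cmod
    (recon K lam mu1 mu2 (conv_pow g1) (conv_pow g2) (mask K a) (mask K b) c j k)))
    <= M)%R.
Proof.
  intros H. set (f := fun j k => Cmod _).
  assert (Hf : forall j k, (0 <= f j k)%R) by (intros; apply Cmod_ge_0).
  destruct K as [N|] eqn:EK.
  - exists (rsum (2 * N + 1) (adiag f)). intros n.
    apply Rle_trans with (rsum (Nat.max n (2 * N + 1)) (adiag f)).
    + apply rsum_incr; [lia|]. intros; now apply adiag_ge0.
    + right. apply RtoC_inj. rewrite <- !csum_RtoC. apply csum_trunc; [lia|].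
      intros i Hi. f_equal. unfold adiag.
      rewrite (rsum_ext _ _ (fun _ => 0 * 0)%R), rsum_scal; [ring|].
      intros j Hj. unfold f. rewrite Rmult_0_l, recon_null, Cmod_0; try easy.
      * apply null_seq_mask.
      * apply null_seq_mask.
      * unfold in_cap. apply andb_false_iff. rewrite !Nat.leb_gt. lia.
  - specialize (H eq_refl). eexists. intros n.
    apply rsum_adiag_le; [easy|].
    apply is_sum2_ext with (2 := summable2_is_sum2 _ H).
    intros j k. unfold f.
    now rewrite (reconstruct_recon _ _ c), !mask_null.
Qed.

Lemma corner_or0_relation (a b : nat -> C) :
  K <> Some O ->
  corner_relation K lam mu1 mu2 (conv_pow g1) (conv_pow g2) (mask K a) (mask K b)
    (corner_or0 K lam mu1 mu2 g1 g2 a b).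
Proof.
  intros K1 n EK. rewrite EK. apply corner_off; try easy.
  destruct n; [congruence|lia].
Qed.

End Admissible.

(** Since f is real, the real and imaginary parts of [c * f] are real multiples of one series, and
    [Series] commutes with real factors; a complex f would require splitting a sum of two series. *)
Lemma sum_from_scal K (f : nat -> R) (c : C) (a : nat -> C) :
  (forall k, in_cap K k = true -> a k = c * f k) ->
  sum_from K 0 a = c * sum_from K 0 (fun k => RtoC (f k)).
Proof.
  intros H. unfold sum_from. cbv zeta. simpl Nat.add.
  set (g := fun n => if in_cap K n then f n else 0%R).
  assert (E : forall n, (if in_cap K n then a n else RtoC 0) = c * RtoC (g n)).
  { intros n. unfold g. destruct (in_cap K n) eqn:E; [now apply H|ring]. }
  assert (E' : forall n, (if in_cap K n then RtoC (f n) else RtoC 0) = RtoC (g n)).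
  { intros n. unfold g. now destruct in_cap. }
  assert (S0 : Series (fun _ => 0%R) = 0%R)
    by apply is_series_unique, is_series_zero.
  rewrite (Series_ext (fun n => Re (if in_cap K n then a n else RtoC 0))
    (fun n => Re c * g n)%R) by (intros n; rewrite E; unfold Re; simpl; ring).
  rewrite (Series_ext (fun n => Im (if in_cap K n then a n else RtoC 0))
    (fun n => Im c * g n)%R) by (intros n; rewrite E; unfold Im; simpl; ring).
  rewrite (Series_ext (fun n => Re (if in_cap K n then RtoC (f n) else RtoC 0)) g)
    by (intros n; now rewrite E').
  rewrite (Series_ext (fun n => Im (if in_cap K n then RtoC (f n) else RtoC 0))
    (fun _ => 0%R)) by (intros n; now rewrite E').
  rewrite !Series_scal_l, S0.
  apply injective_projections; simpl; unfold Re, Im; ring.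
Qed.

Lemma gen_1_scal K (f : nat -> R) (c : C) (a : nat -> C) :
  (forall k, in_cap K k = true -> a k = c * f k) ->
  gen K a 1 = c * gen K (fun k => RtoC (f k)) 1.
Proof.
  intros H. unfold gen.
  rewrite (sum_from_scal K f c (fun k => a k * 1 ^ k)).
  - rewrite (sum_from_scal K f 1 (fun k => RtoC (f k) * 1 ^ k)); [ring|].
    intros k _. rewrite Cpow_1_l. ring.
  - intros k Hk. rewrite Cpow_1_l, H by easy. ring.
Qed.

Theorem theorem7
  (lam mu1 mu2 p1 p2 : R) (K : option nat) (pi : nat -> nat -> R)
  (xi1p xi1m xi2p xi2m : C)
  (lam_pos : (0 < lam)%R) (mu1_pos : (0 < mu1)%R) (mu2_pos : (0 < mu2)%R)
  (p1_ge0 : (0 <= p1)%R) (p2_ge0 : (0 <= p2)%R) (p_sum : (p1 + p2 = 1)%R)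
  (K_ge1 : K <> Some O)
  (stable : K = None -> (2 * lam < mu1 + mu2)%R)
  (pi_inv : is_invariant_distribution K lam mu1 mu2 p1 p2 pi)
  (xi1 : roots2 mu2 (- (2 * lam + mu1 + mu2)) (2 * lam) xi1p xi1m)
  (xi2 : roots2 mu1 (- (2 * lam + mu1 + mu2)) (2 * lam) xi2p xi2m) :
  let g1 := g_fun (mu1 / mu2) xi1p xi1m in
  let g2 := g_fun (mu2 / mu1) xi2p xi2m in
  let pi10 := fun k : nat => RtoC (pi k 0%nat) in
  let pi01 := fun k : nat => RtoC (pi 0%nat k) in
  let piKK := match K with Some n => RtoC (pi n n) | None => RtoC 0 end in
  (* (i) *)
  ((forall j k : nat, (j < k)%nat -> in_cap K k = true ->
      RtoC (pi k j) = off_diag K mu1 mu2 g1 pi10 k j /\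
      RtoC (pi j k) = off_diag K mu2 mu1 g2 pi01 k j) /\
   (forall k : nat, in_cap K (k + 1) = true ->
      RtoC (pi k k) = on_diag K lam mu1 mu2 g1 g2 pi10 pi01 k) /\
   (forall n : nat, K = Some n ->
      RtoC (pi n n) = corner lam mu1 mu2 g1 g2 pi10 pi01 n)) /\
  (* (ii) *)
  (functional_equations_near0 K lam mu1 mu2 p1 p2 pi10 pi01 piKK /\
   forall a b : nat -> C,
     admissible K lam mu1 mu2 g1 g2 a b ->
     functional_equations_near0 K lam mu1 mu2 p1 p2 a b
       (corner_or0 K lam mu1 mu2 g1 g2 a b) <->
     exists c : C, forall k : nat, in_cap K k = true ->
       a k = c * pi10 k /\ b k = c * pi01 k) /\
  (* (iii) *)
  (normalized K lam mu1 mu2 pi10 pi01 piKK /\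
   forall a b : nat -> C,
     admissible K lam mu1 mu2 g1 g2 a b ->
     functional_equations_near0 K lam mu1 mu2 p1 p2 a b
       (corner_or0 K lam mu1 mu2 g1 g2 a b) ->
     normalized K lam mu1 mu2 a b piKK \/
     ((2 * lam)%R <> (mu1 + mu2)%R /\
      normalized K lam mu1 mu2 a b (corner_or0 K lam mu1 mu2 g1 g2 a b)) ->
     forall k : nat, in_cap K k = true -> a k = pi10 k /\ b k = pi01 k).
Proof.
  intros g1 g2 pi10 pi01 piKK.
  assert (HG1 : is_gpow lam mu1 mu2 (conv_pow g1)) by now apply conv_pow_is_gpow.
  assert (HG2 : is_gpow lam mu2 mu1 (conv_pow g2)).
  { apply conv_pow_is_gpow; try easy.
    now replace (2 * lam + mu2 + mu1) with (2 * lam + mu1 + mu2) by ring. }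
  set (m := fun j k => RtoC (pi j k)).
  assert (Hm : forall j k, net K lam mu1 mu2 p1 p2 m j k = 0)
    by now apply invariant_net.
  pose proof pi_inv as (pi_ge0 & pi_null & pi_sum & pi_1 & _).
  assert (Nm : null_off K m).
  { intros j k H. unfold m. now rewrite pi_null. }
  assert (N10 : null_seq K pi10).
  { intros l Hl. unfold pi10. now rewrite pi_null by now rewrite Hl. }
  assert (N01 : null_seq K pi01).
  { intros l Hl. unfold pi01. now rewrite pi_null by now rewrite Hl, andb_false_r. }
  destruct (balanced_expressions K lam mu1 mu2 p1 p2 (conv_pow g1) (conv_pow g2)
    lam_pos mu1_pos mu2_pos p_sum K_ge1 HG1 HG2 m Nm Hm) as (E1 & E2 & E3 & E4).
  assert (mu12n : mu1 + mu2 <> 0) by (rewrite <- RtoC_plus; apply RtoC_neq0; lra).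
  (* The corner value is linear in the boundary values: [c = 1] gives the last formula of (i),
     general c serves (ii) and (iii). *)
  assert (Ecorner : forall a b c n, K = Some n ->
    mask K a = (fun l => c * pi10 l) -> mask K b = (fun l => c * pi01 l) ->
    corner lam mu1 mu2 g1 g2 a b n = c * m n n).
  { intros a b c n EK Ea Eb.
    assert (n_pos : (0 < n)%nat) by (destruct n; [congruence|lia]).
    assert (E : (mu1 + mu2) * corner lam mu1 mu2 g1 g2 a b n
      = (mu1 + mu2) * (c * m n n)).
    { rewrite corner_off by easy. rewrite <- EK, Ea, Eb, !off_scal.
      transitivity (c * ((mu1 + mu2) * m n n)); [|ring].
      rewrite (E4 n EK), E1, E2 by lia. change (fun l => m l 0%nat) with pi10.
      change (fun l => m 0%nat l) with pi01. ring. }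
    transitivity (/ (mu1 + mu2) * ((mu1 + mu2) * corner lam mu1 mu2 g1 g2 a b n));
      [field; easy|]. rewrite E. field. easy. }
  assert (pi_le1 : forall j k, (Cmod (m j k) <= 1)%R).
  { intros j k. unfold m. rewrite Cmod_R, Rabs_pos_eq by easy. rewrite <- pi_1.
    now apply summable2_le. }
  assert (Hdiag : diag_relations K lam mu1 mu2 p1 p2 (conv_pow g1) (conv_pow g2)
    pi10 pi01 piKK).
  { apply (balanced_diag_relations K lam mu1 mu2 p1 p2 (conv_pow g1) (conv_pow g2)
      lam_pos mu1_pos mu2_pos p_sum K_ge1 HG1 HG2 m); try easy.
    intros n EK. unfold piKK. now rewrite EK. }
  assert (Hii : forall a b : nat -> C,
     admissible K lam mu1 mu2 g1 g2 a b ->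
     functional_equations_near0 K lam mu1 mu2 p1 p2 a b
       (corner_or0 K lam mu1 mu2 g1 g2 a b) ->
     exists c : C, forall k : nat, in_cap K k = true ->
       a k = c * pi10 k /\ b k = c * pi01 k).
  { intros a b Hab HFE.
    destruct (admissible_bounded K lam mu1 mu2 g1 g2 mu1_pos mu2_pos HG1 HG2 a b Hab)
      as [M HM].
    set (c0 := corner_or0 K lam mu1 mu2 g1 g2 a b) in *.
    apply (functional_equations_iff K lam mu1 mu2 p1 p2 (conv_pow g1) (conv_pow g2)
      lam_pos mu1_pos mu2_pos HG1 HG2 a b c0 M) in HFE; try apply HM.
    destruct (recon_adiag_bounded K lam mu1 mu2 g1 g2 mu1_pos mu2_pos HG1 HG2 a b
      c0 Hab) as [B HB].
    destruct (balanced_proportional K lam mu1 mu2 p1 p2 lam_pos mu1_pos mu2_pos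
      p1_ge0 p2_ge0 _ pi B 1 (recon_balanced K lam mu1 mu2 p1 p2 _ _ lam_pos mu1_pos
        mu2_pos p_sum K_ge1 HG1 HG2 _ _ c0 (null_seq_mask K a) (null_seq_mask K b) HFE
        (corner_or0_relation K lam mu1 mu2 g1 g2 mu1_pos mu2_pos HG1 HG2 a b K_ge1))
      Hm pi_ge0) as [c Hc].
    - generalize (invariant_origin_pos K lam mu1 mu2 p1 p2 pi lam_pos mu1_pos mu2_pos
        p1_ge0 p2_ge0 pi_inv). lra.
    - easy.
    - intros n. apply rsum_adiag_le; [easy|].
      now apply (invariant_is_sum2 K lam mu1 mu2 p1 p2).
    - exists c.
      (* At the origin proportionality concerns the diagonal formula; the relations of index 0
         transfer it to [a O] and [b O]. *)
      assert (Hc0 := Hc O O). rewrite recon_diag in Hc0.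
      destruct (HFE O) as [F1 F2]. unfold diag_relation in F1, F2.
      rewrite Hc0, (off_0 lam) in F1, F2 by easy.
      assert (mu1n := RtoC_neq0 mu1 mu1_pos). assert (mu2n := RtoC_neq0 mu2 mu2_pos).
      intros k Hk.
      assert (Ma : mask K a k = a k) by (unfold mask; now rewrite Hk).
      assert (Mb : mask K b k = b k) by (unfold mask; now rewrite Hk).
      destruct k as [|k].
      + rewrite <- Ma, <- Mb. split.
        * transitivity (/ mu2 * (mu2 * mask K a 0)); [field; easy|].
          rewrite F1. unfold pi10. field. easy.
        * transitivity (/ mu1 * (mu1 * mask K b 0)); [field; easy|].
          rewrite F2. unfold pi01. field. easy.
      + rewrite <- Ma, <- Mb. unfold pi10, pi01. rewrite <- !Hc.
        rewrite recon_below, recon_above, !(off_0 lam) by (easy || lia). easy. }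
  assert (Hmask : forall (a f : nat -> C) c, null_seq K f ->
    (forall k, in_cap K k = true -> a k = c * f k) -> mask K a = (fun l => c * f l)).
  { intros a f c Hf H. apply functional_extensionality. intros l. unfold mask.
    destruct (in_cap K l) eqn:E; [now apply H|]. rewrite Hf by easy. ring. }
  assert (Hcorner : forall a b c, (forall k, in_cap K k = true ->
       a k = c * pi10 k /\ b k = c * pi01 k) ->
     corner_or0 K lam mu1 mu2 g1 g2 a b = c * piKK).
  { intros a b c H. unfold corner_or0, piKK.
    destruct K as [n|] eqn:EK; [|ring]. rewrite <- EK in *.
    apply Ecorner; [easy| |]; apply Hmask; try easy; intros; now apply H. }
  split; [split; [|split]|split; [split|]].
  - intros j k Hjk _.
    rewrite (off_diag_off K lam mu1 mu2 g1), (off_diag_off K lam mu2 mu1 g2) by easy.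
    rewrite !mask_null by easy. split; [now apply E1|now apply E2].
  - intros k Hk. rewrite on_diag_dia, !mask_null by easy. apply E3.
    now rewrite Nat.add_1_r in Hk.
  - intros n EK. symmetry. rewrite (Ecorner _ _ 1 n EK); [unfold m; ring| |];
      rewrite mask_null by easy; apply functional_extensionality; intros; ring.
  - apply (functional_equations_iff K lam mu1 mu2 p1 p2 (conv_pow g1) (conv_pow g2)
      lam_pos mu1_pos mu2_pos HG1 HG2 pi10 pi01 piKK 1); rewrite !mask_null by easy;
      try easy; intros l; apply pi_le1.
  - intros a b Hab. split; [now apply Hii|]. intros [c Hc].
    rewrite (Hcorner a b c Hc).
    assert (Ea := Hmask a pi10 c N10 (fun k Hk => proj1 (Hc k Hk))).
    assert (Eb := Hmask b pi01 c N01 (fun k Hk => proj2 (Hc k Hk))).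
    apply (functional_equations_iff K lam mu1 mu2 p1 p2 (conv_pow g1) (conv_pow g2)
      lam_pos mu1_pos mu2_pos HG1 HG2 a b (c * piKK) (Cmod c)).
    + intros l. rewrite Ea, Cmod_mult. rewrite <- (Rmult_1_r (Cmod c)) at 2.
      apply Rmult_le_compat_l; [apply Cmod_ge_0|apply pi_le1].
    + intros l. rewrite Eb, Cmod_mult. rewrite <- (Rmult_1_r (Cmod c)) at 2.
      apply Rmult_le_compat_l; [apply Cmod_ge_0|apply pi_le1].
    + rewrite Ea, Eb. now apply diag_relations_scal.
  - destruct (invariant_normalized K lam mu1 mu2 p1 p2 pi lam_pos mu1_pos mu2_pos
      p1_ge0 p2_ge0 p_sum pi_inv) as [HN HN0].
    split; [exact HN|]. intros a b Hab HFE Hn.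
    destruct (Hii a b Hab HFE) as [c Hc].
    enough (c1 : c = 1) by (intros k Hk; destruct (Hc k Hk) as [-> ->]; rewrite c1;
      split; ring).
    rewrite (Hcorner a b c Hc) in Hn. unfold normalized in Hn, HN.
    fold pi10 pi01 piKK in HN, HN0.
    rewrite (gen_1_scal K (fun k => pi k O) c a) in Hn by (intros; now apply Hc).
    rewrite (gen_1_scal K (fun k => pi O k) c b) in Hn by (intros; now apply Hc).
    fold pi10 pi01 in Hn. set (X := gen K pi10 1) in *. set (Y := gen K pi01 1) in *.
    assert (Fin : forall u : C, u <> 0 -> u * (c - 1) = 0 -> c = 1).
    { intros u Hu E. transitivity (/ u * (u * (c - 1)) + 1); [field; easy|].
      rewrite E. ring. }
    (* If the corner term is that of [pi], only the left-hand side scales with c and its being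
       nonzero gives [c = 1]. If it is computed from a and b, subtracting c times the identity for
       [pi] leaves [(mu1 + mu2 - 2 lam) (c - 1) = 0]. *)
    destruct Hn as [Hn|[Hne Hn]].
    + apply (Fin _ HN0). rewrite <- HN in Hn.
      apply null_of_eq with (1 := eq_sym Hn). ring.
    + apply (Fin (mu1 + mu2 - 2 * lam)).
      * rewrite <- RtoC_mult, <- RtoC_plus, <- RtoC_minus. intros E.
        apply RtoC_inj in E. lra.
      * apply null_of_eq with (1 := eq_sym Hn).
        transitivity (c * (mu2 * X + mu1 * Y)
          - (mu1 + mu2 - 2 * lam * (1 - c * piKK))); [rewrite HN; ring|ring].
Qed.
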